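(* Up to isomorphism of compact quantum groups, the following is a complete list of PW-quantum groups of dimension $3$ (that is, every PW-quantum group of dimension $3$ is isomorphic to one in the list, and every member of the list is a PW-quantum group of dimension $3$): (1) $C(\mathbb{T}^2)$, the quantum version of the two-dimensional torus; (2) $U_q(2)$ for $q\in\mathbb{C}^*$; (3) $A_{p,k,m}(3)$ for $p\in\mathbb{C}^*$ and $k,m\in\{0,1,2\}$; (4) $SU_{p,m}(3)$ for $p\in\mathbb{C}^*$ and $m\in\{0,1,2\}$.
   Context: $\mathbb{C}^*=\mathbb{C}\setminus\{0\}$ and $\zeta=e^{\frac23 i\pi}$. PW-quantum groups: let $E=[E_{i_1i_2i_3}]_{i_1,i_2,i_3=1}^3$ be an array of complex numbers satisfying the permutation condition: $E_{i_1i_2i_3}\neq0$ if and only if $(i_1,i_2,i_3)$ is a permutation of $(1,2,3)$. Let $\mathsf A$ be the universal unital C$^*$-algebra generated by the entries of a matrix $u=[u_{jk}]_{j,k=1}^3$ subject to the unitarity condition $\sum_{s}u_{js}u_{ks}^*=\delta_{jk}1=\sum_s u_{sj}^*u_{sk}$ and the twisted determinant condition $\sum_{i_1,i_2,i_3}E_{i_1i_2i_3}u_{a_1i_1}u_{a_2i_2}u_{a_3i_3}=E_{a_1a_2a_3}1$ for all $a_1,a_2,a_3\in\{1,2,3\}$. With $\Delta(u_{jk})=\sum_s u_{js}\otimes u_{sk}$, the pair $(\mathsf A,u)$ is a compact quantum group (Woronowicz construction); it is called the PW-quantum group of dimension $3$ related to $E$. An isomorphism of compact quantum groups is a $*$-isomorphism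 of the C$^*$-algebras intertwining the comultiplications. $C(\mathbb{T}^2)$ has the comultiplication dual to the group multiplication of $\mathbb T^2$. $U_q(2)$, $q=|q|e^{it}\in\mathbb C^*$: the universal unital C$^*$-algebra generated by $a,c,v$ with relations $ac=\bar q\,ca$, $ac^*=q\,c^*a$, $a^*a+c^*c=1$, $aa^*+|q|^2c^*c=1$, $cc^*=c^*c$, $vv^*=v^*v=1$, $av=va$, $cv=e^{-2it}vc$, with quantum group structure imposed by the fundamental corepresentation $u=\begin{pmatrix}v&0&0\\0&a&-q\,c^*v^*\\0&c&a^*v^*\end{pmatrix}$. $A_{p,k,m}(3)$: the PW-quantum group related to $E_{123}=1$, $E_{132}=p$, $E_{213}=p\zeta^k$, $E_{231}=\zeta^m$, $E_{312}=\zeta^{-m}$, $E_{321}=p\zeta^{-k}$ (all other entries $0$). $SU_{p,m}(3)$: the PW-quantum group related to $E_{123}=1$, $E_{132}=p$, $E_{213}=p\zeta^{-m}$, $E_{231}=|p|^2\zeta^m$, $E_{312}=|p|^2\zeta^{-m}$, $E_{321}=|p|^2p\,\zeta^m$ (all other entries $0$). *)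

(* Defs.v *)
From HB Require Import structures.
From mathcomp Require Import all_boot all_order all_algebra.
From mathcomp Require Import complex.
From mathcomp Require Import all_classical all_reals all_analysis.

Set Implicit Arguments.
Unset Strict Implicit.
Unset Printing Implicit Defensive.

Import Order.TTheory GRing.Theory Num.Theory.
Import numFieldNormedType.Exports.

Local Open Scope classical_set_scope.
Local Open Scope ring_scope.

(* Typing [complex R] as a [numClosedFieldType] gives it the topology and norm of
   MathComp-Analysis; its norm and the norms below take values in [C R]. *)
Definition C (R : realType) : numClosedFieldType := complex R.

(* Unital C*-algebras. [algType] imposes 1 != 0, so the zero algebra is left
   out; it has no influence on the universal properties below. The norm is a
   field of the structure because Hierarchy Builder lacks the join of
   normed modules and algebras. *)
HB.mixin Record isCStarAlgebra (R : realType) A & GRing.Algebra (C R) A := {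
  star : A -> A;
  starD : forall x y, star (x + y) = star x + star y;
  starZ : forall (z : C R) x, star (z *: x) = z^* *: star x;
  starM : forall x y, star (x * y) = star y * star x;
  starK : forall x, star (star x) = x;
  cnorm : A -> C R;
  cnormD : forall x y, cnorm (x + y) <= cnorm x + cnorm y;
  cnormZ : forall (z : C R) x, cnorm (z *: x) = `|z| * cnorm x;
  cnorm_eq0 : forall x, cnorm x = 0 -> x = 0;
  cnormM : forall x y, cnorm (x * y) <= cnorm x * cnorm y;
  cnorm_star : forall x, cnorm (star x * x) = cnorm x ^+ 2;
  cnorm_complete : forall w : nat -> A,
    (forall e : C R, 0 < e -> exists N, forall m n,
       (N <= m)%N -> (N <= n)%N -> cnorm (w m - w n) < e) ->
    exists x, forall e : C R, 0 < e -> exists N, forall n,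
       (N <= n)%N -> cnorm (w n - x) < e
}.

#[short(type="cstarType")]
HB.structure Definition CStarAlgebra (R : realType) :=
  {A of isCStarAlgebra R A & GRing.Algebra (C R) A}.

Definition dense_span (R : realType) (A B T : cstarType R)
    (op : A -> B -> T) : Prop :=
  forall (x : T) (e : C R), 0 < e ->
    exists s : seq (A * B), cnorm (x - \sum_(p <- s) op p.1 p.2) < e.

Definition star_preserving (R : realType) (A B : cstarType R) (f : A -> B) :=
  forall x, f (star x) = star (f x).

HB.mixin Record isHilbert (R : realType) H
    & CompleteNormedModule (C R) H := {
  inner : H -> H -> C R;
  innerP : forall (z : C R) x y w,
    inner (z *: x + y) w = z * inner x w + inner y w;
  innerC : forall x y, inner y x = (inner x y)^*;
  inner_norm : forall x : H, `|x| ^+ 2 = inner x x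
}.

#[short(type="hilbertType")]
HB.structure Definition Hilbert (R : realType) :=
  {H of isHilbert R H & CompleteNormedModule (C R) H}.

Definition representation (R : realType) (A : cstarType R) (H : hilbertType R)
    (rho : A -> {linear H -> H}) : Prop :=
  [/\ forall a, continuous (rho a),
      forall (z : C R) a b x, rho (z *: a + b) x = z *: rho a x + rho b x,
      forall a b x, rho (a * b) x = rho a (rho b x),
      forall x, rho 1 x = x
    & forall a x y, inner (rho (star a) x) y = inner x (rho a y)].

(* A list of pairs [t : seq (H * K)] stands for the sum of the elementary
   tensors [v.1 (x) v.2], [v <- t]; such sums are dense in the Hilbert space
   tensor product of H and K, where their squared norm is [tensor_norm2 t]. *)
Definition tensor_norm2 (R : realType) (H K : hilbertType R)
    (t : seq (H * K)) : C R :=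
  \sum_(v <- t) \sum_(w <- t) inner v.1 w.1 * inner v.2 w.2.

Definition tensor_act (R : realType) (A B : cstarType R) (H K : hilbertType R)
    (rho : A -> {linear H -> H}) (sigma : B -> {linear K -> K})
    (s : seq (A * B)) (t : seq (H * K)) : seq (H * K) :=
  [seq (rho p.1 v.1, sigma p.2 v.2) | p <- s, v <- t].

(* M bounds the operator norm of [(rho (x) sigma) s] for all representations
   rho of A and sigma of B: the spatial norm of s is the least such M. *)
Definition spatial_bound (R : realType) (A B : cstarType R)
    (s : seq (A * B)) (M : C R) : Prop :=
  forall (H K : hilbertType R) (rho : A -> {linear H -> H})
    (sigma : B -> {linear K -> K}),
    representation rho -> representation sigma ->
    forall t : seq (H * K),
      tensor_norm2 (tensor_act rho sigma s t) <= M ^+ 2 * tensor_norm2 t.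

(* T, with [leg1 a = a (x) 1] and [leg2 b = 1 (x) b], is the minimal (spatial)
   tensor product of A and B. *)
Definition is_tensor (R : realType) (A B T : cstarType R)
    (leg1 : {lrmorphism A -> T}) (leg2 : {lrmorphism B -> T}) : Prop :=
  [/\ star_preserving leg1,
      star_preserving leg2,
      forall a b, leg1 a * leg2 b = leg2 b * leg1 a,
      dense_span (fun a b => leg1 a * leg2 b)
    & forall (s : seq (A * B)) (M : C R), 0 <= M ->
        cnorm (\sum_(p <- s) leg1 p.1 * leg2 p.2) <= M <-> spatial_bound s M].

(* [d12], [d23] and [e] are [comul (x) id], [id (x) comul] and
   [x |-> 1 (x) x], from A (x) A to (A (x) A) (x) A. *)
Definition coassociative (R : realType) (A T : cstarType R)
    (leg1 leg2 comul : {lrmorphism A -> T}) : Prop :=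
  forall (S : cstarType R) (k1 : {lrmorphism T -> S}) (k2 : {lrmorphism A -> S})
    (e d12 d23 : {lrmorphism T -> S}),
    is_tensor k1 k2 ->
    star_preserving e -> star_preserving d12 -> star_preserving d23 ->
    (forall a, e (leg1 a) = k1 (leg2 a)) ->
    (forall a, e (leg2 a) = k2 a) ->
    (forall a, d12 (leg1 a) = k1 (comul a)) ->
    (forall a, d12 (leg2 a) = k2 a) ->
    (forall a, d23 (leg1 a) = k1 (leg1 a)) ->
    (forall a, d23 (leg2 a) = e (comul a)) ->
    forall a, d12 (comul a) = d23 (comul a).

Definition cancellation (R : realType) (A T : cstarType R)
    (leg1 leg2 comul : {lrmorphism A -> T}) : Prop :=
  dense_span (fun a b => comul a * leg1 b) /\
  dense_span (fun a b => comul a * leg2 b).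

Record cqg (R : realType) := Cqg {
  alg : cstarType R;
  alg2 : cstarType R;
  leg1 : {lrmorphism alg -> alg2};
  leg2 : {lrmorphism alg -> alg2};
  comul : {lrmorphism alg -> alg2};
  _ : is_tensor leg1 leg2;
  _ : star_preserving comul;
  _ : coassociative leg1 leg2 comul;
  _ : cancellation leg1 leg2 comul
}.

(* [f2] is [f (x) f]. *)
Definition cqg_iso (R : realType) (G H : cqg R) : Prop :=
  exists (f : {lrmorphism alg G -> alg H}) (f2 : {lrmorphism alg2 G -> alg2 H}),
    [/\ star_preserving f /\ star_preserving f2,
        bijective f,
        forall a, f2 (leg1 G a) = leg1 H (f a),
        forall a, f2 (leg2 G a) = leg2 H (f a)
      & forall a, f2 (comul G a) = comul H (f a)].

(* A with the family u is the universal unital C*-algebra generated by a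
   family indexed by I and subject to the relations P. *)
Definition universal (R : realType) (I : Type)
    (P : forall B : cstarType R, (I -> B) -> Prop)
    (A : cstarType R) (u : I -> A) : Prop :=
  P A u /\
  forall (B : cstarType R) (b : I -> B), P B b ->
    exists f : {lrmorphism A -> B},
      [/\ star_preserving f,
          forall i, f (u i) = b i
        & forall g : {lrmorphism A -> B}, star_preserving g ->
            (forall i, g (u i) = b i) -> g =1 f].

Definition corepresentation (R : realType) (G : cqg R)
    (u : 'I_3 -> 'I_3 -> alg G) : Prop :=
  forall j k, comul G (u j k) = \sum_s leg1 G (u j s) * leg2 G (u s k).

(* The indices 1, 2, 3 are represented by 0, 1, 2 in ['I_3]. *)
Definition array (R : realType) := 'I_3 -> 'I_3 -> 'I_3 -> C R.

Definition permutation_condition (R : realType) (E : array R) : Prop :=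
  forall i1 i2 i3, E i1 i2 i3 != 0 <-> perm_eq [:: i1; i2; i3] (enum 'I_3).

Definition PW_relations (R : realType) (E : array R) (B : cstarType R)
    (u : 'I_3 * 'I_3 -> B) : Prop :=
  [/\ forall j k, \sum_s u (j, s) * star (u (k, s)) = (j == k)%:R,
      forall j k, \sum_s star (u (s, j)) * u (s, k) = (j == k)%:R
    & forall a1 a2 a3,
        \sum_i1 \sum_i2 \sum_i3
          E i1 i2 i3 *: (u (a1, i1) * u (a2, i2) * u (a3, i3))
        = E a1 a2 a3 *: 1].

Definition PW_quantum_group (R : realType) (E : array R) (G : cqg R) : Prop :=
  exists u : 'I_3 * 'I_3 -> alg G,
    universal (@PW_relations R E) u /\ corepresentation (fun j k => u (j, k)).

(* [ev] identifies A with the C*-algebra of continuous functions on the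
   (compact, nonempty) set K. *)
Definition is_continuous_functions (R : realType) (X : topologicalType)
    (K : set X) (A : cstarType R) (ev : A -> X -> C R) : Prop :=
  [/\ (forall a, {within K, continuous (ev a)}) /\
      (forall f : X -> C R, {within K, continuous f} ->
         exists a, forall x, K x -> ev a x = f x),
      (forall (z : C R) a b x, K x -> ev (z *: a + b) x = z * ev a x + ev b x),
      (forall a b x, K x -> ev (a * b) x = ev a x * ev b x) /\
      (forall x, K x -> ev 1 x = 1),
      (forall a x, K x -> ev (star a) x = (ev a x)^*)
    & (forall a (M : C R), cnorm a <= M <-> forall x, K x -> `|ev a x| <= M)].

Definition torus2 (R : realType) : set (C R * C R) :=
  [set z | `|z.1| = 1 /\ `|z.2| = 1].

(* The tensor square of C(T^2) is C(T^2 x T^2), and the comultiplication sends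
   f to the function (z, w) |-> f (z w). *)
Definition is_torus_group (R : realType) (G : cqg R) : Prop :=
  exists (ev : alg G -> C R * C R -> C R)
         (ev2 : alg2 G -> (C R * C R) * (C R * C R) -> C R),
    [/\ is_continuous_functions (@torus2 R) ev,
        is_continuous_functions (@torus2 R `*` @torus2 R) ev2
      & forall a z w, torus2 z -> torus2 w ->
          [/\ ev2 (leg1 G a) (z, w) = ev a z,
              ev2 (leg2 G a) (z, w) = ev a w
            & ev2 (comul G a) (z, w) = ev a (z.1 * w.1, z.2 * w.2)]].

Inductive Uq2_generator := gen_a | gen_c | gen_v.

(* If q = |q| e^(it), then [(q / `|q|) ^- 2] is e^(-2it). *)
Definition Uq2_relations (R : realType) (q : C R) (B : cstarType R)
    (x : Uq2_generator -> B) : Prop :=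
  let a := x gen_a in let c := x gen_c in let v := x gen_v in
  [/\ a * c = q^* *: (c * a) /\ a * star c = q *: (star c * a),
      star a * a + star c * c = 1 /\
        a * star a + `|q| ^+ 2 *: (star c * c) = 1,
      c * star c = star c * c,
      v * star v = 1 /\ star v * v = 1
    & a * v = v * a /\ c * v = (q / `|q|) ^- 2 *: (v * c)].

Definition Uq2_matrix (R : realType) (q : C R) (B : cstarType R)
    (x : Uq2_generator -> B) : 'I_3 -> 'I_3 -> B :=
  let a := x gen_a in let c := x gen_c in let v := x gen_v in
  fun j k =>
    match nat_of_ord j, nat_of_ord k with
    | 0%N, 0%N => v
    | 1%N, 1%N => a
    | 1%N, 2%N => - (q *: (star c * star v))
    | 2%N, 1%N => c
    | 2%N, 2%N => star a * star v
    | _, _ => 0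
    end.

Definition is_Uq2 (R : realType) (q : C R) (G : cqg R) : Prop :=
  exists x : Uq2_generator -> alg G,
    universal (@Uq2_relations R q) x /\ corepresentation (Uq2_matrix q x).

Definition perm_array (R : realType) (e123 e132 e213 e231 e312 e321 : C R) :
    array R := fun i1 i2 i3 =>
  match nat_of_ord i1, nat_of_ord i2, nat_of_ord i3 with
  | 0%N, 1%N, 2%N => e123
  | 0%N, 2%N, 1%N => e132
  | 1%N, 0%N, 2%N => e213
  | 1%N, 2%N, 0%N => e231
  | 2%N, 0%N, 1%N => e312
  | 2%N, 1%N, 0%N => e321
  | _, _, _ => 0
  end.

(* e^(2 i pi / 3) *)
Definition zeta (R : realType) : C R :=
  (cos (2 / 3 * pi) +i* sin (2 / 3 * pi))%C.

Definition A_array (R : realType) (p : C R) (k m : 'I_3) : array R :=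
  perm_array 1 p (p * zeta R ^+ k) (zeta R ^+ m) (zeta R ^- m)
    (p * zeta R ^- k).

Definition SU_array (R : realType) (p : C R) (m : 'I_3) : array R :=
  perm_array 1 p (p * zeta R ^- m) (`|p| ^+ 2 * zeta R ^+ m)
    (`|p| ^+ 2 * zeta R ^- m) (`|p| ^+ 2 * p * zeta R ^+ m).

Inductive listed (R : realType) :=
  | Torus
  | Uq2 (q : C R)
  | Apkm (p : C R) (k m : 'I_3)
  | SUpm (p : C R) (m : 'I_3).
Arguments Torus {R}.

Definition admissible (R : realType) (l : listed R) : Prop :=
  match l with
  | Torus => True
  | Uq2 q => q != 0
  | Apkm p _ _ => p != 0
  | SUpm p _ => p != 0
  end.

Definition is_member (R : realType) (l : listed R) (G : cqg R) : Prop :=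
  match l with
  | Torus => is_torus_group G
  | Uq2 q => is_Uq2 q G
  | Apkm p k m => PW_quantum_group (A_array p k m) G
  | SUpm p m => PW_quantum_group (SU_array p m) G
  end.

(* Main.v *)
Require Import Defs.
From HB Require Import structures.
From mathcomp Require Import all_boot all_order all_algebra.
From mathcomp Require Import perm cyclic separable cyclotomic.
From mathcomp Require Import complex ring lra.
From mathcomp Require Import all_classical all_reals all_analysis.

(** The determinant condition says that u (x) u (x) u fixes the tensor E. Cancelling
    one factor by unitarity shows that the vectors E (e_l, -, -) on the one hand, and
    the vectors E (-, -, e_l) on the other hand, span subspaces invariant under
    u (x) u (cancel1, cancel2_star). As E is supported on permutations, the vectors
    of each family are orthogonal, and comparing the two families gives two diagonal
    matrices that commute with u (rotation_intertwines, weight_intertwines). The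
    entry u_jk vanishes when such a matrix has different eigenvalues at j and k.

    If an eigenvalue occurs only once, u is the sum of an entry v and of a 2 x 2 block.
    The faces of the determinant condition then amount to the relations of U_q(2)
    (block_Uq2, Uq2_PW), or they contradict each other and force u to be diagonal
    (block_diagonal).

    If both matrices are scalar, Lagrange's identity (side_det_norm) shows that
    either all pairs of vectors E (e_l, -, -), E (-, -, e_l) are parallel, or none is.
    In the first case the equality of the eigenvalues is a system of equations for
    the entries of E, whose solutions are the arrays of A_{p,k,m}(3) and SU_{p,m}(3)
    up to scaling and renumbering (pos_cube, parallel_sides_classified). In the second
    case products of distinct entries in a row or in a column of u vanish
    (products_vanish): the entries are normal partial isometries whose projections
    form a magic unitary. The projection that belongs to a permutation of the indices
    vanishes unless E is covariant under it (cyclic_obstruction), so E is an array of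
    A_{p,k,m}(3) or u is diagonal.

    Isomorphisms are identities throughout: presentations are compared by exchanging
    generators (universal_transfer). For diagonal u the algebra is the universal one
    generated by two commuting unitaries, to be identified with the functions on the
    torus. Its characters come from the universal property and those of its tensor
    square from one-dimensional representations (tensor_character). They compute the
    norm, as a *-polynomial in commuting unitaries has norm at most its supremum over
    the torus (cnorm_speval_le), which follows from discrete Fourier interpolation
    applied to high powers. Averages against Fejer kernels are dense in the continuous
    functions (trig_approx), and *-homomorphisms are contractive
    (star_hom_contractive), so both sides are completions of the same *-polynomials. *)

Set Implicit Arguments.
Unset Strict Implicit.
Unset Printing Implicit Defensive.
Import Order.TTheory GRing.Theory Num.Theory.
Import numFieldNormedType.Exports.
Local Open Scope classical_set_scope.
Local Open Scope ring_scope.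

(** * Scalars and norms in C*-algebras *)

Section Scalars.
Variable R : realType.

Lemma archi_C (x : C R) : 0 <= x -> exists n : nat, x < n.+1%:R.
Proof.
case: x => a b; rewrite lecE /= => /andP[/eqP -> a0].
have h := truncnS_gt a.
exists (Num.trunc a); rewrite ltcE.
have -> : ((Num.trunc a).+1%:R : C R) = ((Num.trunc a).+1%:R : R)%:C%C.
  by rewrite -[RHS]/(real_complex R _) rmorph_nat.
by rewrite /= eqxx.
Qed.

(** If x > M, the powers (x / M) ^ (2 ^ k) grow faster than any multiple of
    2 ^ k: this is Bernoulli's inequality, squared. *)
Lemma ler_of_pow2 (x M B : C R) : 0 <= x -> 0 <= M -> 0 <= B ->
  (forall k, x ^+ (2 ^ k) <= B * (2 ^ k)%:R * M ^+ (2 ^ k)) -> x <= M.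
Proof.
move=> x0 M0 B0 H.
have [//|Mx] := real_leP (ger0_real x0) (ger0_real M0).
move: M0; rewrite le_eqVlt => /orP[/eqP M0|M0].
  by have := H 0%N; rewrite expn0 !expr1 -M0 mulr0 => /(lt_le_trans Mx); rewrite -M0 ltxx.
have bern (d : C R) n : 0 <= d -> 1 + n%:R * d <= (1 + d) ^+ n.
  move=> d0; elim: n => [|n IH]; first by rewrite mul0r addr0 expr0.
  rewrite exprS; apply: le_trans (ler_wpM2l (addr_ge0 ler01 d0) IH).
  rewrite -subr_ge0 -natr1.
  have -> : (1 + d) * (1 + n%:R * d) - (1 + (n%:R + 1) * d) = n%:R * (d * d).
    by ring.
  by rewrite mulr_ge0 // mulr_ge0.
pose d := x / M - 1.
have d0 : 0 < d by rewrite subr_gt0 ltr_pdivlMr // mul1r.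
have [n hn] : exists n : nat, 2%:R * B / d ^+ 2 < n.+1%:R.
  by apply: archi_C; rewrite divr_ge0 ?exprn_ge0 ?mulr_ge0 ?ler0n // ltW.
have Hk k : (2 ^ k)%:R * d ^+ 2 <= 2%:R * B.
  have h := H k.+1.
  have e1 : (x / M) ^+ (2 ^ k.+1) <= B * (2 ^ k.+1)%:R.
    by rewrite expr_div_n ler_pdivrMr ?exprn_gt0.
  have e2 : ((2 ^ k)%:R * d) ^+ 2 <= (x / M) ^+ (2 ^ k.+1).
    have -> : x / M = 1 + d by rewrite /d addrC subrK.
    rewrite expnSr exprM; apply: lerXn2r; rewrite ?nnegrE.
    - by rewrite mulr_ge0 // ltW.
    - by rewrite exprn_ge0 // addr_ge0 // ltW.
    by apply: le_trans (bern _ _ (ltW d0)); rewrite lerDr.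
  have := le_trans e2 e1; rewrite exprMn [(_ ^ k.+1)%N]expnS natrM.
  have p2 : 0 < (2 ^ k)%:R :> C R by rewrite ltr0n expn_gt0.
  move=> h2; rewrite -(ler_pM2l p2).
  move: p2 h2; set P : C R := (2 ^ k)%:R => _.
  have -> : P * (P * d ^+ 2) = P ^+ 2 * d ^+ 2 by ring.
  by have -> : P * (2%:R * B) = B * (2%:R * P) by ring.
have := Hk n; rewrite -ler_pdivlMr ?exprn_gt0 // => /le_lt_trans/(_ hn).
by rewrite ltr_nat ltnS leqNgt ltn_expl.
Qed.
End Scalars.

Section CstarBasics.
Variables (R : realType) (A : cstarType R).
Implicit Types a b : A.

Lemma star0 : star (0 : A) = 0.
Proof. by have := starZ 0 (0 : A); rewrite scale0r conjC0 scale0r. Qed.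

Lemma starN a : star (- a) = - star a.
Proof. by rewrite -scaleN1r starZ rmorphN1 scaleN1r. Qed.

Lemma starB a b : star (a - b) = star a - star b.
Proof. by rewrite starD starN. Qed.

Lemma star1 : star (1 : A) = 1.
Proof. by rewrite -[LHS]mulr1 -[X in _ * X]starK -starM mulr1 starK. Qed.

Lemma star_sum (I : Type) (r : seq I) (P : pred I) (F : I -> A) :
  star (\sum_(i <- r | P i) F i) = \sum_(i <- r | P i) star (F i).
Proof. by apply: (big_morph star (id1 := 0) starD star0). Qed.

Lemma star_exp a n : star (a ^+ n) = star a ^+ n.
Proof. by elim: n => [|n IH]; rewrite ?expr0 ?star1 // exprS starM IH exprSr. Qed.

Lemma cnorm0 : cnorm (0 : A) = 0.
Proof. by rewrite -(scale0r (0 : A)) cnormZ normr0 mul0r. Qed.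

Lemma cnormN a : cnorm (- a) = cnorm a.
Proof. by rewrite -scaleN1r cnormZ normrN1 mul1r. Qed.

Lemma cnorm_ge0 a : 0 <= cnorm a.
Proof.
have := cnormD a (- a); rewrite subrr cnorm0 cnormN -mulr2n.
by rewrite pmulrn_lge0.
Qed.

Lemma cnormB a b : cnorm (a - b) <= cnorm a + cnorm b.
Proof. by rewrite -[cnorm b]cnormN cnormD. Qed.

Lemma cnorm_distC a b : cnorm (a - b) = cnorm (b - a).
Proof. by rewrite -cnormN opprB. Qed.

Lemma cnorm_dist b a c : cnorm (a - c) <= cnorm (a - b) + cnorm (b - c).
Proof. by apply: le_trans (cnormD _ _); rewrite addrA subrK. Qed.

Lemma cnorm_sum (I : Type) (r : seq I) (P : pred I) (F : I -> A) :
  cnorm (\sum_(i <- r | P i) F i) <= \sum_(i <- r | P i) cnorm (F i).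
Proof.
elim/big_rec2: _ => [|i y x _ h]; first by rewrite cnorm0.
by apply: le_trans (cnormD _ _) _; rewrite lerD2l.
Qed.

(** The C*-identity and submultiplicativity bound the norm of b by that of
    its adjoint. *)
Lemma cnorm_starE a : cnorm (star a) = cnorm a.
Proof.
have le b : cnorm b <= cnorm (star b).
  have := cnormM (star b) b; rewrite cnorm_star expr2.
  have := cnorm_ge0 b; rewrite le_eqVlt => /orP[/eqP <- _|b0].
    exact: cnorm_ge0.
  by rewrite ler_pM2r.
by apply/eqP; rewrite eq_le le andbT; apply: le_trans (le _) _; rewrite starK.
Qed.

Lemma cnorm1 : cnorm (1 : A) = 1.
Proof.
have h : cnorm (1 : A) != 0.
  by apply/eqP => /cnorm_eq0 /eqP; rewrite oner_eq0.
have := cnorm_star (1 : A); rewrite star1 mulr1 expr2 => h2.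
by apply/(mulfI h); rewrite mulr1 -h2.
Qed.

Lemma star_mul_eq0 a : star a * a = 0 -> a = 0.
Proof.
move=> h; apply: cnorm_eq0; have := cnorm_star a; rewrite h cnorm0.
by move/esym/eqP; rewrite expf_eq0 /= => /eqP.
Qed.

Definition unitary a := star a * a = 1 /\ a * star a = 1.

Lemma cnorm_mul_unitary u a : unitary u -> cnorm (u * a) = cnorm a.
Proof.
move=> [h _]; apply/eqP; rewrite -(@eqrXn2 _ 2) ?cnorm_ge0 //.
by rewrite -!cnorm_star starM -mulrA [star u * _]mulrA h mul1r.
Qed.

Lemma cnorm_unitary u : unitary u -> cnorm u = 1.
Proof. by move=> hu; rewrite -[u]mulr1 cnorm_mul_unitary // cnorm1. Qed.

Lemma cnorm_unitaryX u n : unitary u -> cnorm (u ^+ n) = 1.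
Proof.
move=> hu; elim: n => [|n IH]; first by rewrite expr0 cnorm1.
by rewrite exprS cnorm_mul_unitary.
Qed.

Lemma cnormX_le a n : cnorm (a ^+ n) <= cnorm a ^+ n.
Proof.
elim: n => [|n IH]; first by rewrite !expr0 cnorm1.
rewrite !exprS; apply: le_trans (cnormM _ _) _.
by rewrite ler_wpM2l // cnorm_ge0.
Qed.

(** The C*-identity gives the case k = 1 for self-adjoint elements, hence all k by
    iteration; a normal element reduces to its square modulus. *)
Lemma cnorm_normal_pow2 a k : star a * a = a * star a ->
  cnorm (a ^+ (2 ^ k)) = cnorm a ^+ (2 ^ k).
Proof.
have sa (h : A) j : star h = h -> cnorm (h ^+ (2 ^ j)) = cnorm h ^+ (2 ^ j).
  move=> hh; elim: j => [|j IH]; first by rewrite expn0 !expr1.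
  by rewrite expnSr !exprM -IH -cnorm_star star_exp hh -expr2.
move=> na; apply/eqP; rewrite -(@eqrXn2 _ 2) ?cnorm_ge0 ?exprn_ge0 ?cnorm_ge0 //.
rewrite -cnorm_star star_exp -exprMn_comm // sa; last by rewrite starM starK.
by rewrite cnorm_star -!exprM mulnC.
Qed.
End CstarBasics.

(** * Contractivity of *-homomorphisms *)

Section Convergence.
Variables (R : realType).

Lemma half_pow_lt (c e : C R) : 0 <= c -> 0 < e -> exists n, c / 2 ^+ n < e.
Proof.
move=> c0 e0; have [n hn] := archi_C (divr_ge0 c0 (ltW e0)).
exists n; rewrite ltr_pdivrMr ?exprn_gt0 //.
rewrite ltr_pdivrMr // in hn; apply: (lt_le_trans hn); rewrite mulrC.
by rewrite ler_pM2l // -natrX ler_nat ltn_expl.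
Qed.

Lemma le_of_half_pow (x y c : C R) : 0 <= x -> 0 <= y -> 0 <= c ->
  (forall n, x <= y + c / 2 ^+ n) -> x <= y.
Proof.
move=> x0 y0 c0 h; case: (real_leP (ger0_real x0) (ger0_real y0)) => // yx.
have xy : 0 < x - y by rewrite subr_gt0.
have [n hn] := half_pow_lt c0 xy.
have := le_lt_trans (h n) (_ : _ < y + (x - y)); rewrite ltrD2l => /(_ hn).
by rewrite addrC subrK ltxx.
Qed.

Lemma le_of_eps (x y : C R) : 0 <= x -> 0 <= y ->
  (forall e, 0 < e -> x <= y + e) -> x <= y.
Proof.
move=> x0 y0 h; apply: (@le_of_half_pow _ _ 1) => // n.
by apply: h; rewrite divr_gt0 ?exprn_gt0.
Qed.

Variable A : cstarType R.

Lemma eq_of_half_pow (x y : A) c : 0 <= c ->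
  (forall n, cnorm (x - y) <= c / 2 ^+ n) -> x = y.
Proof.
move=> c0 h; apply/eqP; rewrite -subr_eq0; apply/eqP/cnorm_eq0.
apply/eqP; rewrite eq_le cnorm_ge0 andbT.
by apply: (le_of_half_pow (cnorm_ge0 _) _ c0) => // n; rewrite add0r.
Qed.

Lemma eq_of_eps (x y : A) : (forall e, 0 < e -> cnorm (x - y) <= e) -> x = y.
Proof.
move=> h; apply: (@eq_of_half_pow _ _ 1) => // n.
by apply: h; rewrite divr_gt0 ?exprn_gt0.
Qed.

(** The distances to the limit are bounded by the tail of the geometric series. *)
Lemma cvg_half_pow (w : nat -> A) c : 0 <= c ->
  (forall n, cnorm (w n.+1 - w n) <= c / 2 ^+ n) ->
  exists x, forall n, cnorm (w n - x) <= 2 * c / 2 ^+ n.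
Proof.
move=> c0 h.
have ne n : (2 : C R) ^+ n != 0 by rewrite expf_neq0.
have step n k : cnorm (w (n + k)%N - w n) <= 2 * c / 2 ^+ n - 2 * c / 2 ^+ (n + k).
  elim: k => [|k IH]; first by rewrite addn0 !subrr cnorm0.
  rewrite addnS; have -> : w (n + k).+1 - w n =
    (w (n + k).+1 - w (n + k)%N) + (w (n + k)%N - w n) by rewrite addrA subrK.
  apply: le_trans (cnormD _ _) _; apply: le_trans (lerD (h _) IH) _.
  rewrite le_eqVlt; apply/orP; left; apply/eqP.
  rewrite [2 ^+ (n + k).+1]exprS; move: (ne n) (ne (n + k)%N).
  by set P := 2 ^+ n; set Q := 2 ^+ (n + k) => P0 Q0; field; rewrite P0 Q0.
have p0 n : 0 < 2 ^+ n :> C R by rewrite exprn_gt0.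
have bnd n k : cnorm (w (n + k)%N - w n) <= 2 * c / 2 ^+ n.
  apply: le_trans (step n k) _; rewrite gerBl divr_ge0 ?mulr_ge0 //.
have c2 : 0 <= 2 * c by rewrite mulr_ge0.
have [x hx] : exists x, forall e : C R, 0 < e -> exists N, forall n,
       (N <= n)%N -> cnorm (w n - x) < e.
  apply: cnorm_complete => e e0.
  have e2 : 0 < e / 2 by rewrite divr_gt0.
  have [N hN] := half_pow_lt c2 e2; exists N => m n Nm Nn.
  have -> : w m - w n = (w m - w N) - (w n - w N) by rewrite opprB addrA subrK.
  apply: le_lt_trans (cnormB _ _) _.
  rewrite -(subnKC Nm) -(subnKC Nn) [e]splitr.
  by rewrite ltrD // (le_lt_trans (bnd _ _) hN).
exists x => n; apply: le_of_eps (cnorm_ge0 _) _ _ => [|e e0].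
  by rewrite divr_ge0 // ltW // p0.
have [N hN] := hx _ e0.
have -> : w n - x = - (w (n + N)%N - w n) + (w (n + N)%N - x).
  by rewrite opprB addrA subrK.
apply: le_trans (cnormD _ _) _; rewrite cnormN lerD ?bnd //.
by apply/ltW/hN; rewrite leq_addl.
Qed.

End Convergence.

Section Contractive.
Variable R : realType.

Lemma cnorm_sqrB (A : cstarType R) (x y : A) :
  cnorm (x ^+ 2 - y ^+ 2) <= (cnorm x + cnorm y) * cnorm (x - y).
Proof.
have -> : x ^+ 2 - y ^+ 2 = x * (x - y) + (x - y) * y.
  by rewrite mulrBr mulrBl addrA subrK !expr2.
apply: le_trans (cnormD _ _) _.
rewrite [leRHS]mulrDl lerD ?cnormM //.
by apply: le_trans (cnormM _ _) _; rewrite mulrC.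
Qed.

(** The element 1 - s solves y = (a ^ 2 + y ^ 2) / 2; since a ^ 2 is small, the
    right-hand side is a contraction of the ball of radius 1/2, so that y exists by
    iteration and inherits from the iterates that it is self-adjoint and commutes
    with a. *)
Lemma sqrt_one_sub (A : cstarType R) (a : A) : star a = a -> cnorm a <= 2^-1 ->
  exists s : A, [/\ star s = s, a * s = s * a & s ^+ 2 = 1 - a ^+ 2].
Proof.
move=> sa na; pose h := a ^+ 2; pose k : C R := 2^-1.
have k0 : 0 <= k by rewrite invr_ge0.
have kk : k + k = 1 by rewrite [RHS]splitr mul1r.
have nh : cnorm h <= k ^+ 2.
  by apply: le_trans (cnormX_le _ _) _; apply: lerXn2r; rewrite ?nnegrE ?cnorm_ge0.
pose w := fix w n : A := if n is n'.+1 then k *: (h + w n' ^+ 2) else 0.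
have nw n : cnorm (w n) <= k.
  elim: n => [|n IH] /=; first by rewrite cnorm0.
  rewrite cnormZ ger0_norm // ler_piMr // -kk.
  apply: le_trans (cnormD _ _) _; apply: lerD.
    apply: le_trans nh _; rewrite expr2 ler_piMr // -kk lerDl //.
  apply: le_trans (cnormX_le _ _) _; apply: le_trans (_ : k ^+ 2 <= _).
    by apply: lerXn2r; rewrite ?nnegrE ?cnorm_ge0.
  by rewrite expr2 ler_piMr // -kk lerDl.
have contr x y : cnorm x <= k -> cnorm y <= k ->
    cnorm (k *: (h + x ^+ 2) - k *: (h + y ^+ 2)) <= k * cnorm (x - y).
  move=> xk yk; rewrite -scalerBr cnormZ (ger0_norm k0) ler_wpM2l //.
  have -> : h + x ^+ 2 - (h + y ^+ 2) = x ^+ 2 - y ^+ 2.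
    by rewrite opprD addrACA subrr add0r.
  apply: le_trans (cnorm_sqrB _ _) _.
  by rewrite ler_piMl ?cnorm_ge0 // -kk lerD.
have [y hy] : exists y, forall n, cnorm (w n - y) <= 2 * 1 / 2 ^+ n.
  apply: cvg_half_pow => // ; elim=> [|n IH].
    rewrite subr0 expr0 divr1; apply: le_trans (nw 1%N) _.
    by rewrite -kk lerDl.
  apply: le_trans (contr (w n.+1) (w n) (nw _) (nw _)) _.
  rewrite exprS invfM mulrCA ler_wpM2l //.
have nyk : cnorm y <= k.
  apply: le_of_eps (cnorm_ge0 _) k0 _ => e e0.
  have [n hn] := half_pow_lt (ler0n _ 2) e0.
  have -> : y = w n - (w n - y) by rewrite opprB addrC subrK.
  apply: le_trans (cnormB _ _) _; apply: lerD => //.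
  by apply: le_trans (ltW hn); move: (hy n); rewrite mulr1.
have fixy : k *: (h + y ^+ 2) = y.
  apply: (@eq_of_half_pow _ _ _ _ 4) => // n.
  have -> : k *: (h + y ^+ 2) - y = - (w n.+1 - k *: (h + y ^+ 2)) + (w n.+1 - y).
    by rewrite opprB addrA subrK.
  apply: le_trans (cnormD _ _) _; rewrite cnormN.
  have e : 4 / 2 ^+ n = 2 / 2 ^+ n + 2 / 2 ^+ n :> C R.
    by rewrite -mulrDl; congr (_ / _); rewrite -natrD.
  rewrite e; apply: lerD.
    apply: le_trans (contr (w n) y (nw _) nyk) _.
    apply: le_trans (_ : cnorm (w n - y) <= _); last by move: (hy n); rewrite mulr1.
    by rewrite ler_piMl ?cnorm_ge0 // -kk lerDl.
  apply: le_trans (hy _) _; rewrite mulr1 ler_wpM2l //.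
  rewrite exprS invfM ler_piMl //.
  by rewrite -[2^-1]/k -kk lerDl.
have sw n : star (w n) = w n.
  elim: n => [|n IH] /=; first by rewrite star0.
  rewrite starZ starD /h !star_exp sa IH /k.
  by congr (_ *: _); apply/CrealP; rewrite ger0_real.
have sy : star y = y.
  apply: (@eq_of_half_pow _ _ _ _ 4) => // n.
  have -> : star y - y = - star (w n - y) + (w n - y).
    by rewrite starB opprB sw addrA subrK.
  apply: le_trans (cnormD _ _) _; rewrite cnormN cnorm_starE.
  have e : 4 / 2 ^+ n = 2 / 2 ^+ n + 2 / 2 ^+ n :> C R.
    by rewrite -mulrDl; congr (_ / _); rewrite -natrD.
  by rewrite e; move: (hy n); rewrite mulr1 => q; apply: lerD.
have cw n : a * w n = w n * a.
  elim: n => [|n IH] /=; first by rewrite mulr0 mul0r.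
  rewrite -scalerAr -scalerAl mulrDr mulrDl /h -exprS -exprSr; congr (_ *: (_ + _)).
  by rewrite !expr2 mulrA IH -mulrA IH mulrA.
have cy : a * y = y * a.
  apply: (@eq_of_half_pow _ _ _ _ (4 * cnorm a)); first by rewrite mulr_ge0 ?cnorm_ge0.
  move=> n.
  have -> : a * y - y * a = - (a * (w n - y)) + (w n - y) * a.
    by rewrite mulrBr mulrBl opprB cw addrA subrK.
  apply: le_trans (cnormD _ _) _; rewrite cnormN.
  have e : 4 * cnorm a / 2 ^+ n = cnorm a * (2 / 2 ^+ n) + (2 / 2 ^+ n) * cnorm a :> C R.
    by move: (_ ^+ n) => P; ring.
  rewrite e; apply: lerD; apply: le_trans (cnormM _ _) _.
    by apply: ler_wpM2l (cnorm_ge0 _) _ _ _; move: (hy n); rewrite mulr1.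
  by apply: ler_wpM2r (cnorm_ge0 _) _ _ _; move: (hy n); rewrite mulr1.
exists (1 - y); split.
- by rewrite starB star1 sy.
- by rewrite mulrBr mulrBl mulr1 mul1r cy.
have h2 : h + y ^+ 2 = y + y.
  by rewrite -[in RHS]fixy -scalerDl kk scale1r.
rewrite expr2 mulrBr mulr1 mulrBl mul1r -expr2.
rewrite -/h; have -> : h = y + y - y ^+ 2 by rewrite -h2 addrK.
by rewrite !opprD !opprK !addrA.
Qed.

Lemma ler_of_pow2_bound (x M B : C R) : 0 <= x -> 0 <= M -> 0 <= B ->
  (forall k, x ^+ (2 ^ k) <= B * M ^+ (2 ^ k)) -> x <= M.
Proof.
move=> x0 M0 B0 h; apply: (@ler_of_pow2 _ x M B) => // k.
apply: le_trans (h k) _; rewrite ler_wpM2r ?exprn_ge0 //.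
by rewrite ler_peMr // ler1n expn_gt0.
Qed.

(** A self-adjoint a of norm at most 1/2 is the real part of the unitary a + i s,
    and unitaries have norm 1: this bounds f on self-adjoint elements by a constant
    factor, which taking powers improves to 1. *)
Lemma star_hom_contractive (A B : cstarType R) (f : {lrmorphism A -> B}) :
  star_preserving f -> forall a, cnorm (f a) <= cnorm a.
Proof.
move=> sf.
have half (a : A) : star a = a -> cnorm a <= 2^-1 -> cnorm (f a) <= 1.
  move=> sa na; have [s [ss cs s2]] := sqrt_one_sub sa na.
  pose u := a + 'i *: s.
  have su : star u = a - 'i *: s by rewrite starD starZ ss sa conjCi scaleNr.
  have ii : 'i * 'i = -1 :> C R by rewrite -expr2 sqrCi.
  have uu : star u * u = 1.
    rewrite su /u mulrDr !mulrBl -!scalerAr -!scalerAl scalerA ii.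
    rewrite scaleN1r opprK cs addrA subrK -!expr2 s2.
    by rewrite addrCA subrr addr0.
  have uu' : u * star u = 1.
    rewrite su /u mulrBr !mulrDl -!scalerAr -!scalerAl scalerA ii.
    rewrite scaleN1r cs opprD opprK addrA addrK -!expr2 s2.
    by rewrite addrCA subrr addr0.
  have fu : unitary (f u).
    by split; rewrite -sf -rmorphM ?uu ?uu' rmorph1.
  have -> : f a = 2^-1 *: (f u + star (f u)).
    rewrite -sf su -rmorphD /u addrACA subrr addr0 -linearZ /= -mulr2n.
    by rewrite -[a *+ 2]scaler_nat scalerA mulVf // scale1r.
  rewrite cnormZ ger0_norm ?invr_ge0 // mulrC ler_pdivrMr // mul1r.
  apply: le_trans (cnormD _ _) _.
  by rewrite cnorm_starE cnorm_unitary.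
have bnd (a : A) : star a = a -> cnorm (f a) <= 2 * cnorm a.
  move=> sa; have := cnorm_ge0 a; rewrite le_eqVlt => /orP[/eqP a0|a0].
    by rewrite (cnorm_eq0 _ (esym a0)) raddf0 !cnorm0 mulr0.
  have t0 : 0 < 2 * cnorm a by rewrite mulr_gt0.
  pose t := (2 * cnorm a)^-1; have tp : 0 < t by rewrite invr_gt0.
  have nt x : cnorm (t *: x : A) = cnorm x / (2 * cnorm a).
    by rewrite cnormZ gtr0_norm // mulrC.
  rewrite -[leRHS]mul1r -ler_pdivrMr //.
  have -> : cnorm (f a) / (2 * cnorm a) = cnorm (f (t *: a)).
    by rewrite linearZ /= cnormZ gtr0_norm // mulrC.
  apply: half; last by rewrite nt invfM mulrCA mulfV ?mulr1 // gt_eqF.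
  by rewrite starZ sa; congr (_ *: _); apply/CrealP; rewrite gtr0_real.
move=> a; pose h := star a * a.
have sh : star h = h by rewrite starM starK.
have nh : cnorm (f h) <= cnorm h.
  apply: (@ler_of_pow2_bound _ _ 2); rewrite ?cnorm_ge0 // => k.
  rewrite -!cnorm_normal_pow2 -?sf ?sh // -rmorphXn; apply: bnd.
  by rewrite star_exp sh.
rewrite -(@ler_pXn2r _ 2) ?nnegrE ?cnorm_ge0 // -!cnorm_star.
by rewrite -sf -rmorphM.
Qed.

End Contractive.

(** * The scalars as a C*-algebra and as a Hilbert space *)

Section ComplexAnalysis.
Variable R : realType.
Local Notation Re := complex.Re.
Local Notation Im := complex.Im.

Lemma gt0_realE (e : C R) : 0 < e -> exists2 r : R, 0 < r & e = (r%:C)%C.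
Proof.
case: e => a b; rewrite ltcE /= => /andP[/eqP -> a0]; by exists a.
Qed.

Lemma norm_Re_le (z : C R) : (`|Re z|%:C)%C <= `|z|.
Proof. exact: normc_ge_Re. Qed.

Lemma norm_Im_le (z : C R) : (`|Im z|%:C)%C <= `|z|.
Proof.
case: z => a b; rewrite normc_def lecR /= -sqrtr_sqr ler_wsqrtr //.
by rewrite lerDr sqr_ge0.
Qed.

Lemma norm_complex_le (z : C R) : `|z| <= ((`|Re z| + `|Im z|)%:C)%C.
Proof.
case: z => a b; rewrite normc_def lecR /=.
rewrite -[leRHS]ger0_norm ?addr_ge0 // -sqrtr_sqr ler_wsqrtr //.
rewrite sqrrD !real_normK ?num_real // lerD2r lerDl.
by rewrite mulrn_wge0 // mulr_ge0.
Qed.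

(** Real and imaginary parts of a Cauchy filter are Cauchy. *)
Lemma complex_complete (F : set_system (C R)^o) : ProperFilter F ->
  cauchy F -> cvg F.
Proof.
move=> FF /cauchyP Fc.
have part (p : C R -> R) : (forall z w, p (z - w) = p z - p w) ->
    (forall z, (`|p z|%:C)%C <= `|z|) -> cvg (p @ F).
  move=> pB pn; apply/cauchy_cvgP/cauchyP => e e0.
  have eC : 0 < (e%:C)%C :> C R by rewrite ltcR.
  have [x Fx] := Fc _ eC; exists (p x).
  suff : F (p @^-1` ball (p x) e) by [].
  apply: filterS Fx => y.
  rewrite -!ball_normE /ball_ /= => h.
  have := pn ((x : C R) - y); rewrite pB => h2.
  by rewrite -ltcR; apply: le_lt_trans h2 h.
have cr : cvg ((@Re R) @ F) by apply: part norm_Re_le => -[a b] [c d].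
have ci : cvg ((@Im R) @ F) by apply: part norm_Im_le => -[a b] [c d].
apply/cvg_ex; exists (lim ((@Re R) @ F) +i* lim ((@Im R) @ F))%C.
apply/cvgrPdist_lt => e /gt0_realE [r r0 ->].
have r2 : 0 < r / 2 by rewrite divr_gt0.
move/cvgrPdist_lt: cr => /(_ _ r2) cr.
move/cvgrPdist_lt: ci => /(_ _ r2) ci.
near=> z; apply: le_lt_trans (norm_complex_le _) _; rewrite ltcR.
rewrite [r]splitr; apply: ltrD.
  by have : `|lim (@Re R @ F) - Re z| < r / 2; [near: z; exact: cr|case: (z)].
by have : `|lim (@Im R @ F) - Im z| < r / 2; [near: z; exact: ci|case: (z)].
Unshelve. all: by end_near. Qed.

End ComplexAnalysis.

(** The scalars as a one-dimensional C*-algebra, where characters take their values,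
    and as a one-dimensional Hilbert space, on which they act. *)
Definition scal (R : realType) : Type := ((C R)^o)%type.
HB.instance Definition _ (R : realType) := NormedModule.copy (scal R) (C R)^o.
HB.instance Definition _ (R : realType) :=
  Uniform_isComplete.Build (scal R) (@complex_complete R).
HB.instance Definition _ (R : realType) := GRing.Algebra.copy (scal R) (C R)^o.

Section ScalStructures.
Variable R : realType.

Fact scal_innerP (z : C R) (x y w : scal R) :
  (z *: x + y : C R) * (w : C R)^* = z * ((x : C R) * (w : C R)^*) + (y : C R) * (w : C R)^*.
Proof. by rewrite mulrDl -mulrA. Qed.
Fact scal_innerC (x y : scal R) :
  (y : C R) * (x : C R)^* = ((x : C R) * (y : C R)^*)^*.
Proof. by rewrite [RHS]rmorphM /= conjCK mulrC. Qed.
Fact scal_inner_norm (x : scal R) : `|x| ^+ 2 = (x : C R) * (x : C R)^*.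
Proof. exact: normCK. Qed.

HB.instance Definition _ := @isHilbert.Build R (scal R)
  (fun x y : scal R => (x : C R) * (y : C R)^*) scal_innerP scal_innerC scal_inner_norm.

Fact scal_starD (x y : scal R) : (x + y : C R)^* = (x : C R)^* + (y : C R)^*.
Proof. exact: rmorphD. Qed.
Fact scal_starZ (z : C R) (x : scal R) :
  (z *: x : C R)^* = z^* * (x : C R)^*.
Proof. exact: rmorphM. Qed.
Fact scal_starM (x y : scal R) : (x * y : C R)^* = (y : C R)^* * (x : C R)^*.
Proof. by rewrite rmorphM mulrC. Qed.
Fact scal_starK (x : scal R) : ((x : C R)^*)^* = x.
Proof. exact: conjCK. Qed.
Fact scal_cnorm_star (x : scal R) : `|(x : C R)^* * x| = `|x : C R| ^+ 2.
Proof. by rewrite normrM norm_conjC. Qed.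
Fact scal_cnorm_eq0 (x : scal R) : `|x : C R| = 0 -> x = 0.
Proof. exact: normr0_eq0. Qed.
Fact scal_cnormM (x y : scal R) : `|x * y : C R| <= `|x : C R| * `|y : C R|.
Proof. by rewrite normrM. Qed.
Fact scal_complete (w : nat -> scal R) :
    (forall e : C R, 0 < e -> exists N, forall m n,
       (N <= m)%N -> (N <= n)%N -> `|w m - w n : C R| < e) ->
    exists x : scal R, forall e : C R, 0 < e -> exists N, forall n,
       (N <= n)%N -> `|w n - x : C R| < e.
Proof.
move=> h; have : cvg (w @ \oo).
  apply/cauchy_cvgP/cauchyP => e e0; have [N hN] := h e e0.
  exists (w N); exists N => // n /= Nn.
  by rewrite -ball_normE /ball_ /=; exact: hN.
case/cvg_ex => x /cvgrPdist_lt hx; exists x => e e0.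
have [N _ hN] := hx e e0; exists N => n Nn.
by rewrite distrC; apply: hN.
Qed.

HB.instance Definition _ := @isCStarAlgebra.Build R (scal R)
  (fun x : scal R => (x : C R)^*) scal_starD scal_starZ scal_starM scal_starK
  (fun x : scal R => `|x : C R|)
  (fun x y => ler_normD (x : C R) y) (fun z x => normrM z (x : C R))
  scal_cnorm_eq0
  scal_cnormM scal_cnorm_star scal_complete.
End ScalStructures.

(** * Density of *-polynomials in the generators *)

(** Formal *-polynomials: the syntax makes it possible to evaluate the same
    expression in several algebras and to compare the norms of its values. *)
Inductive star_poly (R : realType) (I : Type) :=
  | PScal (z : C R) | PGen (i : I) | PStar (i : I)
  | PAdd (s t : star_poly R I) | PMul (s t : star_poly R I).
Arguments PScal {R I}. Arguments PGen {R I}. Arguments PStar {R I}.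

Section StarPoly.
Variables (R : realType) (I : Type).
Local Notation poly := (star_poly R I).

Fixpoint speval (A : cstarType R) (x : I -> A) (t : poly) : A :=
  match t with
  | PScal z => z *: 1
  | PGen i => x i
  | PStar i => star (x i)
  | PAdd s t => speval x s + speval x t
  | PMul s t => speval x s * speval x t
  end.

Fixpoint sp_star (t : poly) : poly :=
  match t with
  | PScal z => PScal z^*
  | PGen i => PStar i
  | PStar i => PGen i
  | PAdd s t => PAdd (sp_star s) (sp_star t)
  | PMul s t => PMul (sp_star t) (sp_star s)
  end.

Definition sp_comb (z : C R) (s t : poly) : poly := PAdd (PMul (PScal z) s) t.

Lemma speval_star (A : cstarType R) (x : I -> A) t :
  speval x (sp_star t) = star (speval x t).
Proof.
elim: t => //= [z|i|s -> t ->|s -> t ->]; rewrite ?starD ?starM ?starK //.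
by rewrite starZ star1.
Qed.

Lemma speval_comb (A : cstarType R) (x : I -> A) z s t :
  speval x (sp_comb z s t) = z *: speval x s + speval x t.
Proof. by rewrite /= -scalerAl mul1r. Qed.

Lemma speval_hom (A B : cstarType R) (f : {lrmorphism A -> B}) (x : I -> A) t :
  star_preserving f -> f (speval x t) = speval (f \o x) t.
Proof.
move=> sf; elim: t => //= [z|s hs t ht|s hs t ht].
- by rewrite linearZ /= rmorph1.
- by rewrite rmorphD /= hs ht.
- by rewrite rmorphM /= hs ht.
Qed.

Lemma eq_speval (A : cstarType R) (x y : I -> A) t : x =1 y ->
  speval x t = speval y t.
Proof. by move=> e; elim: t => //= [i|s -> t ->|s -> t ->]; rewrite ?e. Qed.

Definition sp_dense (A : cstarType R) (x : I -> A) :=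
  forall a (e : C R), 0 < e -> exists t, cnorm (a - speval x t) < e.

End StarPoly.

Section GeneratedSubalgebra.
Variables (R : realType) (I : Type) (A : cstarType R) (x : I -> A).

Definition in_closure (a : A) : Prop :=
  forall e : C R, 0 < e -> exists t, cnorm (a - speval x t) < e.
Definition gen_closure : {pred A} := fun a => `[< in_closure a >].

Lemma in_closure_speval t : in_closure (speval x t).
Proof. by move=> e e0; exists t; rewrite subrr cnorm0. Qed.

Lemma in_closure_star a : in_closure a -> in_closure (star a).
Proof.
move=> h e /h [t ht]; exists (sp_star t).
by rewrite speval_star -starB cnorm_starE.
Qed.

Lemma in_closure_lim (w : nat -> A) a : (forall n, in_closure (w n)) ->
  (forall e : C R, 0 < e -> exists n, cnorm (w n - a) < e) -> in_closure a.
Proof.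
move=> hw ha e e0; have e2 : 0 < e / 2 by rewrite divr_gt0.
have [n hn] := ha _ e2; have [t ht] := hw n _ e2; exists t.
have -> : a - speval x t = - (w n - a) + (w n - speval x t).
  by rewrite opprB addrA subrK.
rewrite [e]splitr; apply: le_lt_trans (cnormD _ _) _.
by rewrite cnormN ltrD.
Qed.

Lemma gen_closure_subalg : subalg_closed gen_closure.
Proof.
split=> [|z a b|a b]; rewrite ?unfold_in.
- apply/asboolP; have := in_closure_speval (PScal 1); by rewrite /= scale1r.
- move=> /asboolP ha /asboolP hb; apply/asboolP => e e0.
  have e2 : 0 < e / 2 by rewrite divr_gt0.
  have z1 : 0 < `|z| + 1 by rewrite ltr_wpDl.
  have [s hs] := ha (e / 2 / (`|z| + 1)) (divr_gt0 e2 z1).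
  have [t ht] := hb _ e2; exists (sp_comb z s t).
  rewrite speval_comb opprD addrACA -scalerBr.
  apply: le_lt_trans (cnormD _ _) _; rewrite cnormZ [e]splitr ltr_leD // ?(ltW ht) //.
  move: hs; rewrite ltr_pdivlMr // => hs; apply: le_lt_trans hs.
  by rewrite mulrC ler_wpM2l ?cnorm_ge0 // lerDl.
- move=> /asboolP ha /asboolP hb; apply/asboolP => e e0.
  have e2 : 0 < e / 2 by rewrite divr_gt0.
  have b1 : 0 < cnorm b + 1 by rewrite ltr_wpDl ?cnorm_ge0.
  have [s hs] := ha (e / 2 / (cnorm b + 1)) (divr_gt0 e2 b1).
  have s1 : 0 < cnorm (speval x s) + 1 by rewrite ltr_wpDl ?cnorm_ge0.
  have [t ht] := hb (e / 2 / (cnorm (speval x s) + 1)) (divr_gt0 e2 s1).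
  exists (PMul s t) => /=.
  have -> : a * b - speval x s * speval x t
      = (a - speval x s) * b + speval x s * (b - speval x t).
    by rewrite mulrBl mulrBr addrA subrK.
  apply: le_lt_trans (cnormD _ _) _; rewrite [e]splitr ltrD //.
    apply: le_lt_trans (cnormM _ _) _; move: hs; rewrite ltr_pdivlMr //.
    by apply: le_lt_trans; rewrite ler_wpM2l ?cnorm_ge0 // lerDl.
  apply: le_lt_trans (cnormM _ _) _; move: ht; rewrite ltr_pdivlMr //.
  by apply: le_lt_trans; rewrite mulrC ler_wpM2l ?cnorm_ge0 // lerDl.
Qed.

HB.instance Definition _ :=
  GRing.isSubalgClosed.Build (C R) A gen_closure gen_closure_subalg.

(** The closed *-subalgebra generated by x, as a C*-algebra in its own right. *)
Record gen_sub := GenSub { gen_val : A; gen_valP : gen_val \in gen_closure }.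
HB.instance Definition _ := [isSub for gen_val].
HB.instance Definition _ := [Choice of gen_sub by <:].
HB.instance Definition _ := [SubChoice_isSubAlgebra of gen_sub by <:].

Lemma gen_sub_in (a : gen_sub) : in_closure (val a).
Proof. by case: a => a ha; apply/asboolP. Qed.

Definition gen_star (a : gen_sub) : gen_sub :=
  GenSub (asboolT (in_closure_star (gen_sub_in a))).

Fact gen_starD (a b : gen_sub) : gen_star (a + b) = gen_star a + gen_star b.
Proof. by apply: val_inj; rewrite rmorphD /= -starD. Qed.
Fact gen_starZ (z : C R) (a : gen_sub) : gen_star (z *: a) = z^* *: gen_star a.
Proof. by apply: val_inj; rewrite linearZ /= -starZ. Qed.
Fact gen_starM (a b : gen_sub) : gen_star (a * b) = gen_star b * gen_star a.
Proof. by apply: val_inj; rewrite rmorphM /= -starM. Qed.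
Fact gen_starK (a : gen_sub) : gen_star (gen_star a) = a.
Proof. by apply: val_inj; rewrite /= starK. Qed.

Definition gen_norm (a : gen_sub) : C R := cnorm (val a).

Fact gen_normD (a b : gen_sub) : gen_norm (a + b) <= gen_norm a + gen_norm b.
Proof. exact: cnormD. Qed.
Fact gen_normZ (z : C R) (a : gen_sub) : gen_norm (z *: a) = `|z| * gen_norm a.
Proof. by rewrite -cnormZ. Qed.
Fact gen_norm_eq0 (a : gen_sub) : gen_norm a = 0 -> a = 0.
Proof. by move=> /cnorm_eq0 h; apply: val_inj; rewrite raddf0. Qed.
Fact gen_normM (a b : gen_sub) : gen_norm (a * b) <= gen_norm a * gen_norm b.
Proof. exact: cnormM. Qed.
Fact gen_norm_star (a : gen_sub) : gen_norm (gen_star a * a) = gen_norm a ^+ 2.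
Proof. exact: cnorm_star. Qed.
Fact gen_complete (w : nat -> gen_sub) :
    (forall e : C R, 0 < e -> exists N, forall m n,
       (N <= m)%N -> (N <= n)%N -> gen_norm (w m - w n) < e) ->
    exists x, forall e : C R, 0 < e -> exists N, forall n,
       (N <= n)%N -> gen_norm (w n - x) < e.
Proof.
move=> h; have [] := cnorm_complete (val \o w).
  move=> e /h [N hN]; exists N => m n Nm Nn /=.
  by exact: hN.
move=> a ha; have ca : in_closure a.
  apply: (@in_closure_lim (val \o w)) => [n|e /ha [N hN]]; first exact: gen_sub_in.
  by exists N; apply: hN.
exists (GenSub (asboolT ca)) => e /ha [N hN]; exists N => n /hN.
by rewrite /gen_norm raddfB.
Qed.

HB.instance Definition _ := @isCStarAlgebra.Build R gen_sub
  gen_star gen_starD gen_starZ gen_starM gen_starK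
  gen_norm gen_normD gen_normZ gen_norm_eq0 gen_normM gen_norm_star gen_complete.

Definition gen_incl : gen_sub -> A := val.
HB.instance Definition _ := GRing.RMorphism.copy gen_incl (val : gen_sub -> A).
Fact gen_incl_scalable : scalable gen_incl. Proof. by []. Qed.
HB.instance Definition _ :=
  GRing.isScalable.Build (C R) gen_sub A *:%R gen_incl gen_incl_scalable.


Definition gen_gen (i : I) : gen_sub := GenSub (asboolT (in_closure_speval (PGen i))).

End GeneratedSubalgebra.

(** The closed *-subalgebra generated by x satisfies the relations as well, so the
    universal property gives a map into it; followed by the inclusion it fixes the
    generators and is therefore the identity. *)
Lemma universal_dense (R : realType) (I : Type)
    (P : forall B : cstarType R, (I -> B) -> Prop) (A : cstarType R) (x : I -> A) :
  (forall (B B' : cstarType R) (g : {lrmorphism B -> B'}) (b : I -> B),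
     star_preserving g -> injective g -> P B' (g \o b) -> P B b) ->
  universal P x -> sp_dense x.
Proof.
move=> Pinj [Px univ] a e e0.
have Pg : P (gen_sub x) (gen_gen x).
  exact: (@Pinj (gen_sub x) A (@gen_incl R I A x) (gen_gen x) (fun _ => erefl) val_inj Px).
have [f [sf fx _]] := univ _ _ Pg; have [g [_ _ gu]] := univ _ _ Px.
have h1 := gu ((gen_incl (x := x)) \o f) (fun b => congr1 _ (sf b)) (fun i => congr1 _ (fx i)).
have h2 := gu idfun (fun b => erefl) (fun i => erefl).
have : in_closure x (val (f a)) by apply: gen_sub_in.
by have /= := h1 a; rewrite -(h2 a) /gen_incl => ->; apply.
Qed.

(** * Extension of homomorphisms by density *)

Section ExtendByDensity.
Variables (R : realType) (A B : cstarType R) (S : Type).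
Variables (phi : S -> A) (psi : S -> B).
Hypothesis dense : forall a (e : C R), 0 < e -> exists s, cnorm (a - phi s) < e.
Hypothesis contr : forall s t, cnorm (psi s - psi t) <= cnorm (phi s - phi t).

(** The closure of the set of pairs (phi s, psi s): it is the graph of the extension
    of the map sending phi s to psi s. *)
Definition closed_graph (a : A) (b : B) : Prop :=
  forall e : C R, 0 < e -> exists s, cnorm (a - phi s) < e /\ cnorm (b - psi s) < e.

Lemma closed_graph_le a a' b b' : closed_graph a b -> closed_graph a' b' ->
  cnorm (b - b') <= cnorm (a - a').
Proof.
move=> h h'; apply: le_of_eps; rewrite ?cnorm_ge0 // => e e0.
have e4 : 0 < e / 2 / 2 by rewrite !divr_gt0.
have [s [hs1 hs2]] := h _ e4; have [t [ht1 ht2]] := h' _ e4.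
have e3 : e = (e / 2 / 2 + (e / 2 / 2)) + (e / 2 / 2 + e / 2 / 2) by rewrite -!splitr.
apply: le_trans (cnorm_dist (psi s) _ _) _.
apply: le_trans (lerD (ltW hs2) (cnorm_dist (psi t) _ _)) _.
rewrite [X in _ + (_ + X)]cnorm_distC.
apply: le_trans (lerD (lexx _) (lerD (contr _ _) (ltW ht2))) _.
apply: le_trans (lerD (lexx _) (lerD (cnorm_dist a _ _) (lexx _))) _.
rewrite [cnorm (phi s - a)]cnorm_distC.
apply: le_trans (lerD (lexx _) (lerD (lerD (ltW hs1) (cnorm_dist a' _ _)) (lexx _))) _.
apply: le_trans (lerD (lexx _) (lerD (lerD (lexx _) (lerD (lexx _) (ltW ht1))) (lexx _))) _.
rewrite le_eqVlt; apply/orP; left; apply/eqP; move: (cnorm _) => X.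
by rewrite [in RHS]e3; ring.
Qed.

(** The images of a sequence converging geometrically to a converge as fast. *)
Lemma closed_graph_total a : exists b, closed_graph a b.
Proof.
have /choice[s hs] : forall n : nat, exists s, cnorm (a - phi s) < 1 / 2 ^+ n.
  by move=> n; apply: dense; rewrite divr_gt0 ?exprn_gt0.
have [|n|b hb] := @cvg_half_pow R B (psi \o s) 2; first by [].
  apply: le_trans (contr _ _) _.
  have -> : phi (s n.+1) - phi (s n) = (a - phi (s n)) - (a - phi (s n.+1)).
    by rewrite opprB [RHS]addrC addrA subrK.
  apply: le_trans (cnormB _ _) _.
  rewrite [leRHS](_ : _ = 1 / 2 ^+ n + 1 / 2 ^+ n); last by rewrite -mulrDl.
  apply: lerD; first exact/ltW/hs.
  apply: le_trans (ltW (hs _)) _.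
  rewrite !mul1r exprS invfM ler_piMl ?invr_ge0 ?exprn_ge0 //.
  by rewrite invf_le1 // ler1n.
exists b => e e0.
have [n hn] := @half_pow_lt R (2 * 2) e (mulr_ge0 (ler0n _ 2) (ler0n _ 2)) e0.
exists (s n); split; last by rewrite cnorm_distC; apply: le_lt_trans (hb n) hn.
apply: lt_trans (hs n) _; apply: le_lt_trans hn.
by rewrite ler_wpM2r ?invr_ge0 ?exprn_ge0 // -natrM ler1n.
Qed.

Hypothesis comb : forall z s t, exists r,
  phi r = z *: phi s + phi t /\ psi r = z *: psi s + psi t.
Hypothesis mult : forall s t, exists r,
  phi r = phi s * phi t /\ psi r = psi s * psi t.
Hypothesis unit : exists r, phi r = 1 /\ psi r = 1.
Hypothesis star_stable : forall s, exists r,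
  phi r = star (phi s) /\ psi r = star (psi s).

Lemma closed_graph_point s : closed_graph (phi s) (psi s).
Proof. by move=> e e0; exists s; rewrite !subrr !cnorm0. Qed.

Lemma closed_graph_fun a b b' : closed_graph a b -> closed_graph a b' -> b = b'.
Proof.
move=> h h'; apply: eq_of_eps => e e0; apply: le_trans (closed_graph_le h h') _.
by rewrite subrr cnorm0 ltW.
Qed.

Lemma closed_graph_comb z a a' b b' : closed_graph a b -> closed_graph a' b' ->
  closed_graph (z *: a + a') (z *: b + b').
Proof.
move=> h h' e e0; have e2 : 0 < e / 2 by rewrite divr_gt0.
have z1 : 0 < `|z| + 1 by rewrite ltr_wpDl.
have [s [s1 s2]] := h (e / 2 / (`|z| + 1)) (divr_gt0 e2 z1).
have [t [t1 t2]] := h' _ e2; have [r [r1 r2]] := comb z s t; exists r; rewrite r1 r2.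
have key (D : cstarType R) (x y x' y' : D) : cnorm (x - x') < e / 2 / (`|z| + 1) ->
    cnorm (y - y') < e / 2 -> cnorm (z *: x + y - (z *: x' + y')) < e.
  move=> h1 h2; rewrite opprD addrACA -scalerBr.
  apply: le_lt_trans (cnormD _ _) _; rewrite cnormZ [e]splitr ltr_leD // ?(ltW h2) //.
  move: h1; rewrite ltr_pdivlMr // => h1; apply: le_lt_trans h1.
  by rewrite mulrC ler_wpM2l ?cnorm_ge0 // lerDl.
by split; apply: key.
Qed.

Lemma closed_graph_mul a a' b b' : closed_graph a b -> closed_graph a' b' ->
  closed_graph (a * a') (b * b').
Proof.
move=> h h' e e0; have [M [M1 [aM bM a'M b'M]]] : exists M : C R, 1 <= M /\
    [/\ cnorm a <= M, cnorm b <= M, cnorm a' <= M & cnorm b' <= M].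
  have n0 := (cnorm_ge0 a, cnorm_ge0 b, cnorm_ge0 a', cnorm_ge0 b').
  exists (1 + (cnorm a + (cnorm b + (cnorm a' + cnorm b')))).
  split; first by rewrite lerDl !addr_ge0 ?n0.
  split; apply: ler_wpDl => //; first by apply: ler_wpDr; rewrite ?addr_ge0 ?n0.
  - by apply: ler_wpDl; rewrite ?n0 //; apply: ler_wpDr; rewrite ?addr_ge0 ?n0.
  - by do 2!(apply: ler_wpDl; rewrite ?n0 //); apply: ler_wpDr; rewrite ?n0.
  - by do 3!(apply: ler_wpDl; rewrite ?n0 //).
have M0 : 0 < M by apply: lt_le_trans M1.
have MM : 0 < M + M + 1 by rewrite !addr_gt0.
have MMe : 0 < M + M + 1 + e by rewrite addr_gt0.
pose d := e / (M + M + 1 + e).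
have d0 : 0 < d by rewrite divr_gt0.
have d1 : d <= 1 by rewrite ler_pdivrMr // mul1r lerDr ltW.
have de : d <= e / (M + M + 1).
  by rewrite ler_wpM2l ?(ltW e0) // lef_pV2 ?posrE // lerDl ltW.
have [s [s1 s2]] := h _ d0; have [t [t1 t2]] := h' _ d0.
have [r [r1 r2]] := mult s t; exists r; rewrite r1 r2.
have key (D : cstarType R) (x y x' y' : D) : cnorm (x - x') < d ->
    cnorm (y - y') < d -> cnorm x <= M -> cnorm y <= M ->
    cnorm (x * y - x' * y') < e.
  move=> h1 h2 xM yM; have x'M : cnorm x' <= M + 1.
    have -> : x' = x - (x - x') by rewrite opprB addrC subrK.
    by apply: le_trans (cnormB _ _) _; rewrite lerD // (le_trans (ltW h1)).
  apply: le_lt_trans (cnorm_dist (x' * y) _ _) _.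
  rewrite -mulrBl -mulrBr.
  apply: le_lt_trans (lerD (cnormM _ _) (cnormM _ _)) _.
  have lt1 : cnorm x' * cnorm (y - y') < (M + 1) * d.
    apply: (@le_lt_trans _ _ ((M + 1) * cnorm (y - y'))).
      by rewrite ler_wpM2r ?cnorm_ge0.
    by rewrite ltr_pM2l ?addr_gt0.
  have le1 : cnorm (x - x') * cnorm y <= d * M.
    by apply: ler_pM; rewrite ?cnorm_ge0 // ltW.
  apply: (lt_le_trans (ler_ltD le1 lt1)).
  apply: (@le_trans _ _ ((M + M + 1) * d)).
    by rewrite le_eqVlt; apply/orP; left; apply/eqP; ring.
  by rewrite mulrC -ler_pdivlMr.
by split; apply: key.
Qed.

Lemma closed_graph_star a b : closed_graph a b -> closed_graph (star a) (star b).
Proof.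
move=> h e /h [s [s1 s2]]; have [r [r1 r2]] := star_stable s.
by exists r; rewrite r1 r2 -!starB !cnorm_starE.
Qed.

(** The closed graph is single-valued and total, and it is compatible with the
    operations because the set of pairs (phi s, psi s) is. *)
Lemma extend_by_density : exists f : {lrmorphism A -> B},
  [/\ star_preserving f, forall s, f (phi s) = psi s
    & forall a, cnorm (f a) <= cnorm a].
Proof.
have [f hf] := choice closed_graph_total.
have fE a b : closed_graph a b -> f a = b by apply: closed_graph_fun (hf a).
have [r [r1 r2]] := unit.
have c1 : closed_graph 1 1 by rewrite -r1 -r2; apply: closed_graph_point.
have fmul : GRing.monoid_morphism f.
  by split=> [|a b]; [exact: fE|apply/fE/closed_graph_mul].
have fzero : f 0 = 0.
  by apply: fE; have := closed_graph_comb (-1) c1 c1; rewrite !scaleN1r !addNr.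
have fadd : GRing.zmod_morphism f.
  move=> a b; apply: fE; rewrite -scaleN1r -[- f b]scaleN1r addrC [f a + _]addrC.
  exact: closed_graph_comb.
have fscal : scalable f.
  move=> z a; apply: fE; rewrite -[z *: a]addr0 -[z *: f a]addr0 -fzero.
  exact: closed_graph_comb.
pose l1 := GRing.isZmodMorphism.Build A B f fadd.
pose l2 := GRing.isScalable.Build (C R) A B *:%R f fscal.
pose l3 := GRing.isMonoidMorphism.Build A B f fmul.
pose g : {lrmorphism A -> B} := HB.pack f l1 l2 l3.
exists g; split=> [a|s|a] /=.
- exact/fE/closed_graph_star.
- exact/fE/closed_graph_point.
have := closed_graph_le (hf a) (hf 0); rewrite fzero !subr0; exact.
Qed.

End ExtendByDensity.

(** * Polynomials in commuting unitaries *)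

Section RootsOfUnity.
Variable R : realType.

Lemma C_primitive_root n : (n > 0)%N -> exists w : C R, n.-primitive_root w.
Proof.
pose p : {poly C R} := 'X^n - 1; have [r Dp] := closed_field_poly_normal p.
move=> n_gt0; rewrite (monicP _) ?monicXnsubC // scale1r in Dp.
have rn1 : all n.-unity_root r by apply/allP=> z; rewrite -root_prod_XsubC -Dp.
have sz_r : (n < (size r).+1)%N.
  by rewrite -(size_prod_XsubC r id) -Dp size_XnsubC.
have [|z] := hasP (has_prim_root n_gt0 rn1 _ sz_r); last by exists z.
by rewrite -separable_prod_XsubC -Dp separable_Xn_sub_1 // pnatr_eq0 -lt0n.
Qed.

Lemma norm_prim_root n (w : C R) : n.-primitive_root w -> `|w| = 1.
Proof.
move=> hw; have n0 := prim_order_gt0 hw.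
apply/eqP; rewrite -(@eqrXn2 _ n) ?normr_ge0 //.
by rewrite -normrX (prim_expr_order hw) normr1 expr1n.
Qed.

Lemma conj_norm1 (z : C R) : `|z| = 1 -> z * z^* = 1.
Proof. by move=> h; rewrite -normCK h expr1n. Qed.

(** For k <> m this is a geometric sum over the powers of a root of unity other
    than 1. *)
Lemma root_orthogonality n (w : C R) (k m : nat) : n.-primitive_root w ->
  (k < n)%N -> (m < n)%N ->
  \sum_(j < n) (w ^+ j) ^+ k * ((w ^+ j)^*) ^+ m = n%:R *+ (k == m).
Proof.
move=> hw kn mn; have ww := conj_norm1 (norm_prim_root hw).
have w0 : w != 0 by apply/eqP => h; move: ww; rewrite h mul0r => /eqP; rewrite eq_sym oner_eq0.
pose s := w ^+ k * w^* ^+ m.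
rewrite (eq_bigr (fun j : 'I_n => s ^+ j)); last first.
  move=> j _; rewrite rmorphXn /= /s exprMn -!exprM.
  by rewrite [(j * k)%N]mulnC [(j * m)%N]mulnC.
have sn : s ^+ n = 1.
  by rewrite /s exprMn -!exprM ![(_ * n)%N]mulnC !exprM -rmorphXn (prim_expr_order hw) rmorph1 !expr1n mulr1.
have [e|km] := eqVneq k m.
  have -> : s = 1 by rewrite /s e -exprMn ww expr1n.
  by rewrite (eq_bigr (fun _ => 1)) ?sumr_const ?card_ord // => j _; rewrite expr1n.
have s1 : s != 1.
  apply: contra km => /eqP h; rewrite -(modn_small kn) -(modn_small mn).
  rewrite -[(_ == _)%N](eq_prim_root_expr hw); apply/eqP.
  have : s * w ^+ m = w ^+ m by rewrite h mul1r.
  by rewrite /s -mulrA -exprMn [w^* * w]mulrC ww expr1n mulr1.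
have := subrX1 s n; rewrite sn subrr => /esym/eqP.
by rewrite mulf_eq0 subr_eq0 (negPf s1) /= => /eqP ->.
Qed.
End RootsOfUnity.

Section FourierKernel.
Variables (R : realType) (A : cstarType R).

(** The n-point discrete Fourier kernel at w, evaluated at u. *)
Definition dft n (w : C R) (u : A) : A :=
  n%:R^-1 *: \sum_(m < n) (w^* ^+ m) *: u ^+ m.

Lemma cnorm_dft n w u : (n > 0)%N -> `|w| = 1 -> unitary u -> cnorm (dft n w u) <= 1.
Proof.
move=> n0 w1 hu; rewrite cnormZ ger0_norm ?invr_ge0 // mulrC ler_pdivrMr ?ltr0n // mul1r.
apply: le_trans (cnorm_sum _ _ _) _.
rewrite (eq_bigr (fun _ => 1)) ?sumr_const ?card_ord // => j _.
by rewrite cnormZ normrX norm_conjC w1 expr1n mul1r cnorm_unitaryX.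
Qed.

(** Lagrange interpolation at the n-th roots of unity is exact below degree n. *)
Lemma dft_interp n (w : C R) u k : n.-primitive_root w -> (k < n)%N ->
  u ^+ k = \sum_(j < n) (w ^+ j) ^+ k *: dft n (w ^+ j) u.
Proof.
move=> hw kn; have n0 : (n%:R : C R) != 0 by rewrite pnatr_eq0 -lt0n (prim_order_gt0 hw).
rewrite /dft; under eq_bigr do rewrite scalerA mulrC -scalerA scaler_sumr.
rewrite -scaler_sumr exchange_big /=.
rewrite (eq_bigr (fun m : 'I_n => (n%:R *+ (k == m)) *: u ^+ m)); last first.
  move=> m _; rewrite -(root_orthogonality hw kn (ltn_ord m)) scaler_suml.
  by apply: eq_bigr => j _; rewrite scalerA.
rewrite (bigD1 (Ordinal kn)) //= eqxx mulr1n big1 ?addr0 => [|m mk].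
  by rewrite scalerA mulVf // scale1r.
rewrite (_ : (k == m) = false) ?mulr0n ?scale0r //.
by apply/negbTE; apply: contra mk => /eqP e; apply/eqP/val_inj.
Qed.

Lemma horner_dft n (w : C R) (p : {poly A}) u : n.-primitive_root w ->
  (size p <= n)%N -> p.[u] = \sum_(j < n) p.[(w ^+ j)%:A] * dft n (w ^+ j) u.
Proof.
move=> hw pn; rewrite (horner_coef_wide _ pn).
under eq_bigr => i _ do rewrite (dft_interp u hw (ltn_ord i)) mulr_sumr.
rewrite exchange_big /=; apply: eq_bigr => j _.
rewrite (horner_coef_wide _ pn) mulr_suml; apply: eq_bigr => i _.
by rewrite exprZn expr1n -mulrA -scalerAl mul1r.
Qed.

(** The norm of a normal element is the growth rate of its powers, and the
    interpolation formula bounds the 2 ^ k-th power by O(2 ^ k) times M ^ (2 ^ k),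
    as the degree of the power of p is O(2 ^ k) and each kernel has norm at most 1. *)
Lemma cnorm_horner_unitary (p : {poly A}) u M : unitary u -> 0 <= M ->
  p.[u] * u = u * p.[u] -> star p.[u] * p.[u] = p.[u] * star p.[u] ->
  (forall z : C R, `|z| = 1 -> cnorm p.[z%:A] <= M) -> cnorm p.[u] <= M.
Proof.
move=> hu M0 cu nu H; set d := (size p).-1.
apply: (@ler_of_pow2 _ _ _ d.+1%:R); rewrite ?cnorm_ge0 // => k.
set N := (2 ^ k)%N; have N0 : (N > 0)%N by rewrite expn_gt0.
rewrite -cnorm_normal_pow2 // -horner_exp_comm //.
set L := (d * N).+1; have [w hw] := C_primitive_root R (ltn0Sn (d * N)).
have w1 j : `|w ^+ j| = 1 by rewrite normrX (norm_prim_root hw) expr1n.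
rewrite (horner_dft _ hw (size_poly_exp_leq _ _)).
apply: le_trans (cnorm_sum _ _ _) _.
apply: le_trans (_ : \sum_(j < L) M ^+ N <= _).
  apply: ler_sum => j _; apply: le_trans (cnormM _ _) _.
  rewrite -[leRHS]mulr1; apply: ler_pM; rewrite ?cnorm_ge0 ?cnorm_dft //.
  rewrite horner_exp_comm; last by rewrite /comm_poly -scalerAr -scalerAl mulr1 mul1r.
  apply: le_trans (cnormX_le _ _) _.
  by apply: lerXn2r; rewrite ?nnegrE ?cnorm_ge0 ?H.
rewrite sumr_const card_ord -[leLHS]mulr_natl -natrM ler_wpM2r ?exprn_ge0 //.
by rewrite ler_nat /L mulSn addnC -addn1 leq_add2l.
Qed.

End FourierKernel.

Section CommutingUnitaries.
Variables (R : realType) (I : finType) (A : cstarType R).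
Implicit Types (x : I -> A) (t : star_poly R I).

Definition commuting_unitaries x :=
  (forall i, unitary (x i)) /\ (forall i j, x i * x j = x j * x i).

(** The adjoint of a unitary is its inverse. *)
Lemma comm_star_unitary (u b : A) : unitary u -> b * u = u * b ->
  b * star u = star u * b.
Proof.
move=> [h1 h2] e; rewrite -[LHS]mul1r -h1 -mulrA [u * _]mulrA -e -!mulrA.
by rewrite h2 mulr1.
Qed.

Lemma comm_speval x b t : (forall i, b * x i = x i * b) ->
  (forall i, b * star (x i) = star (x i) * b) -> b * speval x t = speval x t * b.
Proof.
move=> h h'; elim: t => //= [z|s hs t ht|s hs t ht].
- by rewrite -scalerAr -scalerAl mulr1 mul1r.
- by rewrite mulrDr mulrDl hs ht.
- by rewrite mulrA hs -mulrA ht mulrA.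
Qed.

Definition subst_at x i (y : A) : I -> A := fun j => if j == i then y else x j.

(** A *-polynomial in a unitary variable y is, up to a power of y that clears the
    adjoints, a polynomial in y whose coefficients come from the other variables. *)
Lemma speval_subst_poly x i t : commuting_unitaries x ->
  exists K (p : {poly A}), forall y, unitary y -> (forall j, y * x j = x j * y) ->
    y ^+ K * speval (subst_at x i y) t = p.[y].
Proof.
move=> [ux cx].
have cy y s : unitary y -> (forall j, y * x j = x j * y) ->
    y * speval (subst_at x i y) s = speval (subst_at x i y) s * y.
  move=> uy hy; apply: comm_speval => j; rewrite /subst_at; case: eqP => // _.
    by apply: comm_star_unitary.
  by apply: comm_star_unitary.
have cyp y K s : unitary y -> (forall j, y * x j = x j * y) ->
    GRing.comm (y ^+ K * speval (subst_at x i y) s) y.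
  move=> uy hy; rewrite /GRing.comm -mulrA -cy // mulrA [RHS]mulrA.
  by rewrite -exprSr -exprS.
elim: t => [z|j|j|s [K1 [p1 h1]] t [K2 [p2 h2]]|s [K1 [p1 h1]] t [K2 [p2 h2]]].
- by exists 0%N, (z%:A)%:P => y _ _; rewrite expr0 mul1r hornerC.
- have [->|ji] := eqVneq j i.
    by exists 0%N, 'X => y _ _; rewrite /= /subst_at eqxx mul1r hornerX.
  by exists 0%N, (x j)%:P => y _ _; rewrite /= /subst_at (negPf ji) mul1r hornerC.
- have [->|ji] := eqVneq j i.
    by exists 1%N, 1 => y [_ uy] _; rewrite /= /subst_at eqxx expr1 uy hornerC.
  by exists 0%N, (star (x j))%:P => y _ _; rewrite /= /subst_at (negPf ji) mul1r hornerC.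
- exists (K1 + K2)%N, (p1 * 'X^K2 + p2 * 'X^K1) => y uy hy /=.
  have cX K : comm_poly 'X^K y by rewrite /comm_poly hornerXn -exprS -exprSr.
  rewrite hornerD !hornerM_comm ?hornerXn //; try exact: cX.
  rewrite -h1 // -h2 // mulrDr; congr (_ + _).
    rewrite addnC exprD -!mulrA; have := commrX K2 (cyp y K1 s uy hy).
    by rewrite /GRing.comm -!mulrA => ->.
  rewrite exprD -!mulrA; have := commrX K1 (cyp y K2 t uy hy).
  by rewrite /GRing.comm -!mulrA => ->.
exists (K1 + K2)%N, (p1 * p2) => y uy hy /=.
rewrite hornerM_comm; last by rewrite /comm_poly -h2 //; apply/esym/cyp.
rewrite -h1 // -h2 // exprD -!mulrA; congr (_ * _); rewrite mulrA [RHS]mulrA.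
congr (_ * _); apply: commr_sym; apply: commrX; apply: commr_sym; exact: cy.
Qed.

Lemma commuting_unitaries_normal x t : commuting_unitaries x ->
  star (speval x t) * speval x t = speval x t * star (speval x t).
Proof.
move=> [ux cx]; have cs i j : star (x i) * x j = x j * star (x i).
  by symmetry; apply: comm_star_unitary.
have css i j : star (x i) * star (x j) = star (x j) * star (x i).
  by rewrite -!starM cx.
rewrite -speval_star; apply: comm_speval => i; symmetry; apply: comm_speval => j //.
Qed.

Lemma commuting_unitaries_subst x i y : commuting_unitaries x -> unitary y ->
  (forall j, y * x j = x j * y) -> commuting_unitaries (subst_at x i y).
Proof.
move=> [ux cx] uy hy; split=> [j|j k]; rewrite /subst_at; first by case: eqP.
by case: eqP => // _; case: eqP.
Qed.

Lemma unitary_scalar (z : C R) : `|z| = 1 -> unitary (z%:A : A).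
Proof.
move=> z1; split; rewrite starZ star1 -scalerAl mul1r scalerA ?conj_norm1 ?scale1r //.
by rewrite mulrC conj_norm1 // scale1r.
Qed.

Lemma speval_scalar (z : I -> scal R) t :
  speval (fun i => (z i : C R) *: (1 : A)) t = (speval z t : C R) *: 1.
Proof.
elim: t => //= [c|i|s -> t ->|s -> t ->].
- by rewrite /GRing.scale /= mulr1.
- by rewrite starZ star1.
- by rewrite scalerDl.
- by rewrite -scalerAl mul1r scalerA.
Qed.

(** The variables are replaced by scalars of modulus 1 one at a time: the norm of a
    polynomial in one unitary is at most its supremum over the circle. *)
Lemma cnorm_speval_le x t (M : C R) : commuting_unitaries x -> 0 <= M ->
  (forall z : I -> scal R, (forall i, `|z i : C R| = 1) -> `|speval z t : C R| <= M) ->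
  cnorm (speval x t) <= M.
Proof.
move=> hx M0 H.
suff main (s : seq I) : forall x, commuting_unitaries x ->
    (forall i, i \notin s -> exists2 z : C R, `|z| = 1 & x i = z%:A) ->
    cnorm (speval x t) <= M.
  by apply: (main (enum I)) => // i; rewrite mem_enum.
elim: s => [|i s IH] {hx}x hx hs.
  have /choice[z hz] : forall i, exists z : C R, `|z| = 1 /\ x i = z%:A.
    by move=> i; have [z z1 xz] := hs i isT; exists z.
  rewrite (@eq_speval _ _ _ _ (fun i => z i *: 1)); last by move=> i; case: (hz i).
  rewrite (speval_scalar z) cnormZ cnorm1 mulr1; apply: H => i; by case: (hz i).
have [K [p hp]] := speval_subst_poly i t hx.
have xE : subst_at x i (x i) =1 x by move=> j; rewrite /subst_at; case: eqP => [->|].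
have [ux cx] := hx.
have pE := hp (x i) (ux i) (cx i); rewrite (eq_speval t xE) in pE.
have uK : unitary (x i ^+ K).
  have [h1 h2] := ux i.
  split; rewrite star_exp -exprMn_comm ?h1 ?h2 ?expr1n //; rewrite /GRing.comm h1 h2 //.
rewrite -(cnorm_mul_unitary _ uK) pE.
have csx : x i * speval x t = speval x t * x i.
  by apply: comm_speval => j //; apply: comm_star_unitary.
apply: cnorm_horner_unitary => //.
- rewrite -pE -mulrA -csx !mulrA; by rewrite -exprS -exprSr.
- have [h1 h2] := uK.
  have cc : GRing.comm (speval x t) (x i ^+ K) by apply: commrX; apply/esym.
  rewrite -pE; set V := x i ^+ K in h1 h2 cc *; set a := speval x t in cc *.
  have -> : star (V * a) * (V * a) = star a * a.
    by rewrite starM -mulrA [star V * _]mulrA h1 mul1r.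
  have -> : V * a * star (V * a) = a * star a.
    by rewrite -cc starM -mulrA [V * _]mulrA h2 mul1r.
  exact: commuting_unitaries_normal.
move=> z z1.
have zc j : z%:A * x j = x j * z%:A by rewrite -scalerAl -scalerAr mul1r mulr1.
have uz := unitary_scalar z1.
have uzK : unitary (z%:A ^+ K : A).
  by rewrite exprZn expr1n; apply: unitary_scalar; rewrite normrX z1 expr1n.
rewrite -hp // cnorm_mul_unitary //; apply: IH => [|j js].
  exact: commuting_unitaries_subst.
rewrite /subst_at; case: eqP => [_|/eqP ji]; first by exists z.
by apply: hs; rewrite inE negb_or ji.
Qed.

End CommutingUnitaries.

(** * Fejer approximation *)

Section FejerKernel.
Variable R : realType.

(** The square modulus of the discrete Fourier kernel is the Fejer kernel; over the
    n-th roots of unity its values are nonnegative weights of total mass 1. *)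
Definition fejer n (w z : C R) : C R := `|dft n w (z : scal R) : C R| ^+ 2.

Lemma fejer_ge0 n w z : 0 <= fejer n w z.
Proof. by rewrite exprn_ge0. Qed.

(** Parseval's identity, read off the interpolation formula. *)
Lemma sum_fejer n (w z : C R) : n.-primitive_root w -> `|z| = 1 ->
  \sum_(j < n) fejer n (w ^+ j) z = 1.
Proof.
move=> hw z1; have n0 : (n%:R : C R) != 0 by rewrite pnatr_eq0 -lt0n (prim_order_gt0 hw).
have conjE j : (dft n (w ^+ j) (z : scal R) : C R)^* =
    n%:R^-1 * \sum_(m < n) (w ^+ j) ^+ m * z^* ^+ m.
  rewrite /dft [LHS]rmorphM /= fmorphV rmorph_nat rmorph_sum /=; congr (_ * _).
  apply: eq_bigr => m _; rewrite [LHS]rmorphM /= !rmorphXn /=.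
  by rewrite conjCK.
rewrite (eq_bigr (fun j : 'I_n => \sum_(m < n) n%:R^-1 *
   (z^* ^+ m * ((w ^+ j) ^+ m * (dft n (w ^+ j) (z : scal R) : C R))))); last first.
  move=> j _; rewrite /fejer normCK conjE mulrCA mulr_sumr mulr_sumr.
  by apply: eq_bigr => m _; ring.
rewrite exchange_big /= (eq_bigr (fun _ => n%:R^-1)) ?sumr_const ?card_ord.
  by rewrite -[_ *+ n]mulr_natr mulVf.
move=> m _; rewrite -!mulr_sumr.
have <- : (z : scal R) ^+ m = \sum_(j < n) (w ^+ j) ^+ m * (dft n (w ^+ j) (z : scal R) : C R).
  exact: dft_interp.
by rewrite -exprMn mulrC [z^* * z]mulrC conj_norm1 // expr1n mul1r.
Qed.

(** With s the quotient of z by the root, the kernel is (s ^ n - 1) / (n (s - 1)) and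
    the distance is the modulus of s - 1. *)
Lemma dist_fejer n (w z : C R) j : n.-primitive_root w -> `|z| = 1 ->
  `|z - w ^+ j| ^+ 2 * fejer n (w ^+ j) z <= 4 / n%:R ^+ 2.
Proof.
move=> hw z1; have n0 : 0 < (n%:R : C R) by rewrite ltr0n (prim_order_gt0 hw).
set v := w ^+ j; have v1 : `|v| = 1 by rewrite normrX (norm_prim_root hw) expr1n.
have vv := conj_norm1 v1; set s := v^* * z.
have dE : (dft n v (z : scal R) : C R) = n%:R^-1 * \sum_(m < n) s ^+ m.
  by rewrite /dft; congr (_ * _); apply: eq_bigr => m _; rewrite exprMn.
have s1 : `|s| = 1 by rewrite normrM norm_conjC v1 z1 mulr1.
have -> : `|z - v| = `|s - 1|.
  have -> : z - v = v * (s - 1) by rewrite mulrBr mulrA vv mul1r mulr1.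
  by rewrite normrM v1 mul1r.
rewrite /fejer dE -exprMn -normrM mulrCA -subrX1 normrM exprMn.
rewrite ger0_norm ?invr_ge0 ?(ltW n0) // exprVn mulrC ler_wpM2r ?invr_ge0 ?exprn_ge0 ?(ltW n0) //.
have -> : 4 = 2 ^+ 2 :> C R by rewrite -natrX.
apply: lerXn2r; rewrite ?nnegrE //; apply: le_trans (ler_normB _ _) _.
by rewrite normrX s1 expr1n normr1.
Qed.

Lemma sum_dist_fejer n (w z : C R) : n.-primitive_root w -> `|z| = 1 ->
  \sum_(j < n) `|z - w ^+ j| ^+ 2 * fejer n (w ^+ j) z <= 4 / n%:R.
Proof.
move=> hw z1; have n0 : (n%:R : C R) != 0 by rewrite pnatr_eq0 -lt0n (prim_order_gt0 hw).
apply: le_trans (ler_sum _ (fun (j : 'I_n) _ => dist_fejer j hw z1)) _.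
by rewrite sumr_const card_ord -mulr_natr le_eqVlt; apply/orP; left; apply/eqP; field.
Qed.

Variable I : finType.

(** Functions on the torus given by *-polynomials in the coordinates, that is, by
    trigonometric polynomials. *)
Definition trigonometric (g : (I -> C R) -> C R) :=
  exists t : star_poly R I, forall z : I -> C R, (speval (A := scal R) z t : C R) = g z.

Lemma trig_const c : trigonometric (fun=> c).
Proof. by exists (PScal c) => z /=; rewrite /GRing.scale /= mulr1. Qed.
Lemma trig_coord i : trigonometric (fun z => z i).
Proof. by exists (PGen i). Qed.
Lemma trig_mul g h : trigonometric g -> trigonometric h ->
  trigonometric (fun z => g z * h z).
Proof. by move=> [s hs] [t ht]; exists (PMul s t) => z /=; rewrite -hs -ht. Qed.
Lemma trig_conj g : trigonometric g -> trigonometric (fun z => (g z)^*).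
Proof. by move=> [s hs]; exists (sp_star s) => z /=; rewrite speval_star -hs. Qed.
Lemma trig_sum (J : Type) (r : seq J) (g : J -> (I -> C R) -> C R) :
  (forall j, trigonometric (g j)) -> trigonometric (fun z => \sum_(j <- r) g j z).
Proof.
move=> hg; elim: r => [|j r [t ht]].
  by have [t ht] := trig_const 0; exists t => z; rewrite big_nil.
have [s hs] := hg j; exists (PAdd s t) => z.
by rewrite big_cons -hs -ht.
Qed.
Lemma trig_prod (J : Type) (r : seq J) (g : J -> (I -> C R) -> C R) :
  (forall j, trigonometric (g j)) -> trigonometric (fun z => \prod_(j <- r) g j z).
Proof.
move=> hg; elim: r => [|j r [t ht]].
  by have [t ht] := trig_const 1; exists t => z; rewrite big_nil.
have [s hs] := hg j; exists (PMul s t) => z.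
by rewrite big_cons -hs -ht.
Qed.
Lemma trig_exp g n : trigonometric g -> trigonometric (fun z => g z ^+ n).
Proof.
move=> hg; elim: n => [|n IH]; first by case: (trig_const 1) => t ht; exists t.
by have [t ht] := trig_mul hg IH; exists t => z; rewrite ht exprS.
Qed.
Lemma trig_fejer n w i : trigonometric (fun z => fejer n w (z i)).
Proof.
have [t ht] : trigonometric (fun z => (dft n w (z i : scal R) : C R)).
  have [t ht] := trig_mul (trig_const n%:R^-1) (trig_sum (index_enum 'I_n)
    (fun m : 'I_n => trig_mul (trig_const (w^* ^+ m)) (trig_exp m (trig_coord i)))).
  by exists t => z; rewrite ht.
have [s hs] := trig_mul (ex_intro _ t ht) (trig_conj (ex_intro _ t ht)).
by exists s => z; rewrite hs /fejer normCK.
Qed.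

(** Averages of f at points of the discrete torus, weighted by a product of Fejer
    kernels, are trigonometric polynomials; the weights have total mass 1 and second
    moment at most 4 / n in each variable, which is all that the quadratic modulus of
    continuity asks for. *)
Lemma trig_approx (f : (I -> C R) -> C R) (e c : C R) : 0 < e -> 0 <= c ->
  (forall y z : I -> C R, (forall i, `|y i| = 1) -> (forall i, `|z i| = 1) ->
     `|f y - f z| <= e + c * \sum_i `|y i - z i| ^+ 2) ->
  exists2 g, trigonometric g &
    forall z : I -> C R, (forall i, `|z i| = 1) -> `|f z - g z| <= e + e.
Proof.
move=> e0 c0 H.
pose c' := c * #|I|%:R * 4.
have c'0 : 0 <= c' by rewrite !mulr_ge0 ?ler0n.
have [n hn] := archi_C (divr_ge0 c'0 (ltW e0)).
have [w hw] := C_primitive_root R (ltn0Sn n).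
pose node (v : {ffun I -> 'I_n.+1}) i : C R := w ^+ v i.
pose k z (v : {ffun I -> 'I_n.+1}) := \prod_i fejer n.+1 (w ^+ v i) (z i).
exists (fun z => \sum_(v : {ffun I -> 'I_n.+1}) f (node v) * k z v).
  apply: trig_sum => v; apply: trig_mul; first exact: trig_const.
  by apply: trig_prod => i; apply: trig_fejer.
move=> z z1.
have k1 : \sum_v k z v = 1.
  rewrite /k -(bigA_distr_bigA (fun i j => fejer n.+1 (w ^+ nat_of_ord j) (z i))) /=.
  by rewrite big1 // => i _; apply: sum_fejer.
have node1 v i : `|node v i| = 1 by rewrite /node normrX (norm_prim_root hw) expr1n.
rewrite -[f z]mulr1 -k1 mulr_sumr -sumrB.
apply: le_trans (ler_norm_sum _ _ _) _.
apply: le_trans (_ : \sum_v (e + c * \sum_i `|z i - node v i| ^+ 2) * k z v <= _).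
  apply: ler_sum => v _; rewrite -mulrBl normrM.
  have k0 : 0 <= k z v by apply: prodr_ge0 => i _; apply: fejer_ge0.
  by rewrite (ger0_norm k0) ler_wpM2r // H.
under eq_bigr do rewrite mulrDl.
rewrite big_split /= -mulr_sumr k1 mulr1 lerD2l.
apply: le_trans (_ : c * \sum_(i : I) (4 / n.+1%:R) <= _); last first.
  rewrite sumr_const -mulr_natr.
  rewrite (_ : _ * _ = c' / n.+1%:R); last by rewrite /c'; ring.
  by rewrite ler_pdivrMr ?ltr0n // mulrC -ler_pdivrMr // ltW.
under eq_bigr do rewrite -mulrA.
rewrite -[leLHS]mulr_sumr ler_wpM2l //.
under eq_bigr do rewrite mulr_suml.
rewrite exchange_big /=; apply: ler_sum => i _.
rewrite (eq_bigr (fun v : {ffun I -> 'I_n.+1} => \prod_i'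
  ((if i' == i then `|z i - w ^+ v i'| ^+ 2 else 1) * fejer n.+1 (w ^+ v i') (z i')))); last first.
  move=> v _; rewrite big_split /= -big_mkcond /= big_pred1_eq //.
rewrite -(bigA_distr_bigA (fun i' j => (if i' == i then `|z i - w ^+ nat_of_ord j| ^+ 2 else 1)
  * fejer n.+1 (w ^+ nat_of_ord j) (z i'))) /=.
rewrite (bigD1 i) //= [X in _ * X]big1 ?mulr1.
  by rewrite eqxx; apply: sum_dist_fejer.
move=> i' /negPf ->; under eq_bigr do rewrite mul1r; exact: sum_fejer.
Qed.

End FejerKernel.

(** * Continuous functions on a compact torus *)

Section ComplexTopology.
Variable R : realType.

Lemma cvg_to_C_P (T : Type) (F : set_system T) (f : T -> C R) (y : C R) :
  Filter F -> (f @ F --> y) <->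
  (forall e : C R, 0 < e -> \forall p \near F, `|y - f p| < e).
Proof. by move=> FF; apply: cvgrPdist_lt. Qed.

Lemma conjC_continuous : continuous (fun z : C R => z^*).
Proof.
move=> z; apply/(cvg_to_C_P _ _ (nbhs_filter z)) => e e0.
have /(cvg_to_C_P _ _ (nbhs_filter z))/(_ e e0) : id @ nbhs z --> z by exact: cvg_id.
by apply: filterS => w; rewrite -rmorphB norm_conjC.
Qed.

Lemma complex_continuous : continuous (fun p : R * R => (p.1 +i* p.2)%C : C R).
Proof.
move=> p; apply/(cvg_to_C_P _ _ (nbhs_filter p)) => e /gt0_realE [r r0 ->].
have r2 : 0 < r / 2 by rewrite divr_gt0.
have h1 : \forall q \near p, `|p.1 - q.1| < r / 2.
  by apply: (@cvgr_dist_lt _ _ _ (nbhs p) _ fst p.1) => //; exact: cvg_fst.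
have h2 : \forall q \near p, `|p.2 - q.2| < r / 2.
  by apply: (@cvgr_dist_lt _ _ _ (nbhs p) _ snd p.2) => //; exact: cvg_snd.
apply: filterS2 h1 h2 => q h1 h2.
apply: le_lt_trans (norm_complex_le _) _; rewrite ltcR.
by rewrite [r]splitr; apply: ltrD.
Qed.

(** The circle is closed in the image of the square of side 2. *)
Lemma compact_circle : compact [set z : C R | `|z| = 1].
Proof.
pose box : set (R * R) := `[-1, 1]%classic `*` `[-1, 1]%classic.
have cbox : compact box by apply: compact_setX; apply: segment_compact.
have cim : compact ((fun p : R * R => (p.1 +i* p.2)%C : C R) @` box).
  by apply: continuous_compact => //; apply: continuous_subspaceT complex_continuous.
apply: subclosed_compact cim _.
  move=> z clz; apply: contrapT => nz.
  have d0 : 0 < `| `|z| - 1 | by rewrite normr_gt0 subr_eq0; apply/eqP.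
  have /(cvg_to_C_P _ _ (nbhs_filter z))/(_ _ d0) : id @ nbhs z --> z by exact: cvg_id.
  move=> /clz [w [/= w1]]; rewrite -w1 => h.
  by have := le_lt_trans (ler_dist_dist z w) h; rewrite ltxx.
move=> z /= z1; exists (complex.Re z, complex.Im z); last by case: (z).
have h1 := norm_Re_le z; have h2 := norm_Im_le z.
rewrite z1 !lecR in h1 h2.
by split; rewrite /= in_itv /= -ler_norml.
Qed.

End ComplexTopology.

(** The torus is given abstractly, by a space X with coordinates that identify K with
    the families of complex numbers of modulus 1; this covers the torus in the form
    of the definition and its square. *)
Section TorusModel.
Variables (R : realType) (X : topologicalType) (I : finType).
Variables (coord : X -> I -> C R) (K : set X).
Hypothesis K_compact : compact K.
Hypothesis K_def : forall p, K p <-> forall i, `|coord p i| = 1.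
Hypothesis coord_cont : forall i, continuous (fun p => coord p i).
Hypothesis coord_inj : forall p q, coord p =1 coord q -> p = q.
Hypothesis coord_surj : forall z : I -> C R, (forall i, `|z i| = 1) ->
  exists p, coord p =1 z.

(** By compactness of K x K: near the diagonal the left-hand side is at most e, and
    away from it the sum is bounded below. *)
Lemma uniform_modulus (f : X -> C R) (e : C R) : {within K, continuous f} -> 0 < e ->
  exists n : nat, forall p q, K p -> K q ->
    `|f p - f q| <= e + n%:R * \sum_i `|coord p i - coord q i| ^+ 2.
Proof.
move=> fc e0; have e2 : 0 < e / 2 by rewrite divr_gt0.
have KK := compact_setX K_compact K_compact.
move/compact_near_coveringP : KK => /(_ nat \oo
  (fun n p => K p.1 -> K p.2 -> `|f p.1 - f p.2| <=
     e + n%:R * \sum_i `|coord p.1 i - coord p.2 i| ^+ 2) _).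
case=> [[p q] /= [Kp Kq]|N _ HN]; last first.
  by exists N => p q Kp Kq; apply: (HN N (leqnn N) (p, q)).
have sum0 p' q' : 0 <= \sum_i `|coord p' i - coord q' i| ^+ 2.
  by apply: sumr_ge0 => i _; rewrite exprn_ge0.
have fnear p0 d : K p0 -> 0 < d -> \forall p' \near p0, K p' -> `|f p0 - f p'| < d.
  move=> Kp0 d0; have /subspace_continuousP /(_ _ Kp0) := fc.
  by move/cvgrPdist_lt => /(_ _ d0); rewrite near_withinE.
have [pq|npq] := pselect (p = q).
  rewrite -pq in Kq *; near=> p' n => /= Kp1 Kp2.
  apply: le_trans (_ : e <= _); last by rewrite lerDl mulr_ge0.
  rewrite [e]splitr; apply: le_trans (ler_distD (f p) _ _) _.
  apply: lerD; first rewrite distrC.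
    apply: ltW; move: Kp1; near: p'.
    by have := fnear _ _ Kp e2; apply: (@cvg_fst _ _ (nbhs p) (nbhs p)).
  apply: ltW; move: Kp2; near: p'.
  by have := fnear _ _ Kp e2; apply: (@cvg_snd _ _ (nbhs p) (nbhs p)).
have [i hi] : exists i, coord p i != coord q i.
  apply: contrapT => h; apply: npq; apply: coord_inj => i.
  by apply: contrapT => /eqP hi; apply: h; exists i.
pose d := `|coord p i - coord q i|.
have d0 : 0 < d by rewrite normr_gt0 subr_eq0.
have d4 : 0 < d / 2 / 2 by rewrite !divr_gt0.
pose B := 1 + `|f p - f q| + 1.
have B0 : 0 <= B by rewrite !addr_ge0.
have [n0 hn0] := archi_C (divr_ge0 B0 (exprn_ge0 2 (ltW (divr_gt0 d0 (ltr0n _ 2))))).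
near=> p' n => /= Kp1 Kp2.
apply: le_trans (_ : B <= _).
  apply: le_trans (ler_distD (f p) _ _) _; rewrite /B -addrA; apply: lerD.
    rewrite distrC; apply: ltW; move: Kp1; near: p'.
    by have := fnear _ _ Kp ltr01; apply: (@cvg_fst _ _ (nbhs p) (nbhs q)).
  apply: le_trans (ler_distD (f q) _ _) _; rewrite lerD2l.
  apply: ltW; move: Kp2; near: p'.
  by have := fnear _ _ Kq ltr01; apply: (@cvg_snd _ _ (nbhs p) (nbhs q)).
have dn : d / 2 <= `|coord p'.1 i - coord p'.2 i|.
  have h1 : `|coord p i - coord p'.1 i| < d / 2 / 2.
    near: p'; have /cvgrPdist_lt /(_ _ d4) := @coord_cont i p.
    by apply: (@cvg_fst _ _ (nbhs p) (nbhs q)).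
  have h2 : `|coord q i - coord p'.2 i| < d / 2 / 2.
    near: p'; have /cvgrPdist_lt /(_ _ d4) := @coord_cont i q.
    by apply: (@cvg_snd _ _ (nbhs p) (nbhs q)).
  have h3 : d <= d / 2 / 2 + (`|coord p'.1 i - coord p'.2 i| + d / 2 / 2).
    apply: le_trans (ler_distD (coord p'.1 i) _ _) _; apply: lerD; first exact: ltW.
    apply: le_trans (ler_distD (coord p'.2 i) _ _) _; rewrite lerD2l distrC; exact: ltW.
  move: h3; rewrite addrCA -splitr -lerBlDr => h3; apply: le_trans h3.
  by rewrite {2}[d]splitr addrK.
have sq : (d / 2) ^+ 2 <= \sum_i `|coord p'.1 i - coord p'.2 i| ^+ 2.
  rewrite (bigD1 i) //=; apply: ler_wpDr.
    by apply: sumr_ge0 => j _; rewrite exprn_ge0.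
  by apply: lerXn2r; rewrite ?nnegrE // divr_ge0 // ltW.
apply: ler_wpDl; first exact: ltW.
have n0n : (n0.+1 <= n)%N by near: n; exists n0.+1.
apply: le_trans (_ : n0.+1%:R * (d / 2) ^+ 2 <= _).
  by rewrite -ler_pdivrMr ?exprn_gt0 ?divr_gt0 // ltW.
by apply: ler_pM => //; rewrite ?exprn_ge0 ?divr_ge0 ?(ltW d0) // ler_nat.
Unshelve. all: by end_near. Qed.

Lemma continuous_approx (f : X -> C R) (e : C R) : {within K, continuous f} -> 0 < e ->
  exists t : star_poly R I, forall p, K p ->
    `|f p - speval (A := scal R) (coord p) t| <= e.
Proof.
move=> fc e0; have e2 : 0 < e / 2 by rewrite divr_gt0.
have [n hn] := uniform_modulus fc e2.
have /choice[pt hpt] : forall z : I -> C R, exists p,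
    (forall i, `|z i| = 1) -> coord p =1 z.
  move=> z; have [z1|nz] := pselect (forall i, `|z i| = 1).
    by have [p hp] := coord_surj z1; exists p.
  by have [|p _] := @coord_surj (fun=> 1); [move=> i; rewrite normr1|exists p].
have Kpt z : (forall i, `|z i| = 1) -> K (pt z).
  by move=> z1; apply/K_def => i; rewrite (hpt z z1).
have [|g [t ht] hg] := @trig_approx R I (f \o pt) (e / 2) n%:R e2 (ler0n _ n).
  move=> y z y1 z1 /=.
  apply: le_trans (hn _ _ (Kpt y y1) (Kpt z z1)) _.
  rewrite (eq_bigr (fun i => `|y i - z i| ^+ 2)) // => i _.
  by rewrite (hpt y y1) (hpt z z1).
exists t => p Kp; have p1 i : `|coord p i| = 1 by have /K_def := Kp.
have := hg _ p1; rewrite -splitr ht /=.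
by rewrite (coord_inj (hpt _ p1)).
Qed.

Lemma speval_coord_continuous (t : star_poly R I) :
  continuous (fun p => speval (A := scal R) (coord p) t : C R).
Proof.
elim: t => [z|i|i|s hs t ht|s hs t ht] p /=.
- exact: cst_continuous.
- exact: coord_cont.
- apply: (@continuous_comp _ _ _ (fun p => coord p i) (fun z : C R => z^*)).
    exact: coord_cont.
  exact: conjC_continuous.
- by apply: (@continuousD _ (C R)); [exact: hs|exact: ht].
- by apply: (@continuousM (C R)); [exact: hs|exact: ht].
Qed.

(** Gelfand duality in the case at hand. The characters separate the norms because
    the norm of a *-polynomial in commuting unitaries is at most its supremum over
    the torus, and every continuous function is attained because trigonometric
    polynomials are dense and A is complete. *)
Theorem torus_continuous_functions (A : cstarType R) (x : I -> A)
    (ev : A -> X -> C R) :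
  commuting_unitaries x -> sp_dense x ->
  (forall p, K p -> exists2 chi : {lrmorphism A -> scal R}, star_preserving chi &
     (forall a, ev a p = chi a) /\ (forall i, ev (x i) p = coord p i)) ->
  is_continuous_functions K ev.
Proof.
move=> ux dx hev.
have evsp t p : K p -> ev (speval x t) p = speval (A := scal R) (coord p) t.
  move=> /hev [chi sc [ec ex]]; rewrite ec speval_hom //.
  by apply: (@eq_speval R I (scal R) (chi \o x) (coord p)) => i /=; rewrite -ec ex.
have evB a b p : K p -> ev (a - b) p = ev a p - ev b p.
  by move=> /hev [chi _ [ec _]]; rewrite !ec raddfB.
have contr a p : K p -> `|ev a p| <= cnorm a.
  by move=> /hev [chi sc [ec _]]; rewrite ec; exact: (star_hom_contractive sc).
have [p0 Kp0] : exists p, K p.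
  have [|p hp] := @coord_surj (fun=> 1); first by move=> i; rewrite normr1.
  by exists p; apply/K_def => i; rewrite hp normr1.
have bound a M : (forall p, K p -> `|ev a p| <= M) -> cnorm a <= M.
  move=> h; have M0 : 0 <= M by apply: le_trans (h _ Kp0).
  apply: le_of_eps => //; first exact: cnorm_ge0.
  move=> e e0; have e2 : 0 < e / 2 by rewrite divr_gt0.
  have [t ht] := dx a _ e2.
  have st : cnorm (speval x t) <= M + e / 2.
    apply: (cnorm_speval_le ux); first by rewrite addr_ge0 // ltW.
    move=> z z1; have [p hp] := coord_surj z1.
    have Kp : K p by apply/K_def => i; rewrite hp z1.
    rewrite -(eq_speval (A := scal R) t hp) -evsp //.
    rewrite -[ev _ p](subrK (ev a p)) addrC -evB //.
    apply: le_trans (ler_normD _ _) _; rewrite lerD ?h //.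
    by apply: le_trans (contr _ _ Kp) _; rewrite cnorm_distC ltW.
  rewrite -[a](subrK (speval x t)) addrC; apply: le_trans (cnormD _ _) _.
  by rewrite [e]splitr addrA lerD // ltW.
split.
- split=> [a|f fc].
    apply/subspace_continuousP => p Kp.
    apply/(cvg_to_C_P _ _ (within_filter _ (nbhs_filter p))) => e e0.
    have e3 : 0 < e / 2 / 2 by rewrite !divr_gt0.
    have [t ht] := dx a _ e3.
    have /(cvg_to_C_P _ _ (nbhs_filter p))/(_ _ (divr_gt0 e0 (ltr0n _ 2))) :=
      @speval_coord_continuous t p.
    rewrite near_withinE; apply: filterS => q hq Kq.
    have d r : K r -> `|ev a r - speval (A := scal R) (coord r) t| < e / 2 / 2.
      by move=> Kr; rewrite -evsp // -evB //; apply: le_lt_trans (contr _ _ Kr) ht.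
    apply: le_lt_trans (ler_distD (speval (A := scal R) (coord p) t) _ _) _.
    apply: le_lt_trans (lerD (lexx _) (ler_distD (speval (A := scal R) (coord q) t) _ _)) _.
    have -> : e = e / 2 / 2 + (e / 2 + e / 2 / 2) by rewrite addrCA -!splitr.
    by apply: ltrD; [exact: d|apply: ltrD => //; rewrite distrC; exact: d].
  have /choice[t ht] : forall n : nat, exists t : star_poly R I, forall p, K p ->
      `|f p - speval (A := scal R) (coord p) t| <= 1 / 2 ^+ n.
    by move=> n; apply: continuous_approx; rewrite ?divr_gt0 ?exprn_gt0.
  have [//|n|a ha] := @cvg_half_pow R A (fun n => speval x (t n)) 2.
    apply: bound => p Kp; rewrite evB // !evsp //.
    apply: le_trans (ler_distD (f p) _ _) _.
    rewrite [leRHS](_ : _ = 1 / 2 ^+ n + 1 / 2 ^+ n); last by rewrite -mulrDl.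
    apply: lerD; last exact: ht.
    rewrite distrC; apply: le_trans (ht _ _ Kp) _.
    rewrite !mul1r exprS invfM ler_piMl ?invr_ge0 ?exprn_ge0 //.
    by rewrite invf_le1 // ler1n.
  exists a => p Kp; apply: (@eq_of_half_pow R (scal R) _ _ (2 * 2 + 1)) => // n.
  apply: le_trans (ler_distD (ev (speval x (t n)) p) _ _) _.
  rewrite mulrDl; apply: lerD; last by rewrite distrC evsp // ht.
  rewrite -evB //; apply: le_trans (contr _ _ Kp) _; rewrite cnorm_distC; exact: ha.
- by move=> z a b p /hev [chi _ [ec _]]; rewrite !ec linearP.
- split=> [a b p|p] /hev [chi _ [ec _]]; rewrite !ec ?rmorphM ?rmorph1 //.
- by move=> a p /hev [chi sc [ec _]]; rewrite !ec sc.
move=> a M; split; last exact: bound.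
by move=> h p Kp; apply: le_trans (contr _ _ Kp) h.
Qed.

End TorusModel.

(** * The torus as a quantum group *)

Section Multiplication.
Variables (R : realType) (c : C R).
Definition scalar_mult (x : scal R) : scal R := (c : scal R) * x.
Fact scalar_mult_zmod : GRing.zmod_morphism scalar_mult.
Proof. by move=> x y; rewrite /scalar_mult mulrBr. Qed.
Fact scalar_mult_scalable : scalable scalar_mult.
Proof. by move=> z x; rewrite /scalar_mult -scalerAr. Qed.
HB.instance Definition _ :=
  GRing.isZmodMorphism.Build (scal R) (scal R) scalar_mult scalar_mult_zmod.
HB.instance Definition _ :=
  GRing.isScalable.Build (C R) (scal R) (scal R) *:%R scalar_mult scalar_mult_scalable.
End Multiplication.

Section TensorCharacters.
Variable R : realType.

(** A character acts on the one-dimensional Hilbert space by multiplication. *)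
Lemma character_representation (A : cstarType R) (chi : {lrmorphism A -> scal R}) :
  star_preserving chi ->
  representation (fun a => scalar_mult (chi a) : {linear scal R -> scal R}).
Proof.
move=> sc; split=> [a|z a b x|a b x|x|a x y].
- by move=> x; apply: (@mulrl_continuous (C R)).
- by rewrite /= /scalar_mult linearP mulrDl -scalerAl.
- by rewrite /= /scalar_mult rmorphM mulrA.
- by rewrite /= /scalar_mult rmorph1 mul1r.
rewrite /inner /= /scalar_mult sc /star /=.
by rewrite [(_ * y : C R)^*]rmorphM /=; ring.
Qed.

Variables (A B T : cstarType R) (l1 : {lrmorphism A -> T}) (l2 : {lrmorphism B -> T}).
Hypothesis tens : is_tensor l1 l2.

(** The spatial norm dominates pairs of one-dimensional representations, so the
    product functional is bounded by it and extends from the algebraic tensor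
    product. *)
Lemma tensor_character (chi1 : {lrmorphism A -> scal R}) (chi2 : {lrmorphism B -> scal R}) :
  star_preserving chi1 -> star_preserving chi2 ->
  exists psi : {lrmorphism T -> scal R}, [/\ star_preserving psi,
    forall a, psi (l1 a) = chi1 a & forall b, psi (l2 b) = chi2 b].
Proof.
move=> s1 s2; have [sl1 sl2 com dense bnd] := tens.
pose phi (s : seq (A * B)) := \sum_(p <- s) l1 p.1 * l2 p.2.
pose psi (s : seq (A * B)) := \sum_(p <- s) chi1 p.1 * chi2 p.2.
have le s : cnorm (psi s) <= cnorm (phi s).
  have /(bnd s _ (cnorm_ge0 _)) := lexx (cnorm (phi s)).
  move=> /(_ _ _ _ _ (character_representation s1) (character_representation s2) [:: (1, 1)]).
  have -> : tensor_act (fun a => scalar_mult (chi1 a) : {linear scal R -> scal R})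
      (fun b => scalar_mult (chi2 b) : {linear scal R -> scal R}) s [:: (1, 1)]
      = [seq (chi1 p.1, chi2 p.2) | p <- s].
    rewrite /tensor_act; elim: (s) => //= p s' ->.
    by rewrite /scalar_mult !mulr1.
  rewrite /tensor_norm2 big_map !big_seq1 /inner /= conjC1 !mulr1 => h.
  rewrite -(@ler_pXn2r _ 2) ?nnegrE ?cnorm_ge0 //; apply: le_trans h.
  rewrite le_eqVlt; apply/orP; left; apply/eqP.
  rewrite [LHS]normCK /psi [X in _ * X]rmorph_sum /= mulr_suml; apply: eq_bigr => p _.
  rewrite big_map mulr_sumr; apply: eq_bigr => q _.
  by rewrite rmorphM /=; ring.
have phi_cat s t : phi (s ++ t) = phi s + phi t by rewrite /phi big_cat.
have psi_cat s t : psi (s ++ t) = psi s + psi t by rewrite /psi big_cat.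
pose zs (z : C R) (s : seq (A * B)) := [seq (z *: p.1, p.2) | p <- s].
have phi_z z s : phi (zs z s) = z *: phi s.
  rewrite /phi big_map scaler_sumr; apply: eq_bigr => p _.
  by rewrite /= linearZ /= scalerAl.
have psi_z z s : psi (zs z s) = z *: psi s.
  rewrite /psi big_map scaler_sumr; apply: eq_bigr => p _.
  by rewrite /= linearZ /= scalerAl.
have [||z s t|s t||s|f [sf ff _]] := @extend_by_density R T (scal R) (seq (A * B)) phi psi.
- by move=> a e /dense; exact.
- move=> s t; have := le (s ++ zs (-1) t).
  by rewrite phi_cat psi_cat phi_z psi_z !scaleN1r.
- by exists (zs z s ++ t); rewrite phi_cat psi_cat phi_z psi_z.
- exists [seq (p.1 * q.1, p.2 * q.2) | p <- s, q <- t]; split.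
    rewrite /phi big_allpairs_dep mulr_suml; apply: eq_bigr => p _.
    rewrite mulr_sumr; apply: eq_bigr => q _ /=.
    by rewrite !rmorphM /= -!mulrA; congr (_ * _); rewrite !mulrA com.
  rewrite /psi big_allpairs_dep mulr_suml; apply: eq_bigr => p _.
  rewrite mulr_sumr; apply: eq_bigr => q _ /=.
  by rewrite !rmorphM /= -!mulrA; congr (_ * _); rewrite !mulrA [chi1 _ * _]mulrC.
- by exists [:: (1, 1)]; rewrite /phi /psi !big_seq1 /= !rmorph1 !mulr1.
- exists [seq (star p.1, star p.2) | p <- s]; rewrite /phi /psi !big_map !star_sum.
  split; apply: eq_bigr => p _ /=; first by rewrite com starM sl1 sl2.
  by rewrite s1 s2 starM [LHS]mulrC.
exists f; split=> // [a|b].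
  by have := ff [:: (a, 1)]; rewrite /phi /psi !big_seq1 /= !rmorph1 !mulr1.
by have := ff [:: (1, b)]; rewrite /phi /psi !big_seq1 /= !rmorph1 !mul1r.
Qed.

(** Homomorphisms are contractive, so both legs respect the closure of the set of
    *-polynomials. *)
Lemma tensor_dense (I J : Type) (x : I -> A) (y : J -> B) :
  sp_dense x -> sp_dense y ->
  sp_dense (fun k : I + J => match k with inl i => l1 (x i) | inr j => l2 (y j) end).
Proof.
move=> dx dy; have [sl1 sl2 com dense bnd] := tens; set z := fun k => _.
pose fix relabel (K L : Type) (h : K -> L) (t : star_poly R K) : star_poly R L :=
  match t with
  | PScal c => PScal c | PGen i => PGen (h i) | PStar i => PStar (h i)
  | PAdd s t => PAdd (relabel K L h s) (relabel K L h t)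
  | PMul s t => PMul (relabel K L h s) (relabel K L h t)
  end.
have relE (K L : Type) (h : K -> L) (D : cstarType R) (u : L -> D) t :
    speval u (relabel _ _ h t) = speval (u \o h) t.
  by elim: t => //= [s -> t ->|s -> t ->].
have leg (D : cstarType R) (K : Type) (l : {lrmorphism D -> T}) (u : K -> D) (h : K -> I + J) :
    star_preserving l -> sp_dense u -> (forall k, l (u k) = z (h k)) ->
    forall a, in_closure z (l a).
  move=> sl du hl a e e0; have [t ht] := du a e e0; exists (relabel _ _ h t).
  rewrite relE -(@eq_speval _ _ _ (l \o u)) // -speval_hom // -raddfB.
  exact: le_lt_trans (star_hom_contractive sl _) ht.
have c1 a : in_closure z (l1 a) by apply: (leg _ _ l1 x inl).
have c2 b : in_closure z (l2 b) by apply: (leg _ _ l2 y inr).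
move=> a e e0; have e2 : 0 < e / 2 by rewrite divr_gt0.
have [s hs] := dense a _ e2; set b := \sum_(p <- s) _ in hs.
have : b \in gen_closure z.
  by apply: (@rpred_sum T (gen_closure z)) => p _; apply: (@rpredM T (gen_closure z)); apply/asboolP.
move=> /asboolP /(_ _ e2) [t ht]; exists t.
apply: le_lt_trans (cnorm_dist b _ _) _.
by rewrite [e]splitr ltrD.
Qed.
End TensorCharacters.

Section FunctionAlgebras.
Variables (R : realType) (X : topologicalType) (K : set X) (A : cstarType R).
Variable ev : A -> X -> C R.
Hypothesis hev : is_continuous_functions K ev.

Lemma cf_sub a b p : K p -> ev (a - b) p = ev a p - ev b p.
Proof.
move=> Kp; have [_ lin _ _ _] := hev.
by rewrite -[a - b]addrC -scaleN1r lin // mulN1r addrC.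
Qed.

Lemma cf_eq a b : (forall p, K p -> ev a p = ev b p) -> a = b.
Proof.
move=> h; have [_ _ _ _ nrm] := hev.
apply/eqP; rewrite -subr_eq0; apply/eqP/cnorm_eq0/eqP.
rewrite eq_le cnorm_ge0 andbT; apply/nrm => p Kp.
by rewrite cf_sub // h // subrr normr0.
Qed.

Lemma cf_speval (I : Type) (x : I -> A) (t : star_poly R I) p : K p ->
  ev (speval x t) p = speval (A := scal R) (fun i => ev (x i) p) t.
Proof.
move=> Kp; have [_ lin [mul one] st _] := hev.
have add a b : ev (a + b) p = ev a p + ev b p.
  by rewrite -[a]scale1r lin // scale1r mul1r.
have zero : ev 0 p = 0 by rewrite -(subrr 1) cf_sub // subrr.
elim: t => //= [z|i|s <- t <-|s <- t <-].
- by rewrite -[z *: 1]addr0 lin // one // zero addr0.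
- exact: st.
- exact: add.
- exact: mul.
Qed.
End FunctionAlgebras.

Section TorusGroup.
Variable R : realType.

Definition coord2 (p : C R * C R) (b : bool) : C R := if b then p.1 else p.2.
Definition coord4 (p : (C R * C R) * (C R * C R)) (k : bool + bool) : C R :=
  match k with inl b => coord2 p.1 b | inr b => coord2 p.2 b end.

Lemma torus2E p : @torus2 R p <-> forall b, `|coord2 p b| = 1.
Proof.
by split=> [[h1 h2] []|h] //; split; [exact: (h true)|exact: (h false)].
Qed.

Lemma torus4E p : (@torus2 R `*` @torus2 R) p <-> forall k, `|coord4 p k| = 1.
Proof.
split=> [[/torus2E h1 /torus2E h2] [b|b]|h]; [exact: h1|exact: h2|].
by split; apply/torus2E => b; [exact: (h (inl b))|exact: (h (inr b))].
Qed.

Lemma compact_torus2 : compact (@torus2 R).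
Proof. exact: (compact_setX (@compact_circle R) (@compact_circle R)). Qed.

Lemma coord2_continuous b : continuous (fun p => coord2 p b).
Proof. by case: b => p /=; [exact: cvg_fst|exact: cvg_snd]. Qed.

Lemma coord4_continuous k : continuous (fun p => coord4 p k).
Proof.
case: k => b p.
  apply: (@continuous_comp _ _ _ fst (fun p => coord2 p b)); first exact: cvg_fst.
  exact: coord2_continuous.
apply: (@continuous_comp _ _ _ snd (fun p => coord2 p b)); first exact: cvg_snd.
exact: coord2_continuous.
Qed.

Lemma coord2_inj p q : coord2 p =1 coord2 q -> p = q.
Proof. by case: p q => [p1 p2] [q1 q2] h; rewrite (h true : p1 = q1) (h false : p2 = q2). Qed.

Lemma coord4_inj p q : coord4 p =1 coord4 q -> p = q.
Proof.
case: p q => [p1 p2] [q1 q2] h.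
by congr (_, _); apply: coord2_inj => b; [exact: (h (inl b))|exact: (h (inr b))].
Qed.

Lemma coord2_surj (z : bool -> C R) : (forall i, `|z i| = 1) -> exists p, coord2 p =1 z.
Proof. by move=> _; exists (z true, z false) => -[]. Qed.

Lemma coord4_surj (z : bool + bool -> C R) : (forall i, `|z i| = 1) ->
  exists p, coord4 p =1 z.
Proof.
move=> _; exists ((z (inl true), z (inl false)), (z (inr true), z (inr false))).
by case=> [] [].
Qed.

(** Generators of the functions on the dual of Z^2, with their coproducts. *)
Definition torus_presentation (G : cqg R) (x : bool -> alg G) :=
  universal (fun B => @commuting_unitaries R bool B) x /\
  forall b, comul G (x b) = leg1 G (x b) * leg2 G (x b).

Lemma unitary_hom (A B : cstarType R) (f : {lrmorphism A -> B}) u :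
  star_preserving f -> unitary u -> unitary (f u).
Proof. by move=> sf [h1 h2]; split; rewrite -sf -rmorphM ?h1 ?h2 rmorph1. Qed.

Lemma commuting_unitaries_reflect (B B' : cstarType R) (g : {lrmorphism B -> B'})
    (b : bool -> B) : star_preserving g -> injective g ->
  commuting_unitaries (g \o b) -> commuting_unitaries b.
Proof.
move=> sg gi [ub cb]; split=> [i|i j]; last by apply: gi; rewrite !rmorphM; exact: cb.
by have [h1 h2] := ub i; split; apply: gi; rewrite rmorphM rmorph1 /= sg.
Qed.

Lemma torus_character_commuting p : torus2 p ->
  @commuting_unitaries R bool (scal R) (coord2 p).
Proof.
move=> /torus2E h; split=> [i|i j]; last by rewrite mulrC.
have e : (coord2 p i)^* * coord2 p i = 1 by rewrite mulrC conj_norm1.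
by split; [exact: e|rewrite mulrC; exact: e].
Qed.

(** The points of the torus give characters of the algebra by its universal
    property, hence characters of the tensor square; the comultiplication composed
    with the character of (z, w) is a character that agrees with that of z w on the
    generators. *)
Lemma presentation_is_torus (G : cqg R) (x : bool -> alg G) :
  torus_presentation x -> is_torus_group G.
Proof.
case: G x => A T l1 l2 D tens sD coas canc /= x [univ hD].
have [sl1 sl2 com _ _] := tens; have [cu ux] := univ.
have dx : sp_dense x.
  by apply: universal_dense univ => B B' g b sg gi; exact: commuting_unitaries_reflect.
have chr p : torus2 p -> exists2 chi : {lrmorphism A -> scal R}, star_preserving chi &
    forall b, chi (x b) = coord2 p b.
  by move=> /torus_character_commuting /ux [f [sf fx _]]; exists f.
have uniq (f g : {lrmorphism A -> scal R}) : star_preserving f -> star_preserving g ->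
    (forall b, f (x b) = g (x b)) -> f =1 g.
  move=> sf sg fg a; have : commuting_unitaries (g \o x).
    split=> [i|i j] /=; last by rewrite [LHS]mulrC.
    by apply: unitary_hom => //; case: cu.
  by move=> /ux [h [_ _ hu]]; rewrite (hu f) // (hu g).
have /choice[ev hev] : forall p, exists g : A -> C R, torus2 p ->
    exists2 chi : {lrmorphism A -> scal R}, star_preserving chi &
     (forall a, g a = chi a) /\ (forall i, g (x i) = coord2 p i).
  move=> p; have [/chr [chi sc hc]|np] := pselect (torus2 p); last by exists (fun=> 0).
  by exists chi => _; exists chi.
pose y k := match k with inl i => l1 (x i) | inr j => l2 (x j) end.
have dy : sp_dense y by apply: tensor_dense.
have cy : commuting_unitaries y.
  have [ux' cx] := cu; split=> [[i|i]|[i|i] [j|j]] /=.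
  - exact: unitary_hom.
  - exact: unitary_hom.
  - by rewrite -!rmorphM cx.
  - exact: com.
  - exact/esym/com.
  - by rewrite -!rmorphM cx.
have /choice[ev2 hev2] : forall p, exists g : T -> C R, (@torus2 R `*` @torus2 R) p ->
    exists2 chi : {lrmorphism T -> scal R}, star_preserving chi &
     (forall a, g a = chi a) /\ [/\ forall a, g (l1 a) = ev p.1 a &
        forall a, g (l2 a) = ev p.2 a].
  move=> p; have [[t1 t2]|np] := pselect ((@torus2 R `*` @torus2 R) p); last by exists (fun=> 0).
  have [c1 s1 [e1 _]] := hev _ t1; have [c2 s2 [e2 _]] := hev _ t2.
  have [psi [sp p1 p2]] := tensor_character tens s1 s2.
  exists psi => _; exists psi => //; split=> //.
  by split=> a; [rewrite e1 -p1|rewrite e2 -p2].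
exists (fun a p => ev p a), (fun a p => ev2 p a); split.
- apply: (torus_continuous_functions compact_torus2 torus2E coord2_continuous
    coord2_inj coord2_surj cu dx) => p Kp.
  by have [chi sc [c1 c2]] := hev p Kp; exists chi.
- apply: (torus_continuous_functions (compact_setX compact_torus2 compact_torus2) torus4E
    coord4_continuous coord4_inj coord4_surj cy dy) => p Kp.
  have [chi sc [c1 [c2 c3]]] := hev2 p Kp; exists chi => //; split=> //.
  have [K1 K2] := Kp; case=> i /=.
    by rewrite c2; have [_ _ [_]] := hev _ K1.
  by rewrite c3; have [_ _ [_]] := hev _ K2.
move=> a z w Kz Kw; have [chi sc [c1 [c2 c3]]] := hev2 (z, w) (conj Kz Kw).
split; [by rewrite c2|by rewrite c3|].
have Kzw : @torus2 R (z.1 * w.1, z.2 * w.2).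
  by case: Kz Kw => [h1 h2] [h3 h4]; split; rewrite /= normrM ?h1 ?h2 ?h3 ?h4 mulr1.
have [xi sx [x1 x2]] := hev _ Kzw; rewrite c1 x1.
apply: (uniq (chi \o D) xi) => // [b|b] /=; first by rewrite sD sc.
rewrite hD rmorphM /= -!c1 c2 c3 -x1 x2.
have [_ _ [_ ->]] := hev _ Kz; have [_ _ [_ ->]] := hev _ Kw.
by case: b.
Qed.

(** The coordinate functions are generators: trigonometric polynomials in them are
    dense, and their supremum norm dominates their norm in any algebra in which they
    are evaluated at commuting unitaries. *)
Lemma torus_has_presentation (G : cqg R) : is_torus_group G ->
  exists x : bool -> alg G, torus_presentation x.
Proof.
case: G => A T l1 l2 D tens sD coas canc [/= ev [ev2 [hev hev2 hD]]].
have [[contA surjA] linA [mulA oneA] stA nrmA] := hev.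
have [_ _ [mulT _] _ _] := hev2.
have /choice[x hx] : forall b, exists a : A, forall p, torus2 p -> ev a p = coord2 p b.
  move=> b; have [|a ha] := surjA (fun p => coord2 p b); last by exists a.
  by apply: continuous_subspaceT => p; exact: coord2_continuous.
have cu : commuting_unitaries x.
  split=> [i|i j].
    split; apply: (cf_eq hev) => p Kp; rewrite mulA // stA // hx // oneA //.
      by rewrite mulrC conj_norm1 //; apply/torus2E: i.
    by rewrite conj_norm1 //; apply/torus2E: i.
  by apply: (cf_eq hev) => p Kp; rewrite !mulA // mulrC.
exists x; split; last first.
  move=> b; apply: (cf_eq hev2) => -[z w] [/= Kz Kw].
  have [h1 _ h3] := hD (x b) z w Kz Kw; have [_ h2 _] := hD (x b) z w Kz Kw.
  rewrite mulT // h1 h2 h3 !hx //; first by case: b {h1 h2 h3}.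
  by case: Kz Kw => [k1 k2] [k3 k4]; split; rewrite /= normrM ?k1 ?k2 ?k3 ?k4 mulr1.
have dx : sp_dense x.
  move=> a e e0; have e2 : 0 < e / 2 by rewrite divr_gt0.
  have [t ht] := continuous_approx compact_torus2 torus2E coord2_continuous
    coord2_inj coord2_surj (contA a) e2.
  exists t; apply: le_lt_trans (_ : e / 2 < e); last first.
    by rewrite {2}[e]splitr ltrDl.
  apply/nrmA => p Kp; rewrite (cf_sub hev) // (cf_speval hev) //.
  rewrite (@eq_speval _ _ (scal R) _ (coord2 p)); first exact: ht.
  by move=> b; exact: hx.
split=> // B b cb.
have [||z s t|s t||s|f [sf ff _]] :=
  @extend_by_density R A B (star_poly R bool) (speval x) (speval b).
- exact: dx.
- move=> s t.
  have diff (E : cstarType R) (u : bool -> E) :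
      speval u s - speval u t = speval u (sp_comb (-1) t s).
    by rewrite speval_comb scaleN1r addrC.
  rewrite !diff; apply: cnorm_speval_le cb (cnorm_ge0 _) _ => z z1.
  have [p hp] := coord2_surj z1.
  have Kp : torus2 p by apply/torus2E => i; rewrite hp.
  have /nrmA /(_ _ Kp) := lexx (cnorm (speval x (sp_comb (-1) t s))).
  rewrite (cf_speval hev) // (@eq_speval _ _ (scal R) _ z) // => i.
  by rewrite hx.
- by exists (sp_comb z s t); rewrite !speval_comb.
- by exists (PMul s t).
- by exists (PScal 1); rewrite /= !scale1r.
- by exists (sp_star s); rewrite !speval_star.
exists f; split=> // [i|g sg gb a]; first exact: (ff (PGen i)).
apply: eq_of_eps => e e0; have e2 : 0 < e / 2 by rewrite divr_gt0.
have [t ht] := dx a _ e2.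
have gt : g (speval x t) = f (speval x t).
  rewrite !speval_hom //; apply: eq_speval => i /=; rewrite gb.
  exact/esym/(ff (PGen i)).
apply: le_trans (cnorm_dist (g (speval x t)) _ _) _.
rewrite [e]splitr; apply: lerD.
  by rewrite -raddfB; apply: le_trans (star_hom_contractive sg _) (ltW ht).
rewrite gt -raddfB; apply: le_trans (star_hom_contractive sf _) _.
by rewrite cnorm_distC ltW.
Qed.

End TorusGroup.

(** * Intertwiners obtained from the determinant condition *)

Lemma uniq3_in (a b c x : 'I_3) : uniq [:: a; b; c] -> [\/ x = a, x = b | x = c].
Proof.
move=> h; have : x \in [:: a; b; c].
  have sub : {subset [:: a; b; c] <= enum 'I_3} by move=> y _; rewrite mem_enum.
  have [|_ ->] := uniq_min_size h sub; first by rewrite -cardE card_ord.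
  by rewrite mem_enum.
by rewrite !inE => /or3P [] /eqP ->; [constructor 1|constructor 2|constructor 3].
Qed.

Lemma sum3 (V : nmodType) (F : 'I_3 -> V) a b c : uniq [:: a; b; c] ->
  \sum_i F i = F a + F b + F c.
Proof.
move=> h; transitivity (\sum_(i in [:: a; b; c]) F i).
  by apply: eq_bigl => i; rewrite !inE; case: (uniq3_in i h) => ->; rewrite eqxx ?orbT.
by rewrite -big_uniq // !big_cons big_nil /= addr0 addrA.
Qed.

Lemma uniq3_third (a b c d : 'I_3) : uniq [:: a; b; c] -> uniq [:: a; b; d] -> c = d.
Proof. by move=> /(uniq3_in d) [->|->|->] //=; rewrite !inE eqxx ?orbT ?andbF. Qed.

Lemma uniq3_rot (a b c : 'I_3) : uniq [:: a; b; c] -> uniq [:: b; c; a].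
Proof. by rewrite -(rot_uniq 1 [:: a; b; c]). Qed.
Lemma uniq3_swap (a b c : 'I_3) : uniq [:: a; b; c] -> uniq [:: b; a; c].
Proof.
by rewrite /= !inE !negb_or [b == a]eq_sym => /and3P[/andP[-> ->] -> _].
Qed.

Section LinearSystems.
Variables (R : realType) (B : cstarType R).
Variables (X Y : 'I_3 -> 'I_3 -> B) (w : 'I_3 -> C R) (v e : 'I_3 -> B).

(** A one-sided inverse of the matrix X, up to the weights w, solves the system. *)
Lemma solve_left :
  (forall l i, \sum_c Y c l * X c i = ((l == i)%:R * w l) *: 1) ->
  (forall c, \sum_i X c i * v i = e c) ->
  forall l, w l *: v l = \sum_c Y c l * e c.
Proof.
move=> hYX hX l.
under eq_bigr => c _ do rewrite -hX mulr_sumr.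
rewrite exchange_big /= (bigD1 l) //= [X in _ + X]big1 ?addr0 => [|i il].
  under eq_bigr => c _ do rewrite mulrA.
  by rewrite -mulr_suml hYX eqxx mul1r -scalerAl mul1r.
under eq_bigr => c _ do rewrite mulrA.
by rewrite -mulr_suml hYX eq_sym (negPf il) mul0r scale0r mul0r.
Qed.

Lemma solve_right :
  (forall l i, \sum_c X c i * Y c l = ((l == i)%:R * w l) *: 1) ->
  (forall c, \sum_i v i * X c i = e c) ->
  forall l, w l *: v l = \sum_c e c * Y c l.
Proof.
move=> hYX hX l.
under eq_bigr => c _ do rewrite -hX mulr_suml.
rewrite exchange_big /= (bigD1 l) //= [X in _ + X]big1 ?addr0 => [|i il].
  under eq_bigr => c _ do rewrite -mulrA.
  by rewrite -mulr_sumr hYX eqxx mul1r -scalerAr mulr1.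
under eq_bigr => c _ do rewrite -mulrA.
by rewrite -mulr_sumr hYX eq_sym (negPf il) mul0r scale0r mulr0.
Qed.
End LinearSystems.

(** Throughout, u (x) u (x) u fixes the tensor E; the vectors E (e_l, -, -) and
    E (-, -, e_l) span subspaces of the tensor square that u (x) u leaves invariant,
    and u (x) u acts on them through the adjoints of the entries of u. *)
Section Intertwiners.
Variables (R : realType) (E : array R) (B : cstarType R) (u : 'I_3 * 'I_3 -> B).
Hypothesis rel : PW_relations E u.
Local Notation U j k := (u (j, k)).
Local Notation V j k := (star (u (j, k))).

Lemma unit_rows j k : \sum_s U j s * V k s = (j == k)%:R.
Proof. by case: rel. Qed.
Lemma unit_cols j k : \sum_s V s j * U s k = (j == k)%:R.
Proof. by case: rel. Qed.
Lemma det_rel a b c : \sum_i \sum_j \sum_k E i j k *: (U a i * U b j * U c k) =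
  E a b c *: 1.
Proof. by case: rel. Qed.

Lemma solve_U (v e : 'I_3 -> B) : (forall c, \sum_i U c i * v i = e c) ->
  forall l, v l = \sum_c V c l * e c.
Proof.
move=> h l; rewrite -[LHS]scale1r.
apply: (@solve_left _ _ (fun c i => U c i) (fun c l => V c l) (fun=> 1) v e _ h l).
by move=> l' i; rewrite unit_cols mulr1 scaler_nat.
Qed.

(** The next lemmas cancel the factors of u (x) u (x) u one after the other, by
    unitarity, and take adjoints. *)
Lemma cancel1 l b c :
  \sum_j \sum_k E l j k *: (U b j * U c k) = \sum_a E a b c *: V a l.
Proof.
rewrite (solve_U (v := fun l => \sum_j \sum_k E l j k *: (U b j * U c k))
                 (e := fun a => E a b c *: 1)).
  by apply: eq_bigr => a _; rewrite -scalerAr mulr1.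
move=> a; rewrite -det_rel; apply: eq_bigr => i _; rewrite mulr_sumr.
apply: eq_bigr => j _; rewrite mulr_sumr; apply: eq_bigr => k _.
by rewrite -scalerAr mulrA.
Qed.

Lemma cancel2 l m c :
  \sum_k E l m k *: U c k = \sum_b V b m * \sum_a E a b c *: V a l.
Proof.
rewrite (solve_U (v := fun m => \sum_k E l m k *: U c k)
                 (e := fun b => \sum_a E a b c *: V a l)) // => b.
rewrite -cancel1; apply: eq_bigr => j _; rewrite mulr_sumr.
by apply: eq_bigr => k _; rewrite -scalerAr.
Qed.

Lemma cancel3 l m n :
  E l m n *: 1 = \sum_c V c n * \sum_b V b m * \sum_a E a b c *: V a l.
Proof.
rewrite (solve_U (v := fun n => E l m n *: 1)
                 (e := fun c => \sum_b V b m * \sum_a E a b c *: V a l)) // => c.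
by rewrite -cancel2; apply: eq_bigr => k _; rewrite -scalerAr mulr1.
Qed.

Lemma cancel1_star k b c : \sum_i \sum_j (E k i j)^* *: (V c j * V b i) =
  \sum_a (E a b c)^* *: U a k.
Proof.
have := congr1 (@star _ _) (cancel1 k b c); rewrite !star_sum => h.
transitivity (\sum_i star (\sum_j E k i j *: (U b i * U c j))).
  apply: eq_bigr => i _; rewrite star_sum; apply: eq_bigr => j _.
  by rewrite starZ starM.
by rewrite h; apply: eq_bigr => a _; rewrite starZ starK.
Qed.

Lemma cancel2_star k l c : \sum_j (E k l j)^* *: V c j =
  \sum_a \sum_b (E a b c)^* *: (U a k * U b l).
Proof.
have := congr1 (@star _ _) (cancel2 k l c); rewrite !star_sum.
rewrite (eq_bigr (fun j => (E k l j)^* *: V c j)) => [->|j _]; last by rewrite starZ.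
rewrite exchange_big; apply: eq_bigr => b _ /=.
rewrite starM star_sum starK mulr_suml; apply: eq_bigr => a _.
by rewrite starZ starK -scalerAl.
Qed.

Lemma cancel3_star k l m : \sum_a \sum_b \sum_c (E a b c)^* *: (U a k * U b l * U c m)
  = (E k l m)^* *: 1.
Proof.
have := congr1 (@star _ _) (cancel3 k l m); rewrite starZ star1 => ->.
rewrite star_sum; under eq_bigr => a _ do rewrite exchange_big /=.
rewrite exchange_big /=; apply: eq_bigr => c _.
rewrite starM star_sum starK mulr_suml exchange_big /=; apply: eq_bigr => b _.
rewrite starM star_sum starK mulr_suml mulr_suml; apply: eq_bigr => a _.
by rewrite starZ starK -!scalerAl.
Qed.

(** left_weight and right_weight are the squared norms of E (e_a, -, -) and of
    E (-, -, e_c), and rotation_weight is the inner product of the two vectors with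
    the same index. *)
Definition left_weight a := \sum_b \sum_c (E a b c)^* * E a b c.
Definition right_weight c := \sum_a \sum_b (E a b c)^* * E a b c.
Definition rotation_weight c := \sum_a \sum_b (E a b c)^* * E c a b.

Hypothesis supp : permutation_condition E.

Lemma supp_uniq a b c : E a b c != 0 -> uniq [:: a; b; c].
Proof. by move/supp => h; rewrite (perm_uniq h) enum_uniq. Qed.

(** A permutation is determined by two of its values, so the vectors of each of the
    two families are pairwise orthogonal. *)
Lemma left_orth a a' : \sum_b \sum_c (E a b c)^* * E a' b c =
  (a == a')%:R * left_weight a.
Proof.
have [->|aa] := eqVneq a a'; first by rewrite mul1r.
rewrite mul0r big1 // => b _; rewrite big1 // => c _.
apply/eqP; rewrite mulf_eq0 conjC_eq0 -implyNb; apply/implyP => h.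
apply: contraNT aa => h'.
exact/eqP/(uniq3_third (uniq3_rot (supp_uniq h)) (uniq3_rot (supp_uniq h'))).
Qed.

Lemma right_orth c c' : \sum_a \sum_b (E a b c)^* * E a b c' =
  (c == c')%:R * right_weight c.
Proof.
have [->|aa] := eqVneq c c'; first by rewrite mul1r.
rewrite mul0r big1 // => a _; rewrite big1 // => b _.
apply/eqP; rewrite mulf_eq0 conjC_eq0 -implyNb; apply/implyP => h.
apply: contraNT aa => h'.
by apply/eqP/(@uniq3_third a b); exact: supp_uniq.
Qed.

Lemma rotation_orth c d : \sum_a \sum_b (E a b c)^* * E d a b =
  (c == d)%:R * rotation_weight c.
Proof.
have [->|aa] := eqVneq c d; first by rewrite mul1r.
rewrite mul0r big1 // => a _; rewrite big1 // => b _.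
apply/eqP; rewrite mulf_eq0 conjC_eq0 -implyNb; apply/implyP => h.
apply: contraNT aa => h'.
exact/eqP/(uniq3_third (supp_uniq h) (uniq3_rot (supp_uniq h'))).
Qed.

Lemma delta_sum (w : 'I_3 -> C R) (x : 'I_3 -> B) k :
  \sum_a ((a == k)%:R * w a) *: x a = w k *: x k.
Proof.
rewrite (bigD1 k) //= eqxx mul1r big1 ?addr0 // => a /negPf ->.
by rewrite mul0r scale0r.
Qed.

(** u (x) u preserves inner products; applied to the vectors E (e_k, -, -) this says
    that the transpose of u is unitary for the weighted inner product. *)
Lemma left_gram k l : \sum_a left_weight a *: (U a k * V a l) =
  ((k == l)%:R * left_weight k) *: 1.
Proof.
rewrite -left_orth scaler_suml.
transitivity (\sum_b \sum_c (\sum_a (E a b c)^* *: U a k) * \sum_d E d b c *: V d l).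
  apply/esym; under eq_bigr => b _ do under eq_bigr => c _ do
    (rewrite mulr_suml; under eq_bigr => a _ do rewrite mulr_sumr).
  under eq_bigr => b _ do rewrite exchange_big /=.
  rewrite exchange_big /=; apply: eq_bigr => a _.
  under eq_bigr => b _ do rewrite exchange_big /=.
  rewrite exchange_big /= -(delta_sum (fun=> left_weight a) (fun d => U a k * V d l)).
  apply: eq_bigr => d _; rewrite eq_sym -left_orth scaler_suml.
  apply: eq_bigr => b _; rewrite scaler_suml; apply: eq_bigr => c _.
  by rewrite -scalerAl -scalerAr scalerA.
transitivity (\sum_i \sum_j \sum_c \sum_b (E k i j)^* *:
    (V c j * (V b i * \sum_d E d b c *: V d l))).
  under eq_bigr => b _ do under eq_bigr => c _ do
    (rewrite -cancel1_star mulr_suml; under eq_bigr => i _ do rewrite mulr_suml).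
  under eq_bigr => b _ do rewrite exchange_big /=.
  rewrite exchange_big /=; apply: eq_bigr => i _.
  under eq_bigr => b _ do rewrite exchange_big /=.
  rewrite exchange_big /=; apply: eq_bigr => j _.
  rewrite exchange_big /=; apply: eq_bigr => c _; apply: eq_bigr => b _.
  by rewrite -scalerAl mulrA.
apply: eq_bigr => i _; rewrite scaler_suml; apply: eq_bigr => j _.
rewrite -scalerA (cancel3 l i j) scaler_sumr; apply: eq_bigr => c _.
by rewrite mulr_sumr scaler_sumr.
Qed.

(** The same for the vectors E (-, -, e_i). *)
Lemma right_gram c d : \sum_i right_weight i *: (V c i * U d i) =
  ((c == d)%:R * right_weight c) *: 1.
Proof.
transitivity (\sum_k \sum_l (\sum_j (E k l j)^* *: V c j) * \sum_i E k l i *: U d i).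
  apply/esym; under eq_bigr => k _ do under eq_bigr => l _ do
    (rewrite mulr_suml; under eq_bigr => j _ do rewrite mulr_sumr).
  under eq_bigr => k _ do rewrite exchange_big /=.
  rewrite exchange_big /=; apply: eq_bigr => j _.
  under eq_bigr => k _ do rewrite exchange_big /=.
  rewrite exchange_big /= -(delta_sum (fun=> right_weight j) (fun i => V c j * U d i)).
  apply: eq_bigr => i _; rewrite eq_sym -right_orth scaler_suml.
  apply: eq_bigr => k _; rewrite scaler_suml; apply: eq_bigr => l _.
  by rewrite -scalerAl -scalerAr scalerA.
transitivity (\sum_a \sum_b (E a b c)^* *:
   \sum_k \sum_l \sum_i E k l i *: (U a k * U b l * U d i)).
  under eq_bigr => k _ do under eq_bigr => l _ do
    (rewrite cancel2_star mulr_suml; under eq_bigr => a _ do rewrite mulr_suml).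
  under eq_bigr => k _ do rewrite exchange_big /=.
  rewrite exchange_big /=; apply: eq_bigr => a _.
  under eq_bigr => k _ do rewrite exchange_big /=.
  rewrite exchange_big /=; apply: eq_bigr => b _.
  rewrite scaler_sumr; apply: eq_bigr => k _.
  rewrite scaler_sumr; apply: eq_bigr => l _.
  rewrite scaler_sumr mulr_sumr; apply: eq_bigr => i _.
  by rewrite -scalerAl -scalerAr.
rewrite -right_orth scaler_suml; apply: eq_bigr => a _.
rewrite scaler_suml; apply: eq_bigr => b _.
by rewrite det_rel scalerA.
Qed.

(** Contracting E with its conjugate gives a diagonal matrix that commutes with u:
    pairing the images of E (e_l, -, -) with E (-, -, e_c) can be computed in two
    ways. *)
Lemma rotation_intertwines c l :
  rotation_weight l *: V c l = rotation_weight c *: V c l.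
Proof.
have h : \sum_a \sum_b (E a b c)^* *: (\sum_i \sum_j E l i j *: (U a i * U b j)) =
    rotation_weight c *: V c l.
  under eq_bigr => a _ do under eq_bigr => b _ do rewrite cancel1 scaler_sumr.
  under eq_bigr => a _ do rewrite exchange_big /=.
  rewrite exchange_big /= -(delta_sum (fun=> rotation_weight c) (fun d => V d l)).
  apply: eq_bigr => d _; rewrite eq_sym -rotation_orth scaler_suml.
  apply: eq_bigr => a _; rewrite scaler_suml; apply: eq_bigr => b _.
  by rewrite scalerA.
rewrite -h.
transitivity (\sum_i \sum_j E l i j *: (\sum_k (E i j k)^* *: V c k)).
  under eq_bigr => i _ do under eq_bigr => j _ do rewrite scaler_sumr.
  under eq_bigr => i _ do rewrite exchange_big /=.
  rewrite exchange_big /= -(delta_sum rotation_weight (fun d => V c d)).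
  apply: eq_bigr => k _.
  have -> : (k == l)%:R * rotation_weight k = \sum_a \sum_b (E a b k)^* * E l a b.
    by rewrite rotation_orth.
  rewrite scaler_suml; apply: eq_bigr => i _.
  rewrite scaler_suml; apply: eq_bigr => j _.
  by rewrite scalerA mulrC.
under eq_bigr => i _ do under eq_bigr => j _ do
  (rewrite cancel2_star scaler_sumr; under eq_bigr => a _ do rewrite scaler_sumr).
under eq_bigr => i _ do rewrite exchange_big /=.
rewrite exchange_big /=; apply: eq_bigr => a _.
under eq_bigr => i _ do rewrite exchange_big /=.
rewrite exchange_big /=; apply: eq_bigr => b _.
rewrite scaler_sumr; apply: eq_bigr => i _.
rewrite scaler_sumr; apply: eq_bigr => j _.
by rewrite !scalerA mulrC.
Qed.

(** The two weighted unitarity conditions both compute the inverse of the transpose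
    of u. *)
Lemma weight_intertwines c l :
  (left_weight l * right_weight l) *: V c l = (left_weight c * right_weight c) *: V c l.
Proof.
transitivity (\sum_k right_weight k *: (V c k * \sum_b left_weight b *: (U b k * V b l))).
  under eq_bigr => k _ do rewrite left_gram -scalerAr mulr1 scalerA.
  rewrite -(delta_sum (fun k => left_weight k * right_weight k) (fun k => V c k)).
  by apply: eq_bigr => k _; congr (_ *: _); ring.
transitivity (\sum_b left_weight b *: ((\sum_k right_weight k *: (V c k * U b k)) * V b l)).
  under eq_bigr => k _ do rewrite mulr_sumr scaler_sumr.
  rewrite exchange_big /=; apply: eq_bigr => b _.
  rewrite mulr_suml scaler_sumr; apply: eq_bigr => k _.
  by rewrite -!scalerAr -scalerAl !scalerA mulrA mulrC.
under eq_bigr => b _ do rewrite right_gram -scalerAl mul1r scalerA.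
rewrite -(delta_sum (fun k => left_weight k * right_weight k) (fun b => V b l)).
by apply: eq_bigr => b _; congr (_ *: _); have [->|_] := eqVneq b c; rewrite /= ?eqxx ?mulr0n ?mulr1n; ring.
Qed.

End Intertwiners.

(** * Vanishing products of entries *)

Section ThreeIndices.
Variables (R : realType).

Variable E : array R.
Hypothesis supp : permutation_condition E.

Lemma supp0 a b c : ~~ uniq [:: a; b; c] -> E a b c = 0.
Proof. by move=> h; apply/eqP; apply: contraNT h; apply: supp_uniq. Qed.

Lemma supp_neq0 a b c : uniq [:: a; b; c] -> E a b c != 0.
Proof.
move=> h; apply/supp; apply: uniq_perm (enum_uniq _) _ => // x.
by rewrite mem_enum !inE; case: (uniq3_in x h) => ->; rewrite eqxx ?orbT.
Qed.

Variables (V : lmodType (C R)) (F : 'I_3 -> 'I_3 -> V).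

Lemma two_terms_left (g : C R -> C R) l j k : g 0 = 0 -> uniq [:: l; j; k] ->
  \sum_i \sum_i' g (E l i i') *: F i i' = g (E l j k) *: F j k + g (E l k j) *: F k j.
Proof.
move=> g0 h; rewrite (sum3 _ h) !(sum3 _ h).
have z a b c : ~~ uniq [:: a; b; c] -> g (E a b c) = 0 by move/supp0 => ->.
by rewrite (z l l l) ?(z l l j) ?(z l l k) ?(z l j l) ?(z l j j) ?(z l k l) ?(z l k k) ?scale0r ?add0r ?addr0 //= !inE ?eqxx ?orbT ?andbF.
Qed.

Lemma two_terms_right (g : C R -> C R) l j k : g 0 = 0 -> uniq [:: l; j; k] ->
  \sum_i \sum_i' g (E i i' l) *: F i i' = g (E j k l) *: F j k + g (E k j l) *: F k j.
Proof.
move=> g0 h; rewrite (sum3 _ h) !(sum3 _ h).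
have z a b c : ~~ uniq [:: a; b; c] -> g (E a b c) = 0 by move/supp0 => ->.
by rewrite (z l l l) ?(z l j l) ?(z l k l) ?(z j l l) ?(z j j l) ?(z k l l) ?(z k k l) ?scale0r ?add0r ?addr0 //= !inE ?eqxx ?orbT ?andbF.
Qed.

End ThreeIndices.

(** The vectors E (e_l, -, -) and E (-, -, e_l) live in the same coordinate plane;
    they are parallel when this 2 x 2 determinant vanishes. *)
Definition side_det (R : realType) (E : array R) l j k :=
  E l j k * E k j l - E l k j * E j k l.

Section VanishingProducts.
Variables (R : realType) (E : array R) (B : cstarType R) (u : 'I_3 * 'I_3 -> B).
Hypothesis supp : permutation_condition E.
Hypothesis rel : PW_relations E u.
Local Notation U j k := (u (j, k)).
Local Notation V j k := (star (u (j, k))).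

Lemma sqr_weight_gt0 (x y : C R) : x != 0 -> 0 < x^* * x + y^* * y.
Proof.
move=> x0; rewrite ![_^* * _]mulrC -!normCK ltr_pwDl ?exprn_gt0 ?normr_gt0 //.
Qed.

Lemma left_weightE l j k : uniq [:: l; j; k] ->
  left_weight E l = (E l j k)^* * E l j k + (E l k j)^* * E l k j.
Proof.
move=> h; have := @two_terms_left R E supp (C R)^o (fun i i' => E l i i')
   (fun z => z^*) l j k (conjC0 _) h; exact.
Qed.

Lemma right_weightE l j k : uniq [:: l; j; k] ->
  right_weight E l = (E j k l)^* * E j k l + (E k j l)^* * E k j l.
Proof.
move=> h; have := @two_terms_right R E supp (C R)^o (fun i i' => E i i' l)
   (fun z => z^*) l j k (conjC0 _) h; exact.
Qed.

Lemma left_weight_neq0 l j k : uniq [:: l; j; k] -> left_weight E l != 0.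
Proof.
by move=> h; rewrite (left_weightE h) gt_eqF // sqr_weight_gt0 // supp_neq0.
Qed.

Lemma right_weight_neq0 l j k : uniq [:: l; j; k] -> right_weight E l != 0.
Proof.
move=> h; rewrite (right_weightE h) gt_eqF // sqr_weight_gt0 // supp_neq0 //.
exact: uniq3_rot.
Qed.

(** Cancelling the last factor of the determinant condition from the right, by the
    weighted unitarity of the transpose of u. *)
Lemma cancel_right l a b : left_weight E l *: \sum_i \sum_j E i j l *: (U a i * U b j) =
  \sum_c E a b c *: (left_weight E c *: V c l).
Proof.
rewrite (@solve_right _ _ (fun c i => U c i) (fun c l => left_weight E c *: V c l)
  (left_weight E) (fun l => \sum_i \sum_j E i j l *: (U a i * U b j))
  (fun c => E a b c *: 1)).
- by apply: eq_bigr => c _; rewrite -scalerAl mul1r.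
- move=> l' i; rewrite (eq_bigr (fun c => left_weight E c *: (U c i * V c l'))).
    rewrite (left_gram rel supp) eq_sym.
    by case: eqP => [->|]; rewrite ?mul0r.
  by move=> c _; rewrite -scalerAr.
move=> c; rewrite -(det_rel rel).
under [LHS]eq_bigr => k _ do (rewrite mulr_suml; under eq_bigr => i _ do rewrite mulr_suml).
rewrite exchange_big /=; apply: eq_bigr => i _; rewrite exchange_big /=.
by apply: eq_bigr => j _; apply: eq_bigr => k _; rewrite -scalerAl.
Qed.

Lemma cancel_left_star c l m : right_weight E c *:
    \sum_a \sum_b (E c a b)^* *: (U a l * U b m) =
  \sum_k (E k l m)^* *: (right_weight E k *: V c k).
Proof.
rewrite (@solve_left _ _ (fun k a => U a k) (fun k c => right_weight E k *: V c k)
  (right_weight E) (fun c => \sum_a \sum_b (E c a b)^* *: (U a l * U b m))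
  (fun k => (E k l m)^* *: 1)).
- by apply: eq_bigr => k _; rewrite -scalerAr mulr1.
- move=> c' i; rewrite -(right_gram rel supp).
  by apply: eq_bigr => k _; rewrite -scalerAl.
move=> k; rewrite -(cancel3_star rel); apply: eq_bigr => a _; rewrite mulr_sumr.
apply: eq_bigr => b _; rewrite mulr_sumr; apply: eq_bigr => d _.
by rewrite -scalerAr mulrA.
Qed.

Lemma cramer2 (a b c d : C R) (x y : B) : a * d - b * c != 0 ->
  a *: x + b *: y = 0 -> c *: x + d *: y = 0 -> x = 0.
Proof.
move=> h e1 e2; have : (a * d - b * c) *: x = d *: (a *: x + b *: y) - b *: (c *: x + d *: y).
  rewrite !scalerDr !scalerA scalerBl opprD addrACA.
  by rewrite [b * d]mulrC subrr addr0 [d * a]mulrC.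
by rewrite e1 e2 !scaler0 subrr => /eqP; rewrite scaler_eq0 (negPf h) => /eqP.
Qed.

(** No multiple of e_a (x) e_a occurs in the vectors of the two invariant subspaces;
    so u_aj u_ak and u_ak u_aj satisfy two linear equations, which are independent
    when the two vectors of index l are. Columns are treated in the same way. *)
Lemma products_vanish l j k a : uniq [:: l; j; k] -> side_det E l j k != 0 ->
  U a j * U a k = 0 /\ U j a * U k a = 0.
Proof.
move=> h d0; have rep b c : ~~ uniq [:: b; b; c] by rewrite /= inE eqxx.
have rep' b c : ~~ uniq [:: c; b; b] by rewrite /= !inE eqxx !andbF.
split.
  apply: (@cramer2 (E l j k) (E l k j) (E j k l) (E k j l) _ (U a k * U a j)) => //.
    rewrite -[LHS](two_terms_left supp (fun i i' => U a i * U a i') (g := id) erefl h).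
    by rewrite (cancel1 rel) big1 // => c _; rewrite (supp0 supp) ?scale0r.
  rewrite -[LHS](two_terms_right supp (fun i i' => U a i * U a i') (g := id) erefl h).
  apply/eqP; have := left_weight_neq0 h.
  have /eqP := cancel_right l a a; rewrite [X in _ == X]big1 ?scaler_eq0.
    by case/orP => // /eqP ->; rewrite eqxx.
  by move=> c _; rewrite (supp0 supp) ?scale0r.
apply: (@cramer2 (E l j k)^* (E l k j)^* (E j k l)^* (E k j l)^* _ (U k a * U j a)).
- by rewrite -!rmorphM -rmorphB conjC_eq0.
- rewrite -[LHS](two_terms_left supp (fun i i' => U i a * U i' a) (g := fun z => z^*) (conjC0 _) h).
  apply/eqP; have := right_weight_neq0 h.
  have /eqP := cancel_left_star l a a; rewrite [X in _ == X]big1 ?scaler_eq0.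
    by case/orP => // /eqP ->; rewrite eqxx.
  by move=> c _; rewrite (supp0 supp) ?conjC0 ?scale0r.
rewrite -[LHS](two_terms_right supp (fun i i' => U i a * U i' a) (g := fun z => z^*) (conjC0 _) h).
rewrite -(cancel2_star rel) big1 // => c _.
by rewrite (supp0 supp) ?conjC0 ?scale0r.
Qed.

End VanishingProducts.

(** * Magic unitaries *)

Section MagicUnitary.
Variables (R : realType) (E : array R) (B : cstarType R) (u : 'I_3 * 'I_3 -> B).
Hypothesis supp : permutation_condition E.
Hypothesis rel : PW_relations E u.
Local Notation U j k := (u (j, k)).
Local Notation V j k := (star (u (j, k))).
Hypothesis row0 : forall a j k, j != k -> U a j * U a k = 0.
Hypothesis col0 : forall a b j, a != b -> U a j * U b j = 0.

Fact proj_key : unit. Proof. exact: tt. Qed.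
(** The entries are normal partial isometries, and this is their common initial and
    final projection; it is locked so that rewriting does not look inside. *)
Definition proj a j := locked_with proj_key (V a j * U a j).
Lemma projV a j : proj a j = V a j * U a j.
Proof. by rewrite /proj unlock. Qed.

Lemma unit_row a : \sum_s U a s * V a s = 1.
Proof. by rewrite (unit_rows rel) eqxx. Qed.
Lemma unit_col j : \sum_s V s j * U s j = 1.
Proof. by rewrite (unit_cols rel) eqxx. Qed.

Lemma entry_UUV a j : U a j * U a j * V a j = U a j.
Proof.
rewrite -[RHS]mulr1 -(unit_row a) mulr_sumr (bigD1 j) //= big1 ?addr0 ?mulrA // => s sj.
by rewrite mulrA row0 ?mul0r // eq_sym.
Qed.

Lemma entry_VUU a j : V a j * (U a j * U a j) = U a j.
Proof.
rewrite -[RHS]mul1r -(unit_col j) mulr_suml (bigD1 a) //= big1 ?addr0 -?mulrA // => s sa.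
by rewrite -mulrA col0 ?mulr0.
Qed.

Lemma projE a j : proj a j = U a j * V a j.
Proof.
by rewrite projV -{2}[U a j]entry_UUV [V a j * _]mulrA entry_VUU.
Qed.

Lemma star_proj a j : star (proj a j) = proj a j.
Proof. by rewrite projV starM starK. Qed.

Lemma proj_entry a j : proj a j * U a j = U a j.
Proof. by rewrite projV -mulrA entry_VUU. Qed.

Lemma entry_proj a j : U a j * proj a j = U a j.
Proof. by rewrite projE mulrA entry_UUV. Qed.

Lemma proj_idem a j : proj a j * proj a j = proj a j.
Proof. by rewrite {1}projV -mulrA entry_proj -projV. Qed.

Lemma proj_row0 a j k : j != k -> proj a j * proj a k = 0.
Proof. by move=> jk; rewrite [proj a k]projE [proj a j]projV -mulrA [U a j * _]mulrA row0 // mul0r mulr0. Qed.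

Lemma proj_col0 a b j : a != b -> proj a j * proj b j = 0.
Proof. by move=> ab; rewrite [proj b j]projE [proj a j]projV -mulrA [U a j * _]mulrA col0 // mul0r mulr0. Qed.

Lemma sum_proj_row a : \sum_j proj a j = 1.
Proof.
rewrite -(unit_row a); by apply: eq_bigr => j _; rewrite projE.
Qed.

Lemma uniq3_neq (T : eqType) (a b c : T) : uniq [:: a; b; c] ->
  [/\ a != b, a != c & b != c].
Proof. by rewrite /= !inE negb_or => /and3P[/andP[-> ->] -> _]. Qed.

(** The projections form a 3 x 3 magic unitary, whose entries always commute: with
    only three columns, expanding 1 along row a and proj c k along row c kills
    all terms but a symmetric one. *)
Lemma proj_comm a c i j k : a != c -> uniq [:: i; j; k] ->
  proj a i * proj c k = proj c k * proj a i.
Proof.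
move=> ac h; have [ij ik jk] := uniq3_neq h.
have e : proj a i * proj c k = proj a i * proj c k * proj a i.
  rewrite -[LHS]mulr1 -(sum_proj_row a) (sum3 _ h) !mulrDr -!mulrA.
  rewrite [proj c k * proj a k]proj_col0 1?eq_sym // mulr0 addr0.
  have -> : proj a i * (proj c k * proj a j) = 0; last by rewrite addr0.
  have -> : proj c k = 1 - proj c i - proj c j.
    by rewrite -(sum_proj_row c) (sum3 _ h) -[RHS]addrA -opprD [RHS]addrC addrA addNr add0r.
  rewrite !mulrBl mul1r !mulrBr proj_row0 // mulrA proj_col0 // mul0r.
  by rewrite [proj c j * _]proj_col0 1?eq_sym // mulr0 !subr0.
rewrite e; have := congr1 (@star _ _) e; rewrite !starM !star_proj => e'.
by rewrite -mulrA -e' .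
Qed.

(** Both products are the projection onto the permutation sending a, b, c to
    i, j, k. *)
Lemma proj_pair a b c i j k : uniq [:: a; b; c] -> uniq [:: i; j; k] ->
  proj a i * proj c k = proj b j * proj a i.
Proof.
move=> h h'; have [ab ac bc] := uniq3_neq h; have [ij ik jk] := uniq3_neq h'.
have ba : b != a by rewrite eq_sym.
have cb : c != b by rewrite eq_sym.
have hjik := uniq3_swap h'; have hkij : uniq [:: k; i; j] by do 2 apply: uniq3_rot.
have hikj : uniq [:: i; k; j] by apply: uniq3_swap.
have e1 : proj a i * proj c k = proj a i * proj c k * proj b j.
  rewrite -[LHS]mulr1 -(sum_proj_row b) (sum3 _ h') !mulrDr.
  rewrite -[X in _ + X]mulrA proj_col0 // mulr0 addr0.
  by rewrite (@proj_comm a c i j k) // -[X in X + _]mulrA proj_col0 // mulr0 add0r.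
rewrite e1.
have -> : proj b j * proj a i = proj b j * proj a i * proj c k.
  rewrite -[LHS]mulr1 -(sum_proj_row c) (sum3 _ h') !mulrDr.
  rewrite -[X in X + _ + _]mulrA proj_col0 // mulr0 add0r.
  rewrite (@proj_comm b a j k i) //; last exact: uniq3_rot.
  by rewrite -[X in X + _]mulrA proj_col0 // mulr0 add0r.
rewrite -mulrA (@proj_comm c b k i j) // mulrA.
by rewrite (@proj_comm a b i k j).
Qed.

(** The projections on the left and on the right single out one term of the
    determinant condition. *)
Lemma triple_product a b c i j k : uniq [:: a; b; c] -> uniq [:: i; j; k] ->
  E i j k *: (U a i * U b j * U c k) = E a b c *: (proj a i * proj c k).
Proof.
move=> h h'; have hk : uniq [:: k; i; j] by do 2 apply: uniq3_rot.
have := congr1 (fun x => proj a i * x * proj c k) (det_rel rel a b c).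
rewrite -scalerAr mulr1 -scalerAl => <-.
rewrite mulr_sumr mulr_suml (bigD1 i) //= [X in _ + X]big1 ?addr0; last first.
  move=> i' ii; rewrite mulr_sumr mulr_suml big1 // => j' _.
  rewrite mulr_sumr mulr_suml big1 // => k' _.
  rewrite -scalerAr -scalerAl !mulrA projV -[V a i * U a i * U a i']mulrA.
  by rewrite row0 1?eq_sym // mulr0 !mul0r scaler0.
rewrite mulr_sumr mulr_suml (bigD1 j) //= [X in _ + X]big1 ?addr0; last first.
  move=> j' jj; rewrite mulr_sumr mulr_suml big1 // => k' _.
  have [->|kk] := eqVneq k' k.
    rewrite (supp0 supp) ?scale0r ?mulr0 ?mul0r //.
    apply: contra jj => h2; apply/eqP.
    exact: uniq3_third (uniq3_rot (uniq3_rot h2)) hk.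
  rewrite -scalerAr -scalerAl -!mulrA (projE c k) [U c k' * _]mulrA row0 //.
  by rewrite mul0r !mulr0 scaler0.
rewrite mulr_sumr mulr_suml (bigD1 k) //= [X in _ + X]big1 ?addr0; last first.
  move=> k' kk; rewrite -scalerAr -scalerAl -!mulrA (projE c k) [U c k' * _]mulrA row0 //.
  by rewrite mul0r !mulr0 scaler0.
by rewrite -scalerAr -scalerAl !mulrA proj_entry -[X in _ = _ *: X]mulrA entry_proj.
Qed.
(** Both sides of u_ai (u_bj u_ck u_ai) = (u_ai u_bj u_ck) u_ai are multiples of
    the projection P and of its conjugate by u_ai. So a multiple of P is idempotent,
    and the two scalars coincide unless P = 0. *)
Lemma cyclic_obstruction a b c i j k : uniq [:: a; b; c] -> uniq [:: i; j; k] ->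
  E a b c * E j k i != E b c a * E i j k -> proj a i * proj c k = 0.
Proof.
move=> h h' ne; have [ab ac bc] := uniq3_neq h.
set P := proj a i * proj c k.
have Eh := supp_neq0 supp h'; have Er := supp_neq0 supp (uniq3_rot h').
have com : proj a i * proj c k = proj c k * proj a i by apply: (@proj_comm a c i j k).
have pP : proj a i * P = P by rewrite /P mulrA proj_idem.
have Pp : P * proj a i = P by rewrite /P -mulrA -com mulrA proj_idem.
have PP : P * P = P.
  by rewrite {2}/P mulrA Pp /P -mulrA proj_idem.
pose r := E a b c / E i j k; pose r' := E b c a / E j k i.
have X : U a i * U b j * U c k = r *: P.
  by rewrite /r mulrC -scalerA -(triple_product h h') scalerA mulVf // scale1r.
have X' : U b j * U c k * U a i = r' *: P.
  rewrite /P (proj_pair h h') /r' mulrC -scalerA -(triple_product (uniq3_rot h) (uniq3_rot h')).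
  by rewrite scalerA mulVf // scale1r.
clearbody P; pose T := V a i * P * U a i.
have TT : T * T = T.
  rewrite /T -!mulrA [U a i * (V a i * _)]mulrA -projE [proj a i * _]mulrA pP.
  by rewrite [P * (P * _)]mulrA PP.
have e : r' *: P = r *: T.
  have : U a i * (U b j * U c k * U a i) = U a i * U b j * U c k * U a i.
    by rewrite !mulrA.
  rewrite X X' -scalerAr -scalerAl => /(congr1 (fun x => V a i * x)).
  by rewrite -!scalerAr mulrA -projV pP mulrA.
have r0 : r != 0 by rewrite mulf_neq0 ?invr_neq0 ?(supp_neq0 supp h).
have r'0 : r' != 0.
  by rewrite mulf_neq0 ?invr_neq0 ?Er // (supp_neq0 supp (uniq3_rot h)).
have sT : T = (r' / r) *: P.
  by rewrite [r' / r]mulrC -scalerA e scalerA mulVf // scale1r.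
move: TT; rewrite sT -scalerAl -scalerAr PP scalerA => /eqP.
rewrite -subr_eq0 -scalerBl scaler_eq0 => /orP[|/eqP //].
rewrite -{3}[r' / r]mulr1 -mulrBr mulf_eq0 mulf_eq0 invr_eq0 (negPf r0) (negPf r'0) /=.
rewrite subr_eq0 => /eqP e1; case/negP: ne; apply/eqP.
have : r' = r by rewrite -[r]mul1r -e1 divfK.
by rewrite /r /r' => /eqP; rewrite eqr_div // => /eqP ->.
Qed.

Lemma third_index (x y : 'I_3) : x != y -> exists z, uniq [:: x; y; z].
Proof.
move=> xy; exists (inord (3 - x - y)); move: xy.
case: x y => [[|[|[|//]]] ?] [[|[|[|//]]] ?] //=; rewrite !inE -!val_eqE /= inordK //.
Qed.

(** A diagonal entry is missed by the two 3-cycles, where E is not covariant, and by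
    the transpositions, where covariance would make two side vectors parallel. *)
Lemma magic_diagonal a b c :
  (forall l j k, uniq [:: l; j; k] -> side_det E l j k != 0) ->
  uniq [:: a; b; c] -> E b c a ^+ 2 != E a b c * E c a b ->
  forall x y, x != y -> U x y = 0.
Proof.
move=> sd h ne.
have Qrot x y z : uniq [:: x; y; z] -> proj x y * proj z x = 0 ->
    proj y z * proj x y = 0.
  by move=> hx; rewrite (proj_pair hx (uniq3_rot hx)).
have hb := uniq3_rot h; have hc := uniq3_rot hb.
have Qabc : proj a b * proj c a = 0.
  by apply: (cyclic_obstruction h hb); rewrite eq_sym -expr2.
have Qacb : proj a c * proj b a = 0.
  have [ab ac bc] := uniq3_neq h.
  rewrite (@proj_comm a b c b a) //; last exact: (uniq3_rot (uniq3_rot (uniq3_swap h))).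
  by apply: (cyclic_obstruction hb h); rewrite -expr2 mulrC.
have hacb : uniq [:: a; c; b] by apply: uniq3_swap.
have Qbca := Qrot _ _ _ h Qabc; have Qcab := Qrot _ _ _ hb Qbca.
have Qcba := Qrot _ _ _ hacb Qacb.
have Qbac := Qrot _ _ _ (uniq3_rot hacb) Qcba.
have Q x y z : uniq [:: x; y; z] -> proj x y * proj z x = 0.
  by case: (uniq3_in x h) => ->; case: (uniq3_in y h) => ->; case: (uniq3_in z h) => -> //=;
    rewrite !inE eqxx ?orbT ?andbF.
move=> x y xy; have [z hz] := third_index xy.
have [_ xz yz] := uniq3_neq hz.
have p0 : proj x y = 0.
  have hzyx : uniq [:: z; y; x] := uniq3_rot (uniq3_rot (uniq3_swap hz)).
  rewrite -[LHS]mulr1 -(sum_proj_row z) (sum3 _ hz) !mulrDr Q // add0r.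
  rewrite proj_col0 // add0r (@proj_comm x z y x z) //; last exact: uniq3_swap.
  have := sd _ _ _ hzyx; rewrite /side_det subr_eq0 => d.
  apply: (cyclic_obstruction (a := z) (b := y) (c := x) (i := z) (j := x) (k := y)) => //.
    by do 2 apply: uniq3_rot.
  by rewrite [E y x z * _]mulrC.
by rewrite -entry_proj p0 mulr0.
Qed.
End MagicUnitary.

(** When all pairs of side vectors are independent, the products of distinct entries
    of a row or of a column vanish, and magic_diagonal applies. *)
Lemma independent_sides_diagonal (R : realType) (E : array R) (B : cstarType R)
    (u : 'I_3 * 'I_3 -> B) a b c :
  permutation_condition E -> PW_relations E u ->
  (forall l j k, uniq [:: l; j; k] -> side_det E l j k != 0) ->
  uniq [:: a; b; c] -> E b c a ^+ 2 != E a b c * E c a b ->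
  forall x y, x != y -> u (x, y) = 0.
Proof.
move=> supp rel sd; apply: magic_diagonal => // [x j k jk|x y j xy].
  have [l hl] := third_index jk; have hl' := uniq3_rot (uniq3_rot hl).
  by have [] := products_vanish supp rel x hl' (sd _ _ _ hl').
have [l hl] := third_index xy; have hl' := uniq3_rot (uniq3_rot hl).
by have [] := products_vanish supp rel j hl' (sd _ _ _ hl').
Qed.

(** * Changes of generators and the diagonal case *)

Section Transfer.
Variable R : realType.

(** Natural, mutually inverse changes of generators transport the universal
    property: a map is determined by the new generators because it is by the old. *)
Lemma universal_transfer (I J : Type)
    (P : forall B : cstarType R, (I -> B) -> Prop)
    (Q : forall B : cstarType R, (J -> B) -> Prop)
    (alpha : forall B : cstarType R, (I -> B) -> (J -> B))
    (beta : forall B : cstarType R, (J -> B) -> (I -> B)) (A : cstarType R) (x : I -> A) :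
  (forall B b, P B b -> Q B (alpha B b)) -> (forall B b, Q B b -> P B (beta B b)) ->
  (forall B b, P B b -> beta B (alpha B b) =1 b) ->
  (forall B b, Q B b -> alpha B (beta B b) =1 b) ->
  (forall (B B' : cstarType R) (f : {lrmorphism B -> B'}) b c, star_preserving f ->
     (forall i, f (b i) = c i) -> forall j, f (alpha B b j) = alpha B' c j) ->
  (forall (B B' : cstarType R) (f : {lrmorphism B -> B'}) b c, star_preserving f ->
     (forall j, f (b j) = c j) -> forall i, f (beta B b i) = beta B' c i) ->
  universal P x -> universal Q (alpha A x).
Proof.
move=> PQ QP ba ab na nb [Px ux]; split=> [|B b Qb]; first exact: PQ.
have [f [sf fx fu]] := ux B _ (QP B b Qb).
exists f; split=> // [j|g sg gx].
  by rewrite (na _ _ _ _ _ sf fx) ab.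
apply: fu => // i; rewrite -(ba _ _ Px i).
exact: nb.
Qed.

End Transfer.

Definition i0 : 'I_3 := @Ordinal 3 0 isT.
Definition i1 : 'I_3 := @Ordinal 3 1 isT.
Definition i2 : 'I_3 := @Ordinal 3 2 isT.
Lemma uniq012 : uniq [:: i0; i1; i2]. Proof. by []. Qed.

Section DiagonalCase.
Variables (R : realType) (E : array R).
Hypothesis supp : permutation_condition E.

Definition diag_gen (B : cstarType R) (b : bool -> B) (j : 'I_3) : B :=
  match nat_of_ord j with
  | 0%N => b true | 1%N => b false | _ => star (b true * b false)
  end.
Definition diag_matrix (B : cstarType R) (b : bool -> B) (p : 'I_3 * 'I_3) : B :=
  if p.1 == p.2 then diag_gen b p.1 else 0.
Definition diag_part (B : cstarType R) (u : 'I_3 * 'I_3 -> B) (b : bool) : B :=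
  if b then u (i0, i0) else u (i1, i1).

Lemma unitary_mul (B : cstarType R) (x y : B) : unitary x -> unitary y -> unitary (x * y).
Proof.
move=> [x1 x2] [y1 y2]; split; rewrite starM.
  by rewrite -mulrA [star x * _]mulrA x1 mul1r.
by rewrite -mulrA [y * _]mulrA y2 mul1r.
Qed.

Lemma unitary_star (B : cstarType R) (x : B) : unitary x -> unitary (star x).
Proof. by move=> [x1 x2]; split; rewrite starK. Qed.

Lemma diag_gen_unitary (B : cstarType R) (b : bool -> B) j : commuting_unitaries b ->
  unitary (diag_gen b j).
Proof.
move=> [ub _]; case: j => [[|[|[|//]]] ?] /=; [exact: ub|exact: ub|].
exact/unitary_star/unitary_mul.
Qed.

Lemma diag_gen_comm (B : cstarType R) (b : bool -> B) j k : commuting_unitaries b ->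
  diag_gen b j * diag_gen b k = diag_gen b k * diag_gen b j.
Proof.
move=> [ub cb]; have h i : b i * star (b true * b false) = star (b true * b false) * b i.
  apply: comm_star_unitary; first exact: unitary_mul.
  by rewrite mulrA [b i * b true]cb -mulrA [b i * b false]cb mulrA.
by case: j k => [[|[|[|//]]] ?] [[|[|[|//]]] ?]; rewrite /diag_gen /= ?h.
Qed.

Lemma diag_gen_prod (B : cstarType R) (b : bool -> B) j k l : commuting_unitaries b ->
  uniq [:: j; k; l] -> diag_gen b j * diag_gen b k * diag_gen b l = 1.
Proof.
move=> cb; have c := fun j k => diag_gen_comm j k cb.
have e : diag_gen b i0 * diag_gen b i1 * diag_gen b i2 = 1.
  have [ub _] := cb; by have [_ h] := unitary_mul (ub true) (ub false).
have r x y z : diag_gen b x * diag_gen b y * diag_gen b z = 1 ->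
    diag_gen b y * diag_gen b z * diag_gen b x = 1.
  by move=> <-; rewrite -[LHS]mulrA (c z x) mulrA (c y x).
have s x y z : diag_gen b x * diag_gen b y * diag_gen b z = 1 ->
    diag_gen b y * diag_gen b x * diag_gen b z = 1.
  by move=> <-; rewrite (c y x).
have e1 := r _ _ _ e; have e2 := r _ _ _ e1.
have f := s _ _ _ e; have f1 := r _ _ _ f; have f2 := r _ _ _ f1.
by case: (uniq3_in j uniq012) => ->; case: (uniq3_in k uniq012) => ->;
  case: (uniq3_in l uniq012) => ->.
Qed.

(** For diagonal matrices the determinant condition says that the product of the
    entries is 1 in any order. *)
Lemma diag_relations (B : cstarType R) (b : bool -> B) : commuting_unitaries b ->
  PW_relations E (diag_matrix b).
Proof.
move=> cb; rewrite /diag_matrix.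
have z (j s : 'I_3) : s != j -> (if j == s then diag_gen b j else 0) = 0.
  by rewrite eq_sym => /negPf ->.
split=> [j k|j k|a b' c] /=.
- rewrite (bigD1 j) //= eqxx big1 ?addr0 => [|s sj]; last by rewrite z // mul0r.
  have [<-|jk] := eqVneq j k; last by rewrite star0 mulr0.
  by rewrite ?eqxx; have [] := diag_gen_unitary j cb.
- rewrite (bigD1 j) //= eqxx big1 ?addr0 => [|s sj]; last by rewrite (negPf sj) star0 mul0r.
  have [_|jk] := eqVneq j k; last by rewrite mulr0.
  by have [] := diag_gen_unitary j cb.
rewrite (bigD1 a) //= [X in _ + X]big1 ?addr0 => [|i ia]; last first.
  by rewrite big1 // => j _; rewrite big1 // => k _; rewrite z // !mul0r scaler0.
rewrite (bigD1 b') //= [X in _ + X]big1 ?addr0 => [|j jb]; last first.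
  by rewrite big1 // => k _; rewrite [X in _ * X * _]z // mulr0 mul0r scaler0.
rewrite (bigD1 c) //= [X in _ + X]big1 ?addr0 => [|k kc]; last first.
  by rewrite [X in _ * X]z // mulr0 scaler0.
rewrite !eqxx; have [h|h] := boolP (uniq [:: a; b'; c]); first by rewrite diag_gen_prod.
by rewrite (supp0 supp h) !scale0r.
Qed.

(** The products in the orders 012 and 102 are both 1, so the first two entries
    commute and determine the third. *)
Lemma diagonal_commuting (B : cstarType R) (u : 'I_3 * 'I_3 -> B) :
  PW_relations E u -> (forall x y, x != y -> u (x, y) = 0) ->
  commuting_unitaries (diag_part u) /\ diag_matrix (diag_part u) =1 u.
Proof.
move=> rel d0.
have uu j : unitary (u (j, j)).
  split.
    have := unit_cols rel j j; rewrite eqxx (bigD1 j) //= big1 ?addr0 // => s sj.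
    by rewrite d0 // star0 mul0r.
  have := unit_rows rel j j; rewrite eqxx (bigD1 j) //= big1 ?addr0 // => s sj.
  by rewrite d0 1?eq_sym // mul0r.
have pr a b c : uniq [:: a; b; c] -> u (a, a) * u (b, b) * u (c, c) = 1.
  move=> h; have := det_rel rel a b c.
  rewrite (bigD1 a) //= [X in _ + X]big1 ?addr0 => [|i ia]; last first.
    by rewrite big1 // => j _; rewrite big1 // => k _; rewrite d0 1?eq_sym // !mul0r scaler0.
  rewrite (bigD1 b) //= [X in _ + X]big1 ?addr0 => [|j jb]; last first.
    by rewrite big1 // => k _; rewrite (d0 b) 1?eq_sym // mulr0 mul0r scaler0.
  rewrite (bigD1 c) //= [X in _ + X]big1 ?addr0 => [|k kc]; last first.
    by rewrite (d0 c) 1?eq_sym // mulr0 scaler0.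
  by apply: scalerI; apply: supp_neq0.
have inv (x y : B) : unitary y -> x * y = 1 -> x = star y.
  by move=> [y1 y2] xy; rewrite -[x]mulr1 -y2 mulrA xy mul1r.
have e1 := inv _ _ (uu i2) (pr i0 i1 i2 isT).
have e2 := inv _ _ (uu i2) (pr i1 i0 i2 isT).
have c01 : u (i0, i0) * u (i1, i1) = u (i1, i1) * u (i0, i0) by rewrite e1 e2.
split; first by split=> [[]|[] []]; rewrite /diag_part //=.
case=> j k; rewrite /diag_matrix /=; have [<-|jk] := eqVneq j k; last by rewrite d0.
case: (uniq3_in j uniq012) => -> //=.
by rewrite /diag_gen /= e1 starK.
Qed.

Hypothesis diag : forall (B : cstarType R) (u : 'I_3 * 'I_3 -> B),
  PW_relations E u -> forall x y, x != y -> u (x, y) = 0.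

Lemma diag_matrix_hom (B B' : cstarType R) (f : {lrmorphism B -> B'}) b c p :
  star_preserving f -> (forall i, f (b i) = c i) -> f (diag_matrix b p) = diag_matrix c p.
Proof.
move=> sf fb; rewrite /diag_matrix; case: eqP => _; last by rewrite raddf0.
case: p => -[[|[|[|//]]] ?] k; rewrite /diag_gen //=.
by rewrite sf rmorphM /= !fb.
Qed.

Lemma diag_part_hom (B B' : cstarType R) (f : {lrmorphism B -> B'}) u w i :
  (forall p, f (u p) = w p) -> f (diag_part u i) = diag_part w i.
Proof. by move=> fu; case: i; exact: fu. Qed.

Lemma diag_part_matrix (B : cstarType R) (b : bool -> B) : diag_part (diag_matrix b) =1 b.
Proof. by case. Qed.

Lemma PW_diagonal_torus (G : cqg R) : PW_quantum_group E G -> is_torus_group G.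
Proof.
move=> [u [univ cor]]; have [rel _] := univ.
apply: (@presentation_is_torus R G (diag_part u)); split.
  apply: (universal_transfer (alpha := fun B => @diag_part B) (beta := fun B => @diag_matrix B))
    univ => [B b Pb|B b|B b Pb|B b _|B B' f b c _|B B' f b c sf fb p].
  - by have [] := diagonal_commuting Pb (diag Pb).
  - exact: diag_relations.
  - by have [] := diagonal_commuting Pb (diag Pb).
  - exact: diag_part_matrix.
  - by move=> h j; apply: diag_part_hom.
  - exact: diag_matrix_hom.
have h j : comul G (u (j, j)) = leg1 G (u (j, j)) * leg2 G (u (j, j)).
  rewrite cor (bigD1 j) //= big1 ?addr0 // => s sj.
  by rewrite (diag rel sj) raddf0 mulr0.
by case; exact: h.
Qed.

Lemma torus_PW_diagonal (G : cqg R) : is_torus_group G -> PW_quantum_group E G.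
Proof.
move=> /torus_has_presentation [x [univ hD]]; exists (diag_matrix x); split.
  apply: (universal_transfer (alpha := fun B => @diag_matrix B) (beta := fun B => @diag_part B))
    univ => [B b|B b Pb|B b _|B b Pb|B B' f b c sf fb p|B B' f b c _].
  - exact: diag_relations.
  - by have [] := diagonal_commuting Pb (diag Pb).
  - exact: diag_part_matrix.
  - by have [] := diagonal_commuting Pb (diag Pb).
  - exact: diag_matrix_hom.
  - by move=> h j; apply: diag_part_hom.
have [cu _] := univ.
have star_pres : star_preserving (leg1 G) /\ star_preserving (leg2 G) /\
    (forall a b, leg1 G a * leg2 G b = leg2 G b * leg1 G a) /\ star_preserving (comul G).
  by case: (G) => ? ? ? ? ? [] /=.
have [sl1 [sl2 [com sD]]] := star_pres.
have hd j : comul G (diag_gen x j) = leg1 G (diag_gen x j) * leg2 G (diag_gen x j).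
  case: j => [[|[|[|//]]] ?]; rewrite /diag_gen /=; [exact: hD|exact: hD|].
  rewrite sD rmorphM /= !hD sl1 sl2 -starM -com !rmorphM /=; congr star.
  by rewrite -!mulrA; congr (_ * _); rewrite !mulrA com.
move=> j k; rewrite (bigD1 j) //= big1 ?addr0 => [|s sj]; last first.
  by rewrite /diag_matrix /= eq_sym (negPf sj) raddf0 mul0r.
rewrite /diag_matrix /= eqxx; case: eqP => [_|_]; first exact: hd.
by rewrite !raddf0 mulr0.
Qed.

End DiagonalCase.

(** * The block case and U_q(2) *)

Section BlockCase.
Variables (R : realType) (E : array R).
Hypothesis supp : permutation_condition E.

Definition block (B : cstarType R) (u : 'I_3 * 'I_3 -> B) :=
  forall j, j != i0 -> u (i0, j) = 0 /\ u (j, i0) = 0.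

Definition Uq2_part (B : cstarType R) (u : 'I_3 * 'I_3 -> B) (g : Uq2_generator) : B :=
  match g with
  | gen_a => u (i1, i1) | gen_c => u (i2, i1) | gen_v => u (i0, i0)
  end.

(** The parameter of U_q(2): in a block, u_12 = - q u_21^* u_00^*, where q is minus the
    ratio of the two entries of E that start with 0. *)
Definition side_ratio := - (E i0 i2 i1 / E i0 i1 i2).
Local Notation q := side_ratio.

Lemma side_ratio_neq0 : q != 0.
Proof. by rewrite oppr_eq0 mulf_neq0 ?invr_neq0 // (supp_neq0 supp). Qed.

Lemma phaseE (z : C R) : z != 0 -> (z / `|z|) ^- 2 = z^* / z.
Proof.
move=> z0; have n0 : `|z| != 0 by rewrite normr_eq0.
have zc : z^* != 0 by rewrite conjC_eq0.
rewrite expr_div_n normCK; field; by rewrite z0 zc.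
Qed.

(** The first face of the determinant condition expresses the adjoint of the 2 x 2
    block by its cofactors; with unitarity this gives all relations of U_q(2). *)
Section Necessary.
Variables (B : cstarType R) (u : 'I_3 * 'I_3 -> B).
Hypothesis rel : PW_relations E u.
Hypothesis blk : block u.
Local Notation U j k := (u (j, k)).
Local Notation V j k := (star (u (j, k))).

Lemma block_cancel m k b c : uniq [:: i0; m; k] -> uniq [:: i0; b; c] ->
  E i0 m k *: U c k = E i0 b c *: (V b m * V i0 i0).
Proof.
move=> h h'; have := cancel2 rel i0 m c.
rewrite (sum3 _ h) (supp0 supp) ?[E i0 m m](supp0 supp) /= ?inE ?eqxx ?orbT ?andbF //.
rewrite !scale0r !add0r => ->; rewrite (sum3 _ h').
have m0 : m != i0 by rewrite eq_sym; case: (uniq3_neq h).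
have [-> _] := blk m0; rewrite star0 mul0r add0r.
have z (x y : 'I_3) : x != y -> E x y y = 0.
  by move=> xy; rewrite (supp0 supp) //= !inE eqxx andbF.
have z' (x y : 'I_3) : E x x y = 0.
  by rewrite (supp0 supp) //= !inE eqxx.
have [n1 n2 n3] := uniq3_neq h'.
rewrite [X in _ + V c m * X]big1 ?mulr0 ?addr0 => [|a _].
  rewrite (sum3 _ h') z' scale0r addr0.
  have -> : E c b c = 0 by rewrite (supp0 supp) //= !inE eqxx ?orbT.
  by rewrite scale0r addr0 -scalerAr.
by have [->|ac] := eqVneq a c; rewrite ?z' ?z ?scale0r.
Qed.

Lemma block_entries : [/\ U i1 i2 = - (q *: (V i2 i1 * V i0 i0)),
  U i2 i2 = V i1 i1 * V i0 i0, U i1 i1 = V i2 i2 * V i0 i0 &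
  q *: U i2 i1 = - (V i1 i2 * V i0 i0)].
Proof.
have n1 : E i0 i1 i2 != 0 by apply: supp_neq0.
have n2 : E i0 i2 i1 != 0 by apply: supp_neq0.
split.
- apply: (scalerI n1); rewrite (@block_cancel i1 i2 i2 i1) // /side_ratio.
  by rewrite scaleNr opprK scalerA mulrC divfK.
- by apply: (scalerI n1); rewrite (@block_cancel i1 i2 i1 i2).
- by apply: (scalerI n2); rewrite (@block_cancel i2 i1 i2 i1).
apply: (scalerI n1); rewrite scalerN -(@block_cancel i2 i1 i1 i2) // scalerA /side_ratio.
by rewrite mulrN mulrC divfK // scaleNr.
Qed.

Lemma block_row j k : j != i0 -> U j i1 * V k i1 + U j i2 * V k i2 = (j == k)%:R.
Proof.
move=> j0; rewrite -(unit_rows rel) (sum3 _ uniq012).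
by have [_ ->] := blk j0; rewrite mul0r add0r.
Qed.

Lemma block_col j k : j != i0 -> V i1 j * U i1 k + V i2 j * U i2 k = (j == k)%:R.
Proof.
move=> j0; rewrite -(unit_cols rel) (sum3 _ uniq012).
by have [-> _] := blk j0; rewrite star0 mul0r add0r.
Qed.

Lemma block_corner_unitary : unitary (U i0 i0).
Proof.
split.
  have := unit_cols rel i0 i0; rewrite (sum3 _ uniq012).
  have [_ ->] := @blk i1 isT; have [_ ->] := @blk i2 isT.
  by rewrite !mulr0 !addr0.
have := unit_rows rel i0 i0; rewrite (sum3 _ uniq012).
have [-> _] := @blk i1 isT; have [-> _] := @blk i2 isT.
by rewrite !mul0r !addr0.
Qed.

Lemma block_Uq2 : Uq2_relations q (Uq2_part u).
Proof.
have [e12 e22 e11 e21] := block_entries; have [vv1 vv2] := block_corner_unitary.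
rewrite /Uq2_relations /=; set a := U i1 i1 in e12 e22 e11 e21 *.
set c := U i2 i1 in e12 e22 e11 e21 *; set v := U i0 i0 in e12 e22 e11 e21 vv1 vv2 *.
have q0 := side_ratio_neq0.
have vK x : star v * (v * x) = x by rewrite mulrA vv1 mul1r.
have vK' x : v * (star v * x) = x by rewrite mulrA vv2 mul1r.
have r11 : a * star a + `|q| ^+ 2 *: (star c * c) = 1.
  have := block_row i1 (isT : i1 != i0); rewrite e12 -[RHS]/1 => <-; congr (_ + _).
  rewrite starN starZ mulrNN starM !starK -scalerAr -scalerAl scalerA.
  by rewrite -mulrA vK normCK mulrC.
have r12 : a * star c = q *: (star c * a).
  have := block_row i2 (isT : i1 != i0); rewrite e12 e22 -[RHS]/0 => /eqP.
  rewrite starM !starK addr_eq0 => /eqP ->.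
  by rewrite mulNr opprK -scalerAl -mulrA vK.
have r22 : c * star c + star a * a = 1.
  have := block_row i2 (isT : i2 != i0); rewrite e22 -[RHS]/1 => <-; congr (_ + _).
  by rewrite starM !starK -mulrA vK.
have c11 : star a * a + star c * c = 1.
  exact: (block_col i1 (isT : i1 != i0)).
have c12 : a * c = q^* *: (c * a).
  have := block_col i2 (isT : i1 != i0); rewrite e12 e22 -[RHS]/0 => /eqP.
  rewrite addr_eq0 mulrN eqr_opp -scalerAr => /eqP.
  move=> /(congr1 (fun x => star (x * v))).
  by rewrite -scalerAl -!mulrA vv1 !mulr1 starZ !starM !starK => ->.
split=> //.
- by apply: (addrI (star a * a)); rewrite c11 addrC.
- split.
    have := e11; rewrite e22 starM !starK => e.
    by rewrite {1}e -mulrA vv1 mulr1.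
  rewrite phaseE //.
  have : q *: c = q^* *: (v * (c * star v)).
    by rewrite e21 e12 starN mulNr opprK starZ starM !starK -scalerAl mulrA.
  move=> /(congr1 (fun x => q^-1 *: (x * v))).
  rewrite -!scalerAl !scalerA mulVf // scale1r => ->.
  by rewrite -!mulrA vv1 mulr1 [q^-1 * _]mulrC.
Qed.

Lemma block_Uq2_matrix p : Uq2_matrix q (Uq2_part u) p.1 p.2 = u p.
Proof.
have [e12 e22 _ _] := block_entries.
have [z01 z10] := @blk i1 isT; have [z02 z20] := @blk i2 isT.
case: p => j k; case: (uniq3_in j uniq012) => ->; case: (uniq3_in k uniq012) => ->;
  by rewrite /Uq2_matrix /= ?z01 ?z10 ?z02 ?z20 ?e12 ?e22.
Qed.

End Necessary.

(** Conversely the matrix of U_q(2) satisfies the determinant condition provided that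
    its two other faces, where the entry 0 comes last or in the middle, are
    compatible with the first. *)
Section Sufficient.
Variables (B : cstarType R) (x : Uq2_generator -> B).
Hypothesis relq : Uq2_relations q x.
Local Notation a := (x gen_a).
Local Notation c := (x gen_c).
Local Notation v := (x gen_v).
Local Notation w := (fun p => Uq2_matrix q x p.1 p.2).
Local Notation y := (- (q *: (star c * star v))).
Local Notation t := (star a * star v).

Lemma uq2_vv : unitary v.
Proof. by have [_ _ _ [h1 h2] _] := relq. Qed.

Lemma uq2_comm : [/\ star a * v = v * star a, a * star v = star v * a,
  star c * v = (q / q^*) *: (v * star c), c * v = (q^* / q) *: (v * c)
  & star v * c = (q^* / q) *: (c * star v)].
Proof.
have [_ _ _ _ [av cv]] := relq; have [v1 v2] := uq2_vv.
have q0 := side_ratio_neq0; have qc : q^* != 0 by rewrite conjC_eq0.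
rewrite phaseE // in cv.
have vK z : star v * (v * z) = z by rewrite mulrA v1 mul1r.
have e : star v * c = (q^* / q) *: (c * star v).
  have : star v * (c * v) * star v = star v * c by rewrite -!mulrA v2 mulr1.
  by rewrite cv -scalerAr vK -scalerAl => <-.
have sav : a * star v = star v * a by apply: comm_star_unitary => //; exact: uq2_vv.
split=> //.
  by have := congr1 (@star _ _) sav; rewrite !starM starK => <-.
have := congr1 (@star _ _) e; rewrite starZ !starM !starK => ->.
by congr (_ *: _); rewrite rmorphM fmorphV /= conjCK.
Qed.

Lemma uq2_unitary : (forall j k, \sum_s w (j, s) * star (w (k, s)) = (j == k)%:R) /\
  (forall j k, \sum_s star (w (s, j)) * w (s, k) = (j == k)%:R).
Proof.
have [[ac acs] [c11 r11] nc [vv1 vv2] [av cv]] := relq.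
have [sav avs scv _ svc] := uq2_comm.
have vK z : star v * (v * z) = z by rewrite mulrA vv2 mul1r.
have vK' z : v * (star v * z) = z by rewrite mulrA vv1 mul1r.
have r22 : c * star c + star a * a = 1 by rewrite nc addrC.
have yyE : y * star y = `|q| ^+ 2 *: (star c * c).
  rewrite starN starZ mulrNN starM !starK -scalerAr -scalerAl scalerA.
  by rewrite -mulrA vK normCK mulrC.
have ttE : t * star t = star a * a by rewrite starM !starK -mulrA vK.
have ytE : y * star t = - (q *: (star c * a)).
  by rewrite starM !starK mulNr -scalerAl -mulrA vK.
have r12 : a * star c + y * star t = 0 by rewrite ytE acs subrr.
have r21 : c * star a + t * star y = 0.
  by have := congr1 (@star _ _) r12; rewrite starD !starM !starK star0.
have ysy : star y * y = `|q| ^+ 2 *: (v * (c * star c) * star v).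
  rewrite starN starZ mulrNN starM !starK -scalerAr -scalerAl scalerA.
  by rewrite !mulrA normCK.
have tst : star t * t = v * (a * star a) * star v by rewrite starM !starK !mulrA.
have c22 : star y * y + star t * t = 1.
  by rewrite ysy tst scalerAl scalerAr -mulrDl -mulrDr nc addrC r11 mulr1 vv1.
have c12 : star a * y + star c * t = 0.
  rewrite mulrN -scalerAr; have := congr1 (@star _ _) ac.
  rewrite starZ !starM conjCK => e.
  have -> : star c * t = q *: (star a * (star c * star v)).
    by rewrite mulrA e -scalerAl -mulrA.
  by rewrite addNr.
have c21 : star y * a + star t * c = 0.
  by have := congr1 (@star _ _) c12; rewrite starD !starM !starK star0.
split=> j k; rewrite (sum3 _ uniq012).
  case: (uniq3_in j uniq012) => ->; case: (uniq3_in k uniq012) => ->;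
    rewrite /Uq2_matrix /= ?star0 ?mul0r ?mulr0 ?add0r ?addr0 //.
    by rewrite yyE.
  by rewrite ttE.
case: (uniq3_in j uniq012) => ->; case: (uniq3_in k uniq012) => ->;
  rewrite /Uq2_matrix /= ?star0 ?mul0r ?mulr0 ?add0r ?addr0 //.
Qed.

(** The products of two entries of the block that enter the faces where 0 comes first
    or last: v is on the outside and can be cancelled. *)
Lemma uq2_pair (e : C R) :
  [/\ e *: (a * t) + (- q * e) *: (y * c) = e *: star v,
     e *: (c * y) + (- q * e) *: (t * a) = (- q * e) *: star v,
     e *: (a * y) + (- q * e) *: (y * a) = 0 &
     e *: (c * t) + (- q * e) *: (t * c) = 0].
Proof.
have [[ac acs] [c11 r11] nc _ _] := relq.
have [sav avs scv _ svc] := uq2_comm; have q0 := side_ratio_neq0.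
have ca : c * star a = q^* *: (star a * c).
  by have := congr1 (@star _ _) acs; rewrite starZ !starM starK.
have yc : y * c = - (q^* *: (star c * c * star v)).
  rewrite mulNr -scalerAl -[star c * star v * c]mulrA svc -scalerAr scalerA.
  by rewrite [q * _]mulrC divfK // mulrA.
have cy : c * y = - (q *: (star c * c * star v)) by rewrite mulrN -scalerAr mulrA nc.
have ta : t * a = star a * a * star v by rewrite -[LHS]mulrA -avs mulrA.
have ay : a * y = - ((q * q) *: (star c * a * star v)).
  by rewrite mulrN -scalerAr mulrA acs -scalerAl scalerA.
have ya : y * a = - (q *: (star c * a * star v)).
  by rewrite mulNr -scalerAl -[star c * star v * a]mulrA -avs mulrA.
have ct : c * t = q^* *: (star a * c * star v) by rewrite mulrA ca -scalerAl.
have tc : t * c = (q^* / q) *: (star a * c * star v).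
  by rewrite -[LHS]mulrA svc -scalerAr mulrA.
split.
- have -> : a * t = a * star a * star v by rewrite mulrA.
  rewrite yc scalerN scalerA -scaleNr.
  rewrite (_ : - (- q * e * q^*) = e * `|q| ^+ 2); last by rewrite normCK; ring.
  by rewrite -scalerA -scalerDr scalerAl -mulrDl r11 mul1r.
- rewrite cy ta scalerN scalerA -scaleNr -mulrN mulrC -scalerDr.
  by rewrite -mulrDl addrC c11 mul1r.
- rewrite ay ya !scalerN -opprD !scalerA -scalerDl.
  by rewrite (_ : _ + _ = 0) ?scale0r ?oppr0 //; ring.
rewrite ct tc !scalerA -scalerDl (_ : _ + _ = 0) ?scale0r //.
by field.
Qed.

(** In the middle face, moving v past c conjugates the parameter. *)
Lemma uq2_middle (e : C R) :
  [/\ e *: (a * v * t) + (- q^* * e) *: (y * v * c) = e *: 1,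
     e *: (c * v * y) + (- q^* * e) *: (t * v * a) = (- q^* * e) *: 1,
     e *: (a * v * y) + (- q^* * e) *: (y * v * a) = 0 &
     e *: (c * v * t) + (- q^* * e) *: (t * v * c) = 0].
Proof.
have [[ac acs] [c11 r11] nc [vv1 vv2] [av cv]] := relq.
have [sav avs scv cv' svc] := uq2_comm; have q0 := side_ratio_neq0.
have qc0 : q^* != 0 by rewrite conjC_eq0.
have ca : c * star a = q^* *: (star a * c).
  by have := congr1 (@star _ _) acs; rewrite starZ !starM starK.
have vK z : star v * (v * z) = z by rewrite mulrA vv2 mul1r.
have avt : a * v * t = a * star a.
  by rewrite -mulrA [v * _]mulrA -sav -[_ * v * _]mulrA vv1 mulr1.
have yvc : y * v * c = - (q *: (star c * c)).
  by rewrite mulNr -scalerAl -[star c * _ * v]mulrA vv2 mulr1 mulNr -scalerAl.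
have tva : t * v * a = star a * a by rewrite -[t * v]mulrA vv2 mulr1.
have tvc : t * v * c = star a * c by rewrite -[t * v]mulrA vv2 mulr1.
have yva : y * v * a = - (q *: (star c * a)).
  by rewrite mulNr -scalerAl -[star c * _ * v]mulrA vv2 mulr1 mulNr -scalerAl.
have vcv : v * (star c * star v) = (q^* / q) *: star c.
  have e1 : (q / q^*) *: (v * (star c * star v)) = star c.
    by rewrite mulrA scalerAl -scv -mulrA vv1 mulr1.
  rewrite -{2}e1 scalerA (_ : q^* / q * (q / q^*) = 1) ?scale1r //.
  by field; rewrite q0 qc0.
have cvy : c * v * y = - (q^* *: (star c * c)).
  rewrite mulrN -scalerAr -mulrA vcv -scalerAr scalerA nc.
  by rewrite [q * _]mulrC divfK.
have avy : a * v * y = - ((q^* * q) *: (star c * a)).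
  rewrite mulrN -scalerAr -mulrA vcv -scalerAr scalerA acs scalerA.
  by rewrite [q * (_ / q)]mulrC divfK.
have cvt : c * v * t = q^* *: (star a * c).
  by rewrite -mulrA [v * _]mulrA -sav -[_ * v * _]mulrA vv1 mulr1 ca.
split.
- rewrite avt yvc scalerN scalerA -scaleNr.
  rewrite (_ : - (- q^* * e * q) = e * `|q| ^+ 2); last by rewrite normCK; ring.
  by rewrite -scalerA -scalerDr r11.
- rewrite cvy tva scalerN scalerA -scaleNr -mulrN mulrC -scalerDr.
  by rewrite addrC c11.
- rewrite avy yva !scalerN -opprD !scalerA -scalerDl.
  by rewrite (_ : _ + _ = 0) ?scale0r ?oppr0 //; ring.
by rewrite cvt tvc !scalerA -scalerDl (_ : _ + _ = 0) ?scale0r //; ring.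
Qed.

End Sufficient.

Lemma det_sum6 (V : lmodType (C R)) (F : 'I_3 -> 'I_3 -> 'I_3 -> V) :
  \sum_i \sum_j \sum_k E i j k *: F i j k =
  (E i0 i1 i2 *: F i0 i1 i2 + E i0 i2 i1 *: F i0 i2 i1) +
  (E i1 i0 i2 *: F i1 i0 i2 + E i1 i2 i0 *: F i1 i2 i0) +
  (E i2 i0 i1 *: F i2 i0 i1 + E i2 i1 i0 *: F i2 i1 i0).
Proof.
have tt i j k (h : uniq [:: i; j; k]) := two_terms_left supp (F i) (g := id) erefl h.
rewrite (sum3 _ uniq012); congr (_ + _ + _).
- exact: (tt i0 i1 i2 isT).
- exact: (tt i1 i0 i2 isT).
exact: (tt i2 i0 i1 isT).
Qed.

Hypothesis parallel : E i1 i2 i0 * E i0 i2 i1 = E i2 i1 i0 * E i0 i1 i2.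
Hypothesis twisted : E i2 i0 i1 * (E i0 i1 i2)^* = E i1 i0 i2 * (E i0 i2 i1)^*.

Lemma side_ratioE : [/\ E i0 i2 i1 = - q * E i0 i1 i2,
  E i2 i1 i0 = - q * E i1 i2 i0 & E i2 i0 i1 = - q^* * E i1 i0 i2].
Proof.
have n1 : E i0 i1 i2 != 0 by apply: supp_neq0.
have n1c : (E i0 i1 i2)^* != 0 by rewrite conjC_eq0.
rewrite /side_ratio opprK; split; first by rewrite divfK.
  by apply: (mulIf n1); rewrite -parallel; field.
apply: (mulIf n1c); rewrite twisted rmorphN opprK rmorphM fmorphV /=.
by field.
Qed.

Lemma Uq2_PW (B : cstarType R) (x : Uq2_generator -> B) : Uq2_relations q x ->
  PW_relations E (fun p => Uq2_matrix q x p.1 p.2).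
Proof.
move=> relq; have [rows cols] := uq2_unitary relq; split=> // a b c.
have [e1 e2 e3] := side_ratioE; have [v1 v2] := uq2_vv relq.
have [p1 p2 p3 p4] := uq2_pair relq (E i0 i1 i2).
have [g1 g2 g3 g4] := uq2_pair relq (E i1 i2 i0).
have [m1 m2 m3 m4] := uq2_middle relq (E i1 i0 i2).
rewrite -e1 in p1 p2 p3 p4; rewrite -e2 in g1 g2 g3 g4; rewrite -e3 in m1 m2 m3 m4.
have L (z1 z2 z3 z4 : B) (e e' : C R) :
    e *: (x gen_v * z1 * z2) + e' *: (x gen_v * z3 * z4) =
    x gen_v * (e *: (z1 * z2) + e' *: (z3 * z4)).
  by rewrite mulrDr -!scalerAr !mulrA.
have Rt (z z' : B) (e e' : C R) :
    e *: (z * x gen_v) + e' *: (z' * x gen_v) = (e *: z + e' *: z') * x gen_v.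
  by rewrite mulrDl -!scalerAl.
have vs (e : C R) : x gen_v * (e *: star (x gen_v)) = e *: 1 by rewrite -scalerAr v2.
have sv (e : C R) : (e *: star (x gen_v)) * x gen_v = e *: 1 by rewrite -scalerAl v1.
have z0 (i j : 'I_3) : E i i j = 0 by rewrite (supp0 supp) //= !inE eqxx.
have z1 (i j : 'I_3) : E i j i = 0 by rewrite (supp0 supp) //= !inE eqxx orbT.
have z2 (i j : 'I_3) : E j i i = 0 by rewrite (supp0 supp) //= !inE eqxx andbF.
rewrite det_sum6.
case: (uniq3_in a uniq012) => ->; case: (uniq3_in b uniq012) => ->;
  case: (uniq3_in c uniq012) => ->;
  rewrite /Uq2_matrix /= ?(mul0r, mulr0, scaler0, add0r, addr0) ?z0 ?z1 ?z2 ?scale0r //.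
- by rewrite L p3 mulr0.
- by rewrite L p1 vs.
- by rewrite L p2 vs.
- by rewrite L p4 mulr0.
- by rewrite Rt g3 mul0r.
- by rewrite Rt g1 sv.
- by rewrite Rt g2 sv.
- by rewrite Rt g4 mul0r.
Qed.

Lemma Uq2_matrix_hom (B B' : cstarType R) (f : {lrmorphism B -> B'}) b c p :
  star_preserving f -> (forall g, f (b g) = c g) ->
  f (Uq2_matrix q b p.1 p.2) = Uq2_matrix q c p.1 p.2.
Proof.
move=> sf fb; have fZ z x : f (z *: x) = z *: f x by exact: linearZ.
case: p => j k; rewrite /Uq2_matrix.
by case: (uniq3_in j uniq012) => ->; case: (uniq3_in k uniq012) => -> /=;
  rewrite ?raddf0 ?(raddfN f) /= ?fZ ?rmorphM /= ?(sf, fb).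
Qed.

(** Each direction maps generators to generators, and the two maps are inverse to
    each other. *)
Lemma PW_block_Uq2 (G : cqg R) :
  (forall (B : cstarType R) (u : 'I_3 * 'I_3 -> B), PW_relations E u -> block u) ->
  PW_quantum_group E G -> is_Uq2 q G.
Proof.
move=> blk [u [univ cor]]; have [rel _] := univ.
exists (Uq2_part u); split; last first.
  move=> j k; have m p : Uq2_matrix q (Uq2_part u) p.1 p.2 = u p.
    exact: (block_Uq2_matrix rel (blk _ _ rel)).
  rewrite (m (j, k)) cor; apply: eq_bigr => s _.
  by rewrite (m (j, s)) (m (s, k)).
apply: (universal_transfer (alpha := fun B => @Uq2_part B)
    (beta := fun B x p => Uq2_matrix q x p.1 p.2)) univ => [B b Pb|B b Qb|B b Pb p|B b _|B B' f b c sf fb g|B B' f b c sf fb p].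
- exact: (block_Uq2 Pb (blk _ _ Pb)).
- exact: Uq2_PW.
- exact: (block_Uq2_matrix Pb (blk _ _ Pb)).
- by case.
- by case: g; exact: fb.
exact: Uq2_matrix_hom.
Qed.

Lemma Uq2_PW_block (G : cqg R) :
  (forall (B : cstarType R) (u : 'I_3 * 'I_3 -> B), PW_relations E u -> block u) ->
  is_Uq2 q G -> PW_quantum_group E G.
Proof.
move=> blk [x [univ cor]]; exists (fun p => Uq2_matrix q x p.1 p.2); split=> //.
apply: (universal_transfer (beta := fun B => @Uq2_part B)
    (alpha := fun B x p => Uq2_matrix q x p.1 p.2)) univ => [B b Qb|B b Pb|B b _|B b Pb p|B B' f b c sf fb p|B B' f b c sf fb g].
- exact: Uq2_PW.
- exact: (block_Uq2 Pb (blk _ _ Pb)).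
- by case.
- exact: (block_Uq2_matrix Pb (blk _ _ Pb)).
- exact: Uq2_matrix_hom.
by case: g; exact: fb.
Qed.

End BlockCase.

(** A face that is not compatible with the first one gives a second value for the
    multiple of c^* c that completes a a^* to 1, which forces c = 0. *)
Lemma block_diagonal (R : realType) (E : array R) (B : cstarType R)
    (u : 'I_3 * 'I_3 -> B) :
  permutation_condition E -> PW_relations E u -> block u ->
  ~~ ((E i1 i2 i0 * E i0 i2 i1 == E i2 i1 i0 * E i0 i1 i2) &&
      (E i2 i0 i1 * (E i0 i1 i2)^* == E i1 i0 i2 * (E i0 i2 i1)^*)) ->
  forall x y, x != y -> u (x, y) = 0.
Proof.
move=> supp rel blk ncond; set q := side_ratio E.
have relq := block_Uq2 supp rel blk; have m p := block_Uq2_matrix supp rel blk p.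
have [[ac acs] [c11 r11] nc [vv1 vv2] [av cv]] := relq.
set x := Uq2_part u in relq ac acs c11 r11 nc vv1 vv2 av cv m; clearbody x.
have n1 : E i0 i1 i2 != 0 by apply: (supp_neq0 supp).
have n1c : (E i0 i1 i2)^* != 0 by rewrite conjC_eq0.
have q0 : q != 0 by apply: side_ratio_neq0.
have qc0 : q^* != 0 by rewrite conjC_eq0.
have eq2 : E i0 i2 i1 = - q * E i0 i1 i2 by rewrite /q /side_ratio opprK divfK.
have m' j k : u (j, k) = Uq2_matrix q x j k by exact: (esym (m (j, k))).
have cmp (e e1 e2 : C R) (X Y : B) : e *: X + e1 *: Y = e *: 1 ->
    e *: X + e2 *: Y = e *: 1 -> Y != 0 -> e1 = e2.
  move=> h1 h2 Y0; have : e1 *: Y = e2 *: Y by apply: (addrI (e *: X)); rewrite h1 h2.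
  by move/eqP; rewrite -subr_eq0 -scalerBl scaler_eq0 (negPf Y0) orbF subr_eq0 => /eqP.
have xc0 : x gen_c = 0.
  apply: star_mul_eq0; apply/eqP; apply: contraNT ncond => nz.
  have [sav avs _ _ _] := uq2_comm supp relq.
  have nz1 : x gen_a * star (x gen_a) != 1.
    apply: contra nz => /eqP h; move: r11; rewrite h => /eqP.
    by rewrite addrC -subr_eq0 addrK scaler_eq0 expf_eq0 normr_eq0 (negPf q0).
  have Y1 : - (q *: (star (x gen_c) * star (x gen_v))) * x gen_c * x gen_v != 0.
    apply: contra nz1 => /eqP h.
    have [p1 _ _ _] := uq2_pair supp relq 1.
    have := congr1 (fun z => z * x gen_v) p1.
    by rewrite mulrDl -!scalerAl h scaler0 addr0 !scale1r -!mulrA vv2 mulr1 => ->.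
  have Y2 : - (q *: (star (x gen_c) * star (x gen_v))) * x gen_v * x gen_c != 0.
    apply: contra nz1 => /eqP h.
    have [m1 _ _ _] := uq2_middle supp relq 1; move: m1.
    rewrite h scaler0 addr0 !scale1r -mulrA [x gen_v * _]mulrA -sav -[_ * _ * star (x gen_v)]mulrA vv1 mulr1.
    by move=> ->.
  have D1 := det_rel rel i1 i2 i0; have D2 := det_rel rel i1 i0 i2.
  rewrite (det_sum6 supp) !m' /Uq2_matrix /= !(mul0r, mulr0, scaler0, add0r, addr0) in D1.
  rewrite (det_sum6 supp) !m' /Uq2_matrix /= !(mul0r, mulr0, scaler0, add0r, addr0) in D2.
  have [g1 _ _ _] := uq2_pair supp relq (E i1 i2 i0).
  have {}g1 := congr1 (fun z => z * x gen_v) g1.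
  rewrite /= mulrDl -!scalerAl vv2 in g1.
  have [m1 _ _ _] := uq2_middle supp relq (E i1 i0 i2).
  rewrite (cmp _ _ _ _ _ D1 g1 Y1) (cmp _ _ _ _ _ D2 m1 Y2) eq2.
  apply/andP; split; apply/eqP; first by rewrite -/q; ring.
  by rewrite [(_ * E i0 i1 i2)^*]rmorphM /= -/q [(- q)^*]rmorphN /=; ring.
move=> j k; case: (uniq3_in j uniq012) => ->; case: (uniq3_in k uniq012) => -> //= _;
  by rewrite m' /Uq2_matrix /= ?xc0 ?star0 ?mul0r ?scaler0 ?oppr0.
Qed.

(** * Renumbering, rescaling and cube roots of unity *)

Section ChangesOfArray.
Variable R : realType.

Lemma perm_eq_enum3 (a b c : 'I_3) : perm_eq [:: a; b; c] (enum 'I_3) = uniq [:: a; b; c].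
Proof.
apply/idP/idP => h; first by rewrite (perm_uniq h) enum_uniq.
apply: uniq_perm (enum_uniq _) _ => // x.
by rewrite mem_enum !inE; case: (uniq3_in x h) => ->; rewrite eqxx ?orbT.
Qed.

Lemma perm_array_supp (e1 e2 e3 e4 e5 e6 : C R) : e1 != 0 -> e2 != 0 -> e3 != 0 ->
  e4 != 0 -> e5 != 0 -> e6 != 0 -> permutation_condition (perm_array e1 e2 e3 e4 e5 e6).
Proof.
move=> h1 h2 h3 h4 h5 h6 a b c; rewrite perm_eq_enum3.
by case: (uniq3_in a uniq012) => ->; case: (uniq3_in b uniq012) => ->;
  case: (uniq3_in c uniq012) => ->; rewrite /perm_array /= ?eqxx ?h1 ?h2 ?h3 ?h4 ?h5 ?h6.
Qed.

Lemma array_eq (E : array R) : permutation_condition E ->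
  E = perm_array (E i0 i1 i2) (E i0 i2 i1) (E i1 i0 i2) (E i1 i2 i0) (E i2 i0 i1) (E i2 i1 i0).
Proof.
move=> supp; apply/funext => a; apply/funext => b; apply/funext => c.
case: (uniq3_in a uniq012) => ->; case: (uniq3_in b uniq012) => ->;
  case: (uniq3_in c uniq012) => ->; rewrite /perm_array //=; exact: (supp0 supp).
Qed.

Lemma universal_iff (I : Type) (P Q : forall B : cstarType R, (I -> B) -> Prop)
    (A : cstarType R) (x : I -> A) :
  (forall B b, P B b <-> Q B b) -> universal P x -> universal Q x.
Proof.
move=> PQ [Px ux]; split=> [|B b /PQ /ux //]; exact/PQ.
Qed.

Definition scaled (z : C R) (E : array R) : array R := fun i j k => z * E i j k.

Lemma PW_relations_scaled z E (B : cstarType R) (u : 'I_3 * 'I_3 -> B) : z != 0 ->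
  PW_relations E u <-> PW_relations (scaled z E) u.
Proof.
move=> z0.
have h a b c : \sum_i \sum_j \sum_k scaled z E i j k *: (u (a, i) * u (b, j) * u (c, k)) =
    z *: \sum_i \sum_j \sum_k E i j k *: (u (a, i) * u (b, j) * u (c, k)).
  rewrite scaler_sumr; apply: eq_bigr => i _; rewrite scaler_sumr; apply: eq_bigr => j _.
  by rewrite scaler_sumr; apply: eq_bigr => k _; rewrite scalerA.
split=> -[r1 r2 r3]; split=> // a b c; first by rewrite h r3 scalerA.
by apply: (scalerI z0); rewrite -h r3 scalerA.
Qed.

Lemma PW_scaled z E (G : cqg R) : z != 0 ->
  PW_quantum_group (scaled z E) G <-> PW_quantum_group E G.
Proof.
move=> z0; have eqv B b := @PW_relations_scaled z E B b z0.
split=> -[u [univ cor]]; exists u; (split; last exact: cor).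
  exact: (@universal_iff _ (@PW_relations R (scaled z E)) (@PW_relations R E) _ _
    (fun B b => iff_sym (eqv B b)) univ).
exact: (@universal_iff _ (@PW_relations R E) (@PW_relations R (scaled z E)) _ _ eqv univ).
Qed.

Definition renumbered (s : 'I_3 -> 'I_3) (E : array R) : array R :=
  fun i j k => E (s i) (s j) (s k).

Definition renumber (B : cstarType R) (s : 'I_3 -> 'I_3) (u : 'I_3 * 'I_3 -> B) :=
  fun p => u (s p.1, s p.2).

(** Renumbering the rows and columns of u together with the indices of E only
    permutes the terms of the sums. *)
Lemma PW_relations_renumbered (s s' : 'I_3 -> 'I_3) E (B : cstarType R)
    (u : 'I_3 * 'I_3 -> B) : cancel s s' -> cancel s' s ->
  PW_relations E u -> PW_relations (renumbered s E) (renumber s u).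
Proof.
move=> ss' s's [r1 r2 r3]; have si := can_inj ss'.
have re (V : nmodType) (F : 'I_3 -> V) : \sum_i F (s i) = \sum_i F i.
  by rewrite [RHS](reindex s) //; exists s' => x _.
split=> [j k|j k|a b c]; rewrite /renumber /renumbered /=.
- by rewrite (re _ (fun i => u (s j, i) * star (u (s k, i)))) r1 (inj_eq si).
- by rewrite (re _ (fun i => star (u (i, s j)) * u (i, s k))) r2 (inj_eq si).
rewrite -r3 -[RHS]re; apply: eq_bigr => i _; rewrite -[RHS]re; apply: eq_bigr => j _.
by rewrite -[RHS]re.
Qed.

Lemma renumbered_supp s s' (E : array R) : cancel s s' -> cancel s' s ->
  permutation_condition E -> permutation_condition (renumbered s E).
Proof.
move=> ss' s's supp a b c; rewrite perm_eq_enum3.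
rewrite -[uniq _](map_inj_uniq (can_inj ss')) -perm_eq_enum3; exact: supp.
Qed.

Lemma PW_renumbered s s' E (G : cqg R) : cancel s s' -> cancel s' s ->
  PW_quantum_group E G -> PW_quantum_group (renumbered s E) G.
Proof.
move=> ss' s's [u [univ cor]]; exists (renumber s u); split; last first.
  move=> j k; rewrite /renumber /= cor (reindex s) //.
  by exists s' => x _.
apply: (universal_transfer (alpha := fun B => @renumber B s)
    (beta := fun B => @renumber B s')) univ => [B b|B b Pb|B b _ [j k]|B b _ [j k]|B B' f b c _ h p|B B' f b c _ h p].
- exact: PW_relations_renumbered.
- have <- : renumbered s' (renumbered s E) = E.
    by apply/funext => i; apply/funext => j; apply/funext => k; rewrite /renumbered !s's.
  exact: PW_relations_renumbered.
- by rewrite /renumber /= !s's.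
- by rewrite /renumber /= !ss'.
- exact: h.
- exact: h.
Qed.

(** The quantum groups themselves, and not only isomorphic copies, satisfy the
    definition of the entry l. *)
Definition classified (E : array R) :=
  exists2 l : listed R, admissible l & forall G, PW_quantum_group E G -> is_member l G.

Lemma classified_renumbered s s' E : cancel s s' -> cancel s' s ->
  classified (renumbered s E) -> classified E.
Proof.
move=> ss' s's [l al h]; exists l => // G hG.
exact/h/(PW_renumbered ss' s's).
Qed.

Lemma classified_scaled_inv z E : z != 0 -> classified (scaled z E) -> classified E.
Proof.
by move=> z0 [l al h]; exists l => // G hG; apply/h/PW_scaled.
Qed.

End ChangesOfArray.

Section CubeRoots.
Variable R : realType.

Lemma zeta_cube : zeta R ^+ 3 = 1.
Proof.
pose x : R := 2 / 3 * pi.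
have x3 : x + (x + x) = pi + pi by rewrite /x; field.
have mulE (a b : R) : ((cos a +i* sin a)%C : C R) * (cos b +i* sin b)%C
    = (cos (a + b) +i* sin (a + b))%C.
  by rewrite cosD sinD; apply/eqP; rewrite eq_complex /= eqxx addrC eqxx.
rewrite /zeta -/x exprS expr2 !mulE x3.
rewrite cosD sinD cospi sinpi !(mulr0, mul0r, addr0, subr0) mulrNN mulr1.
by [].
Qed.

Lemma zeta_neq1 : zeta R != 1.
Proof.
apply/negP; rewrite eq_complex /= => /andP[/eqP h _].
have p0 := pi_gt0 R.
have : (2 / 3 * pi : R) = 0.
  apply: cos_inj; rewrite ?cos0 // in_itv /=; last by rewrite lexx ltW.
  by apply/andP; split; [rewrite mulr_ge0 // ltW|lra].
by move/eqP; rewrite mulf_eq0 => /orP[|]; apply/negP; [lra|rewrite gt_eqF].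
Qed.

Lemma cube_root (z : C R) : z ^+ 3 = 1 -> exists k : 'I_3, z = zeta R ^+ k.
Proof.
move=> z3; have z1 := zeta_cube; have n1 := zeta_neq1.
have s : 1 + zeta R + zeta R ^+ 2 = 0.
  have : (zeta R - 1) * (1 + zeta R + zeta R ^+ 2) = 0.
    by rewrite -[RHS](subrr (1 : C R)) -{3}z1; ring.
  by move/eqP; rewrite mulf_eq0 subr_eq0 (negPf n1) /= => /eqP.
have : (z - 1) * ((z - zeta R) * (z - zeta R ^+ 2)) = 0.
  have -> : (z - zeta R) * (z - zeta R ^+ 2) = z ^+ 2 + z + 1.
    have -> : (z - zeta R) * (z - zeta R ^+ 2) =
      z ^+ 2 + z + zeta R ^+ 3 - z * (1 + zeta R + zeta R ^+ 2) by ring.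
    by rewrite s z1 mulr0 subr0.
  have -> : (z - 1) * (z ^+ 2 + z + 1) = z ^+ 3 - 1 by ring.
  by rewrite z3 subrr.
move/eqP; rewrite !mulf_eq0 !subr_eq0 => /or3P[] /eqP ->.
- by exists i0; rewrite expr0.
- by exists i1; rewrite expr1.
by exists i2.
Qed.

Lemma cube_root_neq0 (z : C R) : z ^+ 3 = 1 -> z != 0.
Proof. by move=> h; apply/eqP => z0; move/eqP: h; rewrite z0 expr0n eq_sym oner_eq0. Qed.

Lemma cube_rootV (z : C R) : z ^+ 3 = 1 -> z^-1 = z ^+ 2.
Proof.
move=> h; have z0 := cube_root_neq0 h.
by apply: (mulfI z0); rewrite mulfV // -exprS h.
Qed.

End CubeRoots.

(** * Classification of the arrays *)

Section BlockArrays.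
Variables (R : realType) (E : array R).
Hypothesis supp : permutation_condition E.

(** One of the two diagonal self-intertwiners of u has at l an eigenvalue that it
    takes nowhere else. *)
Definition separated (l : 'I_3) :=
  (forall j, j != l -> rotation_weight E j != rotation_weight E l) \/
  (forall j, j != l -> left_weight E j * right_weight E j !=
                       left_weight E l * right_weight E l).

Lemma separated_vanish l (B : cstarType R) (u : 'I_3 * 'I_3 -> B) j :
  separated l -> PW_relations E u -> j != l -> u (l, j) = 0 /\ u (j, l) = 0.
Proof.
move=> sep rel jl.
have van (z z' : C R) (x : B) : z *: star x = z' *: star x -> z != z' -> x = 0.
  move=> /eqP; rewrite -subr_eq0 -scalerBl scaler_eq0 => /orP[|/eqP h _].
    by rewrite subr_eq0 => /eqP ->; rewrite eqxx.
  by rewrite -[x]starK h star0.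
case: sep => /(_ j jl) h; split.
- exact: (van _ _ _ (rotation_intertwines rel supp l j) h).
- by apply: (van _ _ _ (rotation_intertwines rel supp j l)); rewrite eq_sym.
- exact: (van _ _ _ (weight_intertwines rel supp l j) h).
- by apply: (van _ _ _ (weight_intertwines rel supp j l)); rewrite eq_sym.
Qed.
End BlockArrays.

Section Classification.
Variable R : realType.
Implicit Types E : array R.

Lemma block_classified E : permutation_condition E ->
  (forall (B : cstarType R) (u : 'I_3 * 'I_3 -> B), PW_relations E u -> block u) ->
  classified E.
Proof.
move=> supp blk.
have [/andP[/eqP par /eqP tw]|nc] := boolP ((E i1 i2 i0 * E i0 i2 i1 == E i2 i1 i0 * E i0 i1 i2) &&
      (E i2 i0 i1 * (E i0 i1 i2)^* == E i1 i0 i2 * (E i0 i2 i1)^*)).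
  exists (Uq2 (side_ratio E)); first exact: side_ratio_neq0.
  by move=> G; apply: PW_block_Uq2.
exists Torus => // G; apply: PW_diagonal_torus => // B u rel.
exact: (block_diagonal supp rel (blk _ _ rel) nc).
Qed.

Lemma separated_classified E l : permutation_condition E -> separated E l -> classified E.
Proof.
move=> supp sep; pose s : 'I_3 -> 'I_3 := tperm i0 l.
have ss : cancel s s by exact: tpermK.
apply: (classified_renumbered ss ss); apply: block_classified.
  exact: (renumbered_supp ss ss supp).
move=> B u rel j j0.
have rel' : PW_relations E (renumber s u).
  have <- : renumbered s (renumbered s E) = E.
    by apply/funext => a; apply/funext => b; apply/funext => c; rewrite /renumbered !ss.
  exact: PW_relations_renumbered.
have sj : s j != l.
  by apply: contra j0 => /eqP e; rewrite -(ss j) e /s tpermR.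
have [] := separated_vanish supp sep rel' sj.
by rewrite /renumber /= ss /s tpermR.
Qed.

Lemma separation (w : 'I_3 -> C R) :
  (exists l, forall j, j != l -> w j != w l) \/ (forall j k, w j = w k).
Proof.
have all3 : w i0 = w i1 -> w i0 = w i2 -> forall j k, w j = w k.
  move=> h1 h2 j k; case: (uniq3_in j uniq012) => ->; case: (uniq3_in k uniq012) => ->;
  by rewrite -?h1 -?h2.
have sep l a b : uniq [:: l; a; b] -> w a != w l -> w b != w l ->
    exists l, forall j, j != l -> w j != w l.
  move=> h ha hb; exists l => j; case: (uniq3_in j h) => -> //; by rewrite eqxx.
have [e01|n01] := eqVneq (w i0) (w i1); have [e02|n02] := eqVneq (w i0) (w i2).
- by right; apply: all3.
- by left; apply: (@sep i2 i0 i1) => //; rewrite -e01.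
- by left; apply: (@sep i1 i0 i2) => //; rewrite -e02.
by left; apply: (@sep i0 i1 i2) => //; rewrite eq_sym.
Qed.

Lemma rotation_weightE E l j k : permutation_condition E -> uniq [:: l; j; k] ->
  rotation_weight E l = (E j k l)^* * E l j k + (E k j l)^* * E l k j.
Proof.
move=> supp h; exact: (@two_terms_right R E supp (C R)^o (fun i i' => E l i i')
   (fun z => z^*) l j k (conjC0 _) h).
Qed.

(** Lagrange's identity for the two side vectors of index l. *)
Lemma side_det_norm E l j k : permutation_condition E -> uniq [:: l; j; k] ->
  left_weight E l * right_weight E l =
  `|rotation_weight E l| ^+ 2 + `|side_det E l j k| ^+ 2.
Proof.
move=> supp h; rewrite (left_weightE supp h) (right_weightE supp h).
rewrite (rotation_weightE supp h) /side_det !normCK.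
rewrite [X in _ = X + _]mulrC [(_ + _)^*]rmorphD [(_ - _)^*]rmorphB /= ![(_ * _)^*]rmorphM /= !conjCK. ring.
Qed.

Lemma side_det_equal E : permutation_condition E ->
  (forall j k, rotation_weight E j = rotation_weight E k) ->
  (forall j k, left_weight E j * right_weight E j = left_weight E k * right_weight E k) ->
  side_det E i0 i1 i2 != 0 -> forall l j k, uniq [:: l; j; k] -> side_det E l j k != 0.
Proof.
move=> supp hr hw d0 l j k h.
have := hw l i0; rewrite (side_det_norm supp h) (side_det_norm supp uniq012) (hr l i0).
move/addrI => e; apply: contraNneq d0 => d; move: e; rewrite d normr0 expr0n /=.
by move/esym/eqP; rewrite expf_eq0 normr_eq0.
Qed.

Lemma side_det_zero E : permutation_condition E ->
  (forall j k, rotation_weight E j = rotation_weight E k) ->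
  (forall j k, left_weight E j * right_weight E j = left_weight E k * right_weight E k) ->
  side_det E i0 i1 i2 = 0 -> forall l j k, uniq [:: l; j; k] -> side_det E l j k = 0.
Proof.
move=> supp hr hw d0 l j k h.
have := hw l i0; rewrite (side_det_norm supp h) (side_det_norm supp uniq012) (hr l i0).
move/addrI; rewrite d0 normr0 expr0n /= => /eqP.
by rewrite expf_eq0 normr_eq0 => /eqP.
Qed.

Lemma Apkm_classified E (p s t : C R) : p != 0 -> s ^+ 3 = 1 -> t ^+ 3 = 1 ->
  E = perm_array 1 p (p * s) t t^-1 (p * s^-1) -> classified E.
Proof.
move=> p0 /cube_root [k ->] /cube_root [m ->] ->.
by exists (Apkm p k m) => // G; rewrite /= /A_array.
Qed.

Lemma SUpm_classified E (p t : C R) : p != 0 -> t ^+ 3 = 1 ->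
  E = perm_array 1 p (p * t^-1) (`|p| ^+ 2 * t) (`|p| ^+ 2 * t^-1) (`|p| ^+ 2 * p * t) ->
  classified E.
Proof.
move=> p0 /cube_root [m ->] ->.
by exists (SUpm p m) => // G; rewrite /= /SU_array.
Qed.

Lemma scaled_perm_array (z e1 e2 e3 e4 e5 e6 : C R) :
  scaled z (perm_array e1 e2 e3 e4 e5 e6) =
  perm_array (z * e1) (z * e2) (z * e3) (z * e4) (z * e5) (z * e6).
Proof.
apply/funext => a; apply/funext => b; apply/funext => c; rewrite /scaled.
by case: (uniq3_in a uniq012) => ->; case: (uniq3_in b uniq012) => ->;
  case: (uniq3_in c uniq012) => ->; rewrite /perm_array /= ?mulr0.
Qed.

Lemma scaled_array E z : permutation_condition E -> scaled z E =
  scaled z (perm_array (E i0 i1 i2) (E i0 i2 i1) (E i1 i0 i2) (E i1 i2 i0) (E i2 i0 i1) (E i2 i1 i0)).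
Proof. by move=> supp; rewrite -array_eq. Qed.

(** The ratios of consecutive entries along each of the two cyclic orders square to
    each other, so they are cube roots of unity. *)
Lemma rotation_covariant_classified E : permutation_condition E ->
  (forall a b c, uniq [:: a; b; c] -> E b c a ^+ 2 = E a b c * E c a b) -> classified E.
Proof.
move=> supp cyc; have n a b c (h : uniq [:: a; b; c]) := supp_neq0 supp h.
have n1 := n i0 i1 i2 isT; have n2 := n i0 i2 i1 isT.
have h1 := cyc i0 i1 i2 isT; have h2 := cyc i1 i2 i0 isT.
have h3 := cyc i0 i2 i1 isT; have h4 := cyc i2 i1 i0 isT.
pose x := E i1 i2 i0 / E i0 i1 i2; pose y := E i2 i0 i1 / E i0 i1 i2.
pose s := E i1 i0 i2 / E i0 i2 i1; pose t := E i2 i1 i0 / E i0 i2 i1.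
have xy : x ^+ 2 = y by rewrite /x expr_div_n h1 /y; field.
have yx : y ^+ 2 = x by rewrite /y expr_div_n h2 /x; field.
have ts : t ^+ 2 = s by rewrite /t expr_div_n h3 /s; field.
have st : s ^+ 2 = t by rewrite /s expr_div_n h4 /t; field.
have cube (z z' : C R) : z != 0 -> z ^+ 2 = z' -> z' ^+ 2 = z -> z ^+ 3 = 1 /\ z' = z^-1.
  move=> z0 e1 e2; have z3 : z ^+ 3 = 1.
    by apply: (mulfI z0); rewrite mulr1 -[RHS]e2 -e1; ring.
  by split=> //; rewrite cube_rootV.
have x0 : x != 0 by rewrite mulf_neq0 ?invr_neq0 // n.
have s0 : s != 0 by rewrite mulf_neq0 ?invr_neq0 // n.
have [x3 yE] := cube _ _ x0 xy yx; have [s3 tE] := cube _ _ s0 st ts.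
apply: (@classified_scaled_inv R (E i0 i1 i2)^-1); first by rewrite invr_eq0.
apply: (@Apkm_classified _ (E i0 i2 i1 / E i0 i1 i2) s x) => //.
  by rewrite mulf_neq0 ?invr_neq0.
rewrite scaled_array // scaled_perm_array -yE -tE /x /y /s /t.
by congr perm_array; field; rewrite ?n1 ?n2.
Qed.

(** Both c2 ^ 3 and c3 / c2 are positive, so c2 and c3 have the same argument, that of
    a cube root of unity; the moduli then satisfy two equations that factor. *)
Lemma pos_cube (c2 c3 P : C R) : c2 != 0 -> c3 != 0 -> 0 < P ->
  (c2 * c3)^* * (1 + P) = c2 * (P + `|c3| ^+ 2) ->
  c2 * (P + `|c3| ^+ 2) = c3 * (1 + P * `|c2| ^+ 2) ->
  exists2 w : C R, w ^+ 3 = 1 & [/\ c2 = `|c2| * w, c3 = `|c3| * w &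
    (`|c2| = 1 \/ `|c2| = P^-1) /\ (`|c3| = 1 \/ `|c3| = P)].
Proof.
move=> c20 c30 P0 e1 e2; set r2 := `|c2|; set r3 := `|c3|.
have r20 : 0 < r2 by rewrite normr_gt0.
have r30 : 0 < r3 by rewrite normr_gt0.
have n2 : c2^* * c2 = r2 ^+ 2 by rewrite /r2 normCK mulrC.
have n3 : c3^* * c3 = r3 ^+ 2 by rewrite /r3 normCK mulrC.
rewrite -/r3 in e1 e2; rewrite -/r2 in e2; rewrite rmorphM /= in e1.
have u0 : 0 < 1 + P by rewrite addr_gt0.
have a0 : 0 < P + r3 ^+ 2 by rewrite addr_gt0 ?exprn_gt0.
have b0 : 0 < 1 + P * r2 ^+ 2 by rewrite addr_gt0 ?mulr_gt0 ?exprn_gt0.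
have nz x : 0 < x -> x != 0 :> C R by move=> x0; rewrite gt_eqF.
have s1 : c2 ^+ 2 * c3 = r2 ^+ 2 * r3 ^+ 2 * (1 + P) / (P + r3 ^+ 2).
  apply: (mulIf (nz _ a0)); rewrite divfK ?nz //.
  have -> : c2 ^+ 2 * c3 * (P + r3 ^+ 2) = c2 * c3 * (c2 * (P + r3 ^+ 2)) by ring.
  by rewrite -e1 -n2 -n3; ring.
have rat : c3 = c2 * ((P + r3 ^+ 2) / (1 + P * r2 ^+ 2)).
  apply: (mulIf (nz _ b0)); rewrite -e2; field; exact: nz.
have k0 : 0 < (P + r3 ^+ 2) / (1 + P * r2 ^+ 2) by rewrite divr_gt0.
have kE : (P + r3 ^+ 2) / (1 + P * r2 ^+ 2) = r3 / r2.
  rewrite -(gtr0_norm k0); apply: (mulfI (nz _ r20)).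
  by rewrite [RHS]mulrC divfK ?nz // {1}/r2 -normrM -rat.
have cube : c2 ^+ 3 = r2 ^+ 3.
  have c3pos : 0 < c2 ^+ 3.
    have -> : c2 ^+ 3 = c2 ^+ 2 * c3 / (r3 / r2).
      by rewrite rat kE; field; rewrite !nz.
    by rewrite s1 !(divr_gt0, mulr_gt0) ?exprn_gt0.
  by rewrite -(gtr0_norm c3pos) normrX.
pose w := c2 / r2; exists w; first by rewrite expr_div_n cube divff // expf_neq0 // nz.
have w0 : w != 0 by rewrite mulf_neq0 ?invr_neq0 // nz.
have w3 : w ^+ 3 = 1 by rewrite expr_div_n cube divff // expf_neq0 // nz.
have c2E : c2 = r2 * w by rewrite mulrC divfK // nz.
have c3E : c3 = r3 * w.
  by rewrite rat kE /w; field; rewrite nz.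
have wc : w^* = w ^+ 2.
  have w1 : `|w| = 1 by rewrite normrM normfV normr_id divff // nz.
  by apply: (mulfI w0); rewrite conj_norm1 // -exprS w3.
have rc (r : C R) : 0 < r -> r^* = r by move=> r0; apply/CrealP/gtr0_real.
clearbody w r2 r3.
have f1 : r2 * r3 * (1 + P) = r2 * (P + r3 ^+ 2).
  apply: (mulfI w0); move: e1; rewrite c2E c3E !rmorphM /= (rc r2 r20) (rc r3 r30) wc.
  have -> : r2 * w ^+ 2 * (r3 * w ^+ 2) * (1 + P) = w ^+ 3 * (w * (r2 * r3 * (1 + P))) by ring.
  by rewrite w3 mul1r => ->; ring.
have f2 : r2 * (P + r3 ^+ 2) = r3 * (1 + P * r2 ^+ 2).
  by apply: (mulfI w0); move: e2; rewrite c2E c3E => e; rewrite mulrCA mulrA e; ring.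
split=> //; split.
  have : (r2 - 1) * (P * r2 - 1) = 0.
    apply: (mulfI (nz _ r30)); rewrite mulr0.
    have -> : r3 * ((r2 - 1) * (P * r2 - 1)) = r3 * (1 + P * r2 ^+ 2) - r2 * r3 * (1 + P) by ring.
    by rewrite -f2 f1 subrr.
  move=> /eqP; rewrite mulf_eq0 !subr_eq0 => /orP[/eqP|/eqP h]; first by left.
  by right; apply: (mulfI (nz _ P0)); rewrite h divff // nz.
have : (r3 - 1) * (r3 - P) = 0.
  apply: (mulfI (nz _ r20)); rewrite mulr0.
  have -> : r2 * ((r3 - 1) * (r3 - P)) = r2 * (P + r3 ^+ 2) - r2 * r3 * (1 + P) by ring.
  by rewrite f1 subrr.
by move=> /eqP; rewrite mulf_eq0 !subr_eq0 => /orP[/eqP|/eqP]; [left|right].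
Qed.

Definition rot3 (i : 'I_3) : 'I_3 :=
  match nat_of_ord i with 0%N => i1 | 1%N => i2 | _ => i0 end.
Definition rot3V (i : 'I_3) : 'I_3 :=
  match nat_of_ord i with 0%N => i2 | 1%N => i0 | _ => i1 end.
Definition swap3 (i : 'I_3) : 'I_3 :=
  match nat_of_ord i with 0%N => i1 | 1%N => i0 | _ => i2 end.

Lemma rot3K : cancel rot3 rot3V.
Proof. by move=> i; case: (uniq3_in i uniq012) => ->. Qed.
Lemma rot3VK : cancel rot3V rot3.
Proof. by move=> i; case: (uniq3_in i uniq012) => ->. Qed.
Lemma swap3K : cancel swap3 swap3.
Proof. by move=> i; case: (uniq3_in i uniq012) => ->. Qed.

Lemma rot3_perm_array (e1 e2 e3 e4 e5 e6 : C R) :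
  renumbered rot3 (perm_array e1 e2 e3 e4 e5 e6) = perm_array e4 e3 e6 e5 e1 e2.
Proof.
apply/funext => a; apply/funext => b; apply/funext => c.
by case: (uniq3_in a uniq012) => ->; case: (uniq3_in b uniq012) => ->;
  case: (uniq3_in c uniq012) => ->.
Qed.

Lemma swap3_perm_array (e1 e2 e3 e4 e5 e6 : C R) :
  renumbered swap3 (perm_array e1 e2 e3 e4 e5 e6) = perm_array e3 e4 e1 e2 e6 e5.
Proof.
apply/funext => a; apply/funext => b; apply/funext => c.
by case: (uniq3_in a uniq012) => ->; case: (uniq3_in b uniq012) => ->;
  case: (uniq3_in c uniq012) => ->.
Qed.

(** Parallel side vectors leave three parameters p, c2, c3. The equality of the
    rotation weights allows four pairs of moduli: one of them gives the arrays of
    A_{p,k,m}, and the three others are renumberings of those of SU_{p,m}. *)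
Lemma parallel_sides_normalized E : permutation_condition E -> E i0 i1 i2 = 1 ->
  (forall l j k, uniq [:: l; j; k] -> side_det E l j k = 0) ->
  (forall j k, rotation_weight E j = rotation_weight E k) -> classified E.
Proof.
move=> supp one par hr; have n a b c (h : uniq [:: a; b; c]) := supp_neq0 supp h.
pose p := E i0 i2 i1; pose c2 := E i1 i0 i2 / p; pose c3 := E i2 i0 i1.
have p0 : p != 0 by apply: n.
have c20 : c2 != 0 by rewrite mulf_neq0 ?invr_neq0 // n.
have c30 : c3 != 0 by apply: n.
have E102 : E i1 i0 i2 = p * c2 by rewrite mulrC divfK.
have E210 : E i2 i1 i0 = p * E i1 i2 i0.
  have := par i0 i1 i2 isT; rewrite /side_det one mul1r => /eqP.
  by rewrite subr_eq0 => /eqP.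
have E120 : E i1 i2 i0 = c2 * c3.
  have := par i1 i0 i2 isT; rewrite /side_det => /eqP; rewrite subr_eq0 => /eqP.
  rewrite E102 -/p -/c3 => h; apply: (mulIf p0); rewrite -h; ring.
rewrite E120 in E210.
have EE : E = perm_array 1 p (p * c2) (c2 * c3) c3 (p * (c2 * c3)).
  by rewrite [LHS](array_eq supp) one E102 E120 E210.
have P0 : 0 < `|p| ^+ 2 by rewrite exprn_gt0 ?normr_gt0.
have w0 := rotation_weightE supp (isT : uniq [:: i0; i1; i2]).
have w1 := rotation_weightE supp (isT : uniq [:: i1; i0; i2]).
have w2 := rotation_weightE supp (isT : uniq [:: i2; i0; i1]).
rewrite one E120 E210 -/p mulr1 in w0.
rewrite -/p E102 -/c3 E120 in w1.
rewrite one E102 E210 -/c3 conjC1 mul1r in w2.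
have [] := @pos_cube c2 c3 (`|p| ^+ 2) c20 c30 P0.
- have := hr i0 i1; rewrite w0 w1 !normCK rmorphM /= => h.
  apply: etrans (etrans h _); first by rewrite !rmorphM /=; ring.
  by ring.
- have := hr i1 i2; rewrite w1 w2 !normCK => h.
  apply: etrans (etrans h _); first by ring.
  by rewrite !rmorphM /=; ring.
move=> w w3 [h2 h3 [c2v c3v]].
have ww : w^-1 = w ^+ 2 by apply: cube_rootV.
have wn : w != 0 by apply: cube_root_neq0.
have w6 : (w ^+ 2) ^+ 3 = 1 by rewrite -exprM mulnC exprM w3 expr1n.
have wV : (w ^+ 2)^-1 = w by rewrite -ww invrK.
have w1n : `|w| = 1.
  by apply/eqP; rewrite -(@eqrXn2 _ 3) // -normrX w3 normr1 expr1n.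
have Pn : `|p| ^+ 2 != 0 by rewrite gt_eqF.
rewrite EE h2 h3; case: c2v => ->; case: c3v => ->.
- apply: (@Apkm_classified _ p w (w ^+ 2)) => //.
  by rewrite wV ww !mul1r -expr2.
- apply: (@SUpm_classified _ p (w ^+ 2)) => //.
  by rewrite wV; congr perm_array; ring.
- apply: (classified_renumbered rot3K rot3VK); rewrite rot3_perm_array.
  apply: (@classified_scaled_inv R (`|p| ^+ 2 * w)); first by rewrite mulf_neq0.
  rewrite scaled_perm_array; apply: (@SUpm_classified _ (p * w ^+ 2) (w ^+ 2)) => //.
    by rewrite mulf_neq0 // expf_neq0.
  have -> : `|p * w ^+ 2| = `|p| by rewrite normrM normrX w1n expr1n mulr1.
  have e z : z * w ^+ 3 = z by rewrite w3 mulr1.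
  rewrite wV; move: Pn; set P := _ ^+ 2 => Pn.
  congr perm_array.
  + by rewrite -[RHS]w3; field.
  + by field.
  + by rewrite -[RHS]mulrA -exprSr e -[RHS]e; field.
  + by ring.
  + by ring.
  + by rewrite -[LHS]e; ring.
apply: (classified_renumbered swap3K swap3K); rewrite swap3_perm_array.
apply: (@classified_scaled_inv R (p^* * w ^+ 2)).
  by rewrite mulf_neq0 ?conjC_eq0 // expf_neq0.
rewrite scaled_perm_array; apply: (@SUpm_classified _ (p^* * w) (w ^+ 2)) => //.
  by rewrite mulf_neq0 ?conjC_eq0.
have -> : `|p^* * w| = `|p| by rewrite normrM norm_conjC w1n mulr1.
have e z : z * w ^+ 3 = z by rewrite w3 mulr1.
rewrite wV; have PE : `|p| ^+ 2 = p * p^* by rewrite normCK.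
have pc0 : p^* != 0 by rewrite conjC_eq0.
congr perm_array.
+ by rewrite -[RHS]w3 PE; field; rewrite p0 pc0.
+ by rewrite -[RHS]e PE; field; rewrite p0 pc0.
+ by ring.
+ by rewrite PE; ring.
+ by rewrite -[RHS]e PE; field; rewrite p0 pc0.
+ by rewrite PE; ring.
Qed.

Lemma rotation_weight_scaled E z l :
  rotation_weight (scaled z E) l = z^* * z * rotation_weight E l.
Proof.
rewrite /rotation_weight mulr_sumr; apply: eq_bigr => a _.
rewrite mulr_sumr; apply: eq_bigr => b _.
by rewrite /scaled rmorphM /=; ring.
Qed.

Lemma scaled_supp E z : z != 0 -> permutation_condition E ->
  permutation_condition (scaled z E).
Proof. by move=> z0 supp a b c; rewrite /scaled mulf_eq0 (negPf z0); exact: supp. Qed.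

Lemma parallel_sides_classified E : permutation_condition E ->
  (forall l j k, uniq [:: l; j; k] -> side_det E l j k = 0) ->
  (forall j k, rotation_weight E j = rotation_weight E k) -> classified E.
Proof.
move=> supp par hr; have n1 := supp_neq0 supp uniq012.
have z0 : (E i0 i1 i2)^-1 != 0 by rewrite invr_neq0.
apply: (classified_scaled_inv z0); apply: parallel_sides_normalized.
- exact: scaled_supp.
- by rewrite /scaled mulVf.
- move=> l j k /par; rewrite /side_det /scaled => /eqP; rewrite subr_eq0 => /eqP h.
  by rewrite mulrACA h; ring.
- by move=> j k; rewrite !rotation_weight_scaled (hr j k).
Qed.

(** Either an intertwiner splits off a one-dimensional block, or the determinants of
    the three pairs of side vectors have the same modulus: they all vanish or none
    does. *)
Theorem every_array_classified E : permutation_condition E -> classified E.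
Proof.
move=> supp.
have [[l hl]|hr] := separation (rotation_weight E).
  by apply: (@separated_classified E l) => //; left.
have [[l hl]|hw] := separation (fun j => left_weight E j * right_weight E j).
  by apply: (@separated_classified E l) => //; right.
have [d0|d0] := eqVneq (side_det E i0 i1 i2) 0.
  by apply: parallel_sides_classified => //; apply: side_det_zero.
have sd := side_det_equal supp hr hw d0.
have [cyc|] := pselect (forall a b c, uniq [:: a; b; c] ->
    E b c a ^+ 2 = E a b c * E c a b).
  exact: rotation_covariant_classified.
move/existsNP => [a /existsNP [b /existsNP [c /not_implyP [h /eqP ne]]]].
exists Torus => // G; apply: PW_diagonal_torus => // B u rel.
exact: (independent_sides_diagonal supp rel sd h ne).
Qed.

Lemma cqg_iso_refl (G : cqg R) : cqg_iso G G.
Proof.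
exists idfun, idfun; split=> //; by exists id.
Qed.

Lemma perm_array_rotation_weight (e1 e2 e3 e4 e5 e6 : C R) : e1 != 0 -> e2 != 0 ->
  e3 != 0 -> e4 != 0 -> e5 != 0 -> e6 != 0 ->
  let E := perm_array e1 e2 e3 e4 e5 e6 in
  [/\ rotation_weight E i0 = e4^* * e1 + e6^* * e2,
     rotation_weight E i1 = e2^* * e3 + e5^* * e4 &
     rotation_weight E i2 = e1^* * e5 + e3^* * e6].
Proof.
move=> h1 h2 h3 h4 h5 h6 E.
have supp : permutation_condition E by apply: perm_array_supp.
split.
- by rewrite (rotation_weightE supp (isT : uniq [:: i0; i1; i2])).
- by rewrite (rotation_weightE supp (isT : uniq [:: i1; i0; i2])).
by rewrite (rotation_weightE supp (isT : uniq [:: i2; i0; i1])).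
Qed.

Lemma separated0 E : rotation_weight E i1 != rotation_weight E i0 ->
  rotation_weight E i2 != rotation_weight E i0 -> separated E i0.
Proof.
move=> h1 h2; left=> j; case: (uniq3_in j uniq012) => -> //; by rewrite eqxx.
Qed.

(** Only the torus and U_q(2) call for a choice of E: it has to satisfy the conditions
    of the block case, with a rotation weight that separates the index 0; the
    factor 1/2 ensures this for all q. *)
Lemma every_member_realized (l : listed R) : admissible l ->
  exists2 E : array R, permutation_condition E &
    forall G, is_member l G -> PW_quantum_group E G.
Proof.
have z3 := zeta_cube R; have z0 : zeta R != 0 := cube_root_neq0 z3.
have zn k : zeta R ^+ k != 0 by rewrite expf_neq0.
have one : (1 : C R) != 0 by rewrite oner_eq0.
have blk E : permutation_condition E -> separated E i0 ->
    forall (B : cstarType R) (u : 'I_3 * 'I_3 -> B), PW_relations E u -> block u.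
  by move=> supp sep B u rel j j0; exact: (separated_vanish supp sep rel j0).
case: l => [_|q q0|p k m p0|p m p0].
- have two : (2 : C R) != 0 by rewrite pnatr_eq0.
  have supp : permutation_condition (perm_array (1 : C R) 1 2 1 1 1) by apply: perm_array_supp.
  exists (perm_array 1 1 2 1 1 1) => // G; apply: torus_PW_diagonal => // B u rel.
  have [w0 w1 w2] := perm_array_rotation_weight one one two one one one.
  have sep : separated (perm_array (1 : C R) 1 2 1 1 1) i0.
    apply: separated0; rewrite w0 ?w1 ?w2 ?conjC_nat ?conjC1 -subr_eq0.
      by rewrite (_ : _ - _ = 1) ?oner_eq0 //; ring.
    by rewrite (_ : _ - _ = 1) ?oner_eq0 //; ring.
  apply: (block_diagonal supp rel (blk _ supp sep _ _ rel)).
  rewrite /perm_array /= conjC1 !mulr1 negb_and; apply/orP; right.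
  by rewrite eq_sym -[X in _ != X]/(1%:R) eqr_nat.
- simpl in q0.
  have qn : - q != 0 by rewrite oppr_eq0.
  have h0 : (2^-1 : C R) != 0 by rewrite invr_neq0 // pnatr_eq0.
  have qc : - (q^* / 2) != 0 by rewrite oppr_eq0 mulf_neq0 // conjC_eq0.
  pose E := perm_array 1 (- q) 2^-1 1 (- (q^* / 2)) (- q).
  have supp : permutation_condition E by apply: perm_array_supp.
  have sr : side_ratio E = q by rewrite /side_ratio /E /perm_array /= divr1 opprK.
  have c2 : (2^-1 : C R)^* = 2^-1 by rewrite fmorphV /= conjC_nat.
  have [w0 w1 w2] := perm_array_rotation_weight one qn h0 one qc qn.
  have sep : separated E i0.
    have dif : 0 < (1 + q / 2) * (1 + q / 2)^* + 3 / 4 * (q * q^*).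
      have q2 : 0 < `|q| ^+ 2 by rewrite exprn_gt0 // normr_gt0.
      by rewrite -!normCK ltr_wpDl ?exprn_ge0 // mulr_gt0.
    have c1 : (1 + q / 2)^* = 1 + q^* / 2 by rewrite rmorphD rmorph1 rmorphM /= c2.
    rewrite c1 in dif.
    have cc : (- (q^* / 2))^* = - (q / 2) by rewrite rmorphN /= rmorphM /= conjCK c2.
    apply: separated0; rewrite -/E in w0 w1 w2; rewrite w0 ?w1 ?w2 eq_sym -subr_eq0.
      rewrite cc conjC1 [(- q)^*]rmorphN /=.
      by rewrite (_ : _ - _ = (1 + q / 2) * (1 + q^* / 2) + 3 / 4 * (q * q^*)) ?gt_eqF //; field.
    rewrite conjC1 c2 [(- q)^*]rmorphN /=.
    by rewrite (_ : _ - _ = (1 + q / 2) * (1 + q^* / 2) + 3 / 4 * (q * q^*)) ?gt_eqF //; field.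
  exists E => // G hG; apply: Uq2_PW_block => //; last by rewrite sr.
  + by rewrite /E /perm_array /=; ring.
  + by rewrite /E /perm_array /= conjC1 rmorphN /=; ring.
  + exact: blk.
- exists (A_array p k m) => //; simpl in p0.
  by apply: perm_array_supp; rewrite ?(mulf_neq0, invr_neq0, zn, p0).
exists (SU_array p m) => //; simpl in p0.
have np : `|p| ^+ 2 != 0 by rewrite expf_neq0 // normr_eq0.
by apply: perm_array_supp => //; do ?[exact: p0|exact: np|exact: zn|
  exact: invr_neq0|apply: mulf_neq0].
Qed.

End Classification.

Theorem theorem2p3 (R : realType) :
  (forall E : array R, permutation_condition E ->
     exists2 l : listed R, admissible l &
       forall G : cqg R, PW_quantum_group E G ->
         exists L : cqg R, is_member l L /\ cqg_iso G L) /\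
  (forall l : listed R, admissible l ->
     exists2 E : array R, permutation_condition E &
       forall L : cqg R, is_member l L ->
         exists G : cqg R, PW_quantum_group E G /\ cqg_iso L G).
Proof.
split=> [E /every_array_classified [l al h]|l /every_member_realized [E supp h]].
  by exists l => // G hG; exists G; split; [exact: h|exact: cqg_iso_refl].
by exists E => // L hL; exists L; split; [exact: h|exact: cqg_iso_refl].
Qed.
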